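(* Let $p\in[1,n)$ and let $K$ be a compact set in $\mathbb{R}^n$. For any $\tau\in[-1,1]$, one has $$C_{p,\tau}(K)=\inf_{f\in C_c^\infty\cap\mathcal{D}(K)}\mathcal{H}_{p,\tau}(f)=\inf_{f\in C_c^\infty\cap\mathcal{E}(K)}\mathcal{H}_{p,\tau}(f)=\inf_{f\in C_c^\infty\cap\mathcal{F}(K)}\mathcal{H}_{p,\tau}(f).$$
   Context: $C_c^\infty$ is the set of smooth functions with compact support in $\mathbb{R}^n$, and $W_0^{1,p}$ is the closure of $C_c^\infty$ under the norm $\|f\|_{1,p}=\|f\|_p+\|\nabla f\|_p$; for $f\in W_0^{1,p}$, $\nabla f$ is the weak gradient. $du$ is the normalized spherical measure on the unit sphere $S^{n-1}$ (total mass $1$). For $\tau\in[-1,1]$ and $t\in\mathbb{R}$ let $\varphi_\tau(t)=\big(\tfrac{1+\tau}{2}\big)^{1/p}t_++\big(\tfrac{1-\tau}{2}\big)^{1/p}t_-$, with $t_+=\max\{t,0\}$ and $t_-=\max\{-t,0\}$. For $f\in W_0^{1,p}$ let $$\mathcal{H}_{p,\tau}(f)=\Big(\int_{S^{n-1}}\Big(\int_{\mathbb{R}^n}[\varphi_\tau(u\cdot\nabla f(x))]^p\,dx\Big)^{-n/p}du\Big)^{-p/n}.$$ For a compact set $K\subset\mathbb{R}^n$ with indicator function $\mathbf{1}_K$, let $$\mathcal{D}(K)=\{f\in W_0^{1,p}:\ f\ge1\text{ on }K\},$$ $$\mathcal{E}(K)=\{f:\ f\in W_0^{1,p},\ f\ge\mathbf{1}_K\},$$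 $$\mathcal{F}(K)=\{f:\ f\in W_0^{1,p},\ 0\le f\le1\text{ in }\mathbb{R}^n,\text{ and } f=1\text{ in a neighborhood of }K\}.$$ The general $p$-affine capacity of a compact set $K$ is defined by $$C_{p,\tau}(K)=\inf_{f\in\mathcal{E}(K)}\mathcal{H}_{p,\tau}(f).$$ *)

(* Defs.v *)
From HB Require Import structures.
From mathcomp Require Import all_boot all_order all_algebra.
From mathcomp Require Import all_classical all_reals all_analysis.
From mathcomp Require Import measurable_realfun.

Set Implicit Arguments.
Unset Strict Implicit.
Unset Printing Implicit Defensive.

Import Order.TTheory GRing.Theory Num.Theory.
Import numFieldNormedType.Exports.

Local Open Scope classical_set_scope.
Local Open Scope ring_scope.

(* 'rV[R]_n carries the product of the Borel sigma-algebras of R, i.e. the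
   Borel sigma-algebra of R^n (same construction as for n.-tuple T). *)
Definition rV_display : measure_display.
Proof. by constructor. Qed.

Section measurable_rV.
Variables (R : realType) (n : nat).

Let coors : 'I_n -> 'rV[R]_n -> measurableTypeR R := fun i x => x ord0 i.

Let rV_set0 : g_sigma_preimage coors set0.
Proof. exact: sigma_algebra0. Qed.

Let rV_setC A : g_sigma_preimage coors A -> g_sigma_preimage coors (~` A).
Proof. exact: sigma_algebraC. Qed.

Let rV_bigcup (F : (set 'rV[R]_n)^nat) :
  (forall i, g_sigma_preimage coors (F i)) ->
  g_sigma_preimage coors (\bigcup_i (F i)).
Proof. exact: sigma_algebra_bigcup. Qed.

HB.instance Definition _ := @isMeasurable.Build rV_display
  'rV[R]_n (g_sigma_preimage coors) rV_set0 rV_setC rV_bigcup.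

Lemma measurable_coord (i : 'I_n) :
  measurable_fun setT (fun x : 'rV[R]_n => x ord0 i).
Proof.
move=> _ Y mY; rewrite setTI; apply: sub_sigma_algebra => /=.
rewrite -bigcup_seq/=; exists i => /=; first by rewrite mem_index_enum.
by exists Y => //; rewrite setTI.
Qed.

Lemma measurable_fun_rV d (T : measurableType d) (f : T -> 'rV[R]_n) :
  (forall i, measurable_fun setT (fun t => f t ord0 i)) ->
  measurable_fun setT f.
Proof.
move=> mf; apply: (@measurability _ _ _ _ _ f
  (\big[setU/set0]_(i < n) preimage_set_system setT (coors i) measurable)) => //.
move=> _ [A + <-]; rewrite -bigcup_seq/= => -[i _ [B mB <-]].
by rewrite setTI; apply: mf.
Qed.

End measurable_rV.

Definition vcons (R : realType) (n : nat) (xv : measurableTypeR R * 'rV[R]_n) :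
    'rV[R]_n.+1 :=
  \row_i (if unlift ord0 i is Some j then xv.2 ord0 j else xv.1).

Section vcons_measurable.
Variables (R : realType) (n : nat).

Lemma measurable_vcons : measurable_fun setT (@vcons R n).
Proof.
apply: measurable_fun_rV => i; rewrite /vcons.
under eq_fun do rewrite mxE.
case: unliftP => [j _|_]; last exact: measurable_fst.
exact: (measurableT_comp (@measurable_coord R n j) measurable_snd).
Qed.

End vcons_measurable.

Section lebesgue_step.
Context (R : realType) (n : nat).
Variable mu : {sigma_finite_measure set 'rV[R]_n -> \bar R}.
Local Open Scope ereal_scope.

Definition lebesgue_step : set 'rV[R]_n.+1 -> \bar R :=
  pushforward (@lebesgue_measure R \x mu) (@vcons R n).

Let mvcons := @measurable_vcons R n.

Let step0 : lebesgue_step set0 = 0.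
Proof. exact: measure0. Qed.

Let step_ge0 A : 0 <= lebesgue_step A.
Proof. exact: measure_ge0. Qed.

Let step_sigma_additive : semi_sigma_additive lebesgue_step.
Proof. exact: measure_semi_sigma_additive. Qed.

HB.instance Definition _ := isMeasure.Build _ _ _ lebesgue_step
  step0 step_ge0 step_sigma_additive.

Let lebesgue_step_sigma_finite : sigma_finite setT lebesgue_step.
Proof.
have /sigma_finiteP[F [TF ndF Foo]] := sigma_finiteT (@lebesgue_measure R).
have /sigma_finiteP[G [TG ndG Goo]] := sigma_finiteT mu.
pose tl (x : 'rV[R]_n.+1) : 'rV[R]_n := \row_j x ord0 (lift ord0 j).
have mtl : measurable_fun setT tl.
  apply: measurable_fun_rV => i; rewrite /tl.
  by under eq_fun do rewrite mxE; exact: measurable_coord.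
exists (fun k => ((fun x : 'rV[R]_n.+1 => x ord0 ord0) @^-1` F k) `&`
                 (tl @^-1` G k)).
  rewrite predeqE => x; split=> // _.
  have [i _ Fi] : (\bigcup_k F k) (x ord0 ord0) by rewrite -TF.
  have [j _ Gj] : (\bigcup_k G k) (tl x) by rewrite -TG.
  exists (maxn i j) => //; split => /=.
  - by move: Fi; exact/subsetPset/ndF/leq_maxl.
  - by move: Gj; exact/subsetPset/ndG/leq_maxr.
move=> k; have [mF Fk] := Foo k; have [mG Gk] := Goo k.
split.
  apply: measurableI.
    by rewrite -[X in measurable X]setTI; apply: measurable_coord.
  by rewrite -[X in measurable X]setTI; apply: mtl.
rewrite /lebesgue_step /pushforward (_ : _ @^-1` _ = F k `*` G k).
  by rewrite product_measure1E// lte_mul_pinfty// ge0_fin_numE.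
have tlE y (v : 'rV[R]_n) : tl (vcons (y, v)) = v.
  by apply/rowP => j; rewrite !mxE liftK.
have hdE y (v : 'rV[R]_n) : vcons (y, v) ord0 ord0 = y.
  by rewrite !mxE unlift_none.
by apply/seteqP; split=> -[y v] /=; rewrite tlE hdE.
Qed.

HB.instance Definition _ := Measure_isSigmaFinite.Build _ _ _ lebesgue_step
  lebesgue_step_sigma_finite.
End lebesgue_step.

(* n-dimensional Lebesgue measure as an iterated product, see leb_box. *)
Fixpoint leb (R : realType) (n : nat) :
    {sigma_finite_measure set 'rV[R]_n -> \bar R} :=
  match n with
  | 0 => \d_(0 : 'rV[R]_0)
  | m.+1 => lebesgue_step (leb R m)
  end.
Arguments leb {R n}.

Lemma leb_box (R : realType) (n : nat) (A : 'I_n -> set (measurableTypeR R)) :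
  (forall i, measurable (A i)) ->
  (leb [set x : 'rV[R]_n | forall i, A i (x ord0 i)]
    = \prod_(i < n) lebesgue_measure (A i))%E.
Proof.
elim: n A => [|n IH] A mA.
  rewrite big_ord0 /= diracE mem_set//; by case.
rewrite big_ord_recl -IH//= /lebesgue_step /pushforward.
rewrite -product_measure1E//; last first.
  rewrite (_ : mkset _ = \bigcap_(i in [set: 'I_n])
      (fun x : 'rV[R]_n => x ord0 i) @^-1` A (lift ord0 i)).
    apply: fin_bigcap_measurable => [|i _]; first exact: finite_finset.
    by rewrite -[X in measurable X]setTI; apply: measurable_coord; [|exact: mA].
  by apply/seteqP; split => x /= h i; [move=> _|]; exact: h.
congr (product_measure1 _ _ _).
apply/seteqP; split => -[y v] /=.
  move=> h; split; first by have := h ord0; rewrite mxE unlift_none.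
  by move=> i; have := h (lift ord0 i); rewrite mxE liftK.
move=> [h1 h2] i; rewrite mxE /=; by case: unliftP => [j ->|->].
Qed.

(* The library norm `|x| on 'rV[R]_n is the sup norm, so the Euclidean norm has
   to be introduced separately (both induce the same topology). *)
Section euclidean.
Variables (R : realType) (n : nat).
Implicit Types x y u : 'rV[R]_n.

Definition dot x y : R := \sum_(i < n) x ord0 i * y ord0 i.

Definition enorm x : R := Num.sqrt (dot x x).

Definition eball x (r : R) : set 'rV[R]_n := [set y | enorm (y - x) < r].

Definition esphere : set 'rV[R]_n := [set u | enorm u = 1].

Definition direction x : 'rV[R]_n := (enorm x)^-1 *: x.

Lemma measurable_enorm : measurable_fun setT enorm.
Proof.
apply: (@measurableT_comp _ _ _ _ _ _ (@Num.sqrt R)).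
  by apply: continuous_measurable_fun; exact: sqrt_continuous.
apply: measurable_sum => i.
by apply: measurable_funM; exact: measurable_coord.
Qed.

Lemma measurable_direction : measurable_fun setT direction.
Proof.
apply: measurable_fun_rV => i; rewrite /direction.
under eq_fun do rewrite mxE.
apply: measurable_funM; last exact: measurable_coord.
under eq_fun do rewrite -powR_inv1 ?sqrtr_ge0//.
exact: (measurableT_comp (measurable_powR _) measurable_enorm).
Qed.

Lemma measurable_unit_ball : measurable (eball 0 1).
Proof.
rewrite (_ : eball 0 1 = enorm @^-1` `]-oo, 1[).
  by rewrite -[X in measurable X]setTI; apply: measurable_enorm.
by apply/seteqP; split => x; rewrite /eball /= subr0 in_itv.
Qed.

Let unit_ball_volume_inv_ge0 : 0 <= (fine (leb (eball 0 1)))^-1 :> R.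
Proof. by rewrite invr_ge0 fine_ge0. Qed.

(* Normalized spherical measure as the cone measure
   A |-> |{x in B : x/|x| in A}| / |B|, with B the unit ball.  It is carried by
   esphere: direction x has norm 1 except at the null point x = 0. *)
Definition cone_measure : set 'rV[R]_n -> \bar R :=
  pushforward (mrestr leb measurable_unit_ball) direction.

Let mdirection := measurable_direction.

Let cone_measure0 : cone_measure set0 = 0%E.
Proof. exact: measure0. Qed.

Let cone_measure_ge0 A : (0 <= cone_measure A)%E.
Proof. exact: measure_ge0. Qed.

Let cone_measure_sigma_additive : semi_sigma_additive cone_measure.
Proof. exact: measure_semi_sigma_additive. Qed.

HB.instance Definition _ := isMeasure.Build _ _ _ cone_measure
  cone_measure0 cone_measure_ge0 cone_measure_sigma_additive.

Definition sphere_measure : set 'rV[R]_n -> \bar R :=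
  mscale (NngNum unit_ball_volume_inv_ge0) cone_measure.

HB.instance Definition _ := Measure.on sphere_measure.

End euclidean.
Arguments sphere_measure {R n}.
Arguments esphere {R n}.

Section sobolev.
Variables (R : realType) (n : nat).
Implicit Types (f g phi : 'rV[R]_n -> R) (G : 'rV[R]_n -> 'rV[R]_n).

Definition partial (i : 'I_n) f : 'rV[R]_n -> R :=
  fun x => 'D_(delta_mx ord0 i) f x.

Definition smooth f : Prop := forall s : seq 'I_n,
  let g := foldr partial f s in
  continuous g /\ forall i x, derivable g x (delta_mx ord0 i).

Definition Cc_smooth : set ('rV[R]_n -> R) :=
  [set f | smooth f /\ compact (closure [set x | f x != 0])].

Definition loc_integrable f : Prop := measurable_fun setT f /\
  forall K, compact K -> leb.-integrable K (EFin \o f).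

Definition is_weak_gradient f G : Prop :=
  [/\ loc_integrable f,
      forall i, loc_integrable (fun x => G x ord0 i) &
      forall phi, Cc_smooth phi -> forall i,
        \int[leb]_x (f x * partial i phi x) =
        - \int[leb]_x (G x ord0 i * phi x)].

(* A choice among the weak gradients of f, which agree almost everywhere. *)
Definition weak_gradient f : 'rV[R]_n -> 'rV[R]_n :=
  get [set G | is_weak_gradient f G].

Definition sobolev_norm (p : R) f : \bar R :=
  ('N[leb]_(p%:E) [EFin \o f]
   + 'N[leb]_(p%:E) [EFin \o (@enorm R n \o weak_gradient f)])%E.

Definition W1p (p : R) : set ('rV[R]_n -> R) :=
  [set f | (exists G, is_weak_gradient f G) /\ (sobolev_norm p f < +oo)%E].

Definition W01p (p : R) : set ('rV[R]_n -> R) :=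
  [set f | W1p p f /\
    forall e : R, 0 < e ->
      exists2 phi, Cc_smooth phi & (sobolev_norm p (f \- phi)%R < e%:E)%E].

End sobolev.

Section capacity.
Variables (R : realType) (n : nat).
Implicit Types (f : 'rV[R]_n -> R) (x : 'rV[R]_n) (p tau : R).
Implicit Types (K : set 'rV[R]_n).

(* An element of W_0^{1,p} is a class of functions modulo null sets; pointwise
   conditions on it, such as f >= 1 on K, are conditions on its precise
   representative, the limit of the means over shrinking balls (0 where there is
   no limit).  It does not depend on the representative f, and is f itself for
   continuous f. *)
Definition ball_mean f x (r : R) : R :=
  (fine (leb (eball x r)))^-1 * \int[leb]_(y in eball x r) f y.

Definition precise f x : R :=
  if pselect (cvg (ball_mean f x r @[r --> 0^'+]))
  then lim (ball_mean f x r @[r --> 0^'+]) else 0.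

Definition phi_tau p tau (t : R) : R :=
  ((1 + tau) / 2) `^ p^-1 * Num.max t 0 +
  ((1 - tau) / 2) `^ p^-1 * Num.max (- t) 0.

Definition directional_energy p tau f (u : 'rV[R]_n) : \bar R :=
  \int[leb]_x ((phi_tau p tau (dot u (weak_gradient f x))) `^ p)%:E.

(* Negative powers are written as inverses: in \bar R, 0^-1 = +oo and
   +oo^-1 = 0, whereas `^ gives 0 `^ a = 0 and +oo `^ a = +oo for a < 0. *)
Definition affine_energy p tau f : \bar R :=
  ((\int[sphere_measure]_(u in esphere)
      (directional_energy p tau f u `^ (n%:R / p))^-1) `^ (p / n%:R))^-1%E.

Definition class_D p K : set ('rV[R]_n -> R) :=
  [set f | W01p p f /\ forall x, K x -> 1 <= precise f x].

Definition class_E p K : set ('rV[R]_n -> R) :=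
  [set f | W01p p f /\ forall x, \1_K x <= precise f x].

Definition class_F p K : set ('rV[R]_n -> R) :=
  [set f | [/\ W01p p f, forall x, 0 <= precise f x <= 1 &
    exists U, [/\ open U, K `<=` U & forall x, U x -> precise f x = 1]]].

Definition capacity p tau K : \bar R :=
  ereal_inf (affine_energy p tau @` class_E p K).

End capacity.

(* Main.v *)
Require Import Defs.
From HB Require Import structures.
From mathcomp Require Import all_boot all_order all_algebra.
From mathcomp Require Import all_classical all_reals all_analysis.
From mathcomp Require Import measurable_realfun ring lra.

Set Implicit Arguments.
Unset Strict Implicit.
Unset Printing Implicit Defensive.

Import Order.TTheory GRing.Theory Num.Theory.
Import numFieldNormedType.Exports.

Local Open Scope classical_set_scope.
Local Open Scope ring_scope.

(** The infima over the smooth classes are compared through one-variable smooth functions built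
    from t e^(-d/t): it is a smooth positive part, 1-Lipschitz, nondecreasing and within d of
    max(t, 0).  Composing f in D(K) with a smooth truncation whose slope lies in [0, 1 + h] gives
    an element of F(K) and multiplies the energy by at most (1 + h)^p.

    Conversely let f in E(K), with precise representative at least 1 on K, and let phi be a smooth
    W^(1,p)-approximation of f.  On the set C_j of the points of K at which all means of f - phi
    over balls of radius at most 1/(j+1) exceed 1 - phi - e/2, the function 1 - e - phi is
    dominated by a mean of psi - phi for a smooth psi close to f; such a mean is a limit of convex
    combinations of translates, so the capacity of C_j relative to this obstacle is at most the
    p-energy of psi - phi.  The C_j increase to K.  Smooth maxima and minima make the capacity strongly
    subadditive, hence the bound passes to the union: choose nearly optimal u_j for C_j and cover
    the compact K by finitely many of the open sets where u_j exceeds the obstacle.  Adding the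
    resulting w to phi gives a smooth function exceeding 1 - e on K with gradient close to that
    of f.  No maximal function or differentiation theorem is used, so p = 1 needs no separate
    treatment. *)

(** * Smooth functions *)

(** The hard comparison is [inf_D_le_E]. Membership in E(K) constrains only limits of means over
    shrinking balls, with no rate uniform on [K], so no single scale of averaging gives a lower
    bound on all of [K]. Each C_j restores uniformity, but psi must then be chosen anew for the
    radius 1/(j+1). This is harmless: two smooth functions within eta of f in Sobolev norm differ by
    a p-energy of order eta^p whatever the radius, and only this bound, never psi itself, is carried
    to the union. Obstacle and corrections are handled in the coordinate energy, the integral of the
    sum of |d_i u|^p: it is convex and translation invariant, and its strong subadditivity is a
    pointwise inequality between gradients. The affine energy enters only through estimates E_u(f)
    <= (1 + h)(E_u(g) + h) of directional energies, uniform in the direction u. The additive h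
    covers directions in which E_u(g) vanishes, and monotone convergence removes h at the end. *)

Section flat_function.
Variable R : realType.
Implicit Types (P : {poly R}) (s t : R).

(** The polynomial parameter makes the family closed under differentiation, which a single function
    exp(-1/t) is not; smoothness then follows by one induction. *)
Definition flat P t : R := if 0 < t then P.[t^-1] * expR (- t^-1) else 0.

Lemma horner_le_pow P : exists n, exists2 E, 0 <= E &
  forall s, 0 <= s -> `|P.[s]| <= E * (1 + s) ^+ n.
Proof.
elim/poly_ind: P => [|Q d [n [E E0 hE]]].
  by exists 0%N, 0 => // s _; rewrite horner0 normr0 mul0r.
exists n.+1, (E + `|d|); first by rewrite addr_ge0.
move=> s s0; rewrite !hornerE.
apply: (le_trans (ler_normD _ _)); rewrite mulrDl; apply: lerD.
  rewrite normrM exprSr mulrA; apply: ler_pM => //; first exact: hE.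
  by rewrite ger0_norm// lerDr.
by rewrite ler_peMr// exprn_ege1// lerDl.
Qed.

Lemma horner_le_expR P : exists2 C, 0 <= C & forall s, 0 <= s -> `|P.[s]| <= C * expR s.
Proof.
have [n [E E0 hE]] := horner_le_pow P.
exists (E * (n.+1%:R ^+ n.+1)); first by rewrite mulr_ge0// exprn_ge0.
move=> s s0.
(* This is 1 + x <= e^x at x = s/(n+1); its power n+1 has exactly e^s on the right. *)
have h1 : (1 + s) <= n.+1%:R * expR (s / n.+1%:R).
  apply: (@le_trans _ _ (n.+1%:R * (1 + s / n.+1%:R))).
    by rewrite mulrDr mulr1 mulrCA mulfV ?mulr1 ?lerD2r ?ler1n// pnatr_eq0.
  by rewrite ler_wpM2l// expR_ge1Dx.
have h2 : (1 + s) ^+ n.+1 <= n.+1%:R ^+ n.+1 * expR s.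
  apply: (le_trans (lerXn2r _ _ _ h1)).
  - by rewrite nnegrE addr_ge0.
  - by rewrite nnegrE mulr_ge0 ?expR_ge0.
  - by rewrite exprMn -expRM_natl mulrCA mulfV ?mulr1 ?pnatr_eq0.
apply: (le_trans (hE s s0)); rewrite -mulrA; apply: ler_wpM2l => //.
by apply: le_trans h2; rewrite exprS ler_peMl ?exprn_ge0 ?addr_ge0// lerDl.
Qed.

Lemma flat_le0 P t : t <= 0 -> flat P t = 0.
Proof. by rewrite /flat ltNge => ->. Qed.

Lemma flat_gt0 P t : 0 < t -> flat P t = P.[t^-1] * expR (- t^-1).
Proof. by rewrite /flat => ->. Qed.

Lemma flat_le_sqr P : exists2 C, 0 <= C & forall t, `|flat P t| <= C * t ^+ 2.
Proof.
(* The extra factor s^2 at s = 1/t becomes t^2 on the other side. *)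
have [C C0 hC] := horner_le_expR ('X^2 * P); exists C => // t.
rewrite /flat; case: ifPn => [t0|_]; last by rewrite normr0 mulr_ge0// sqr_ge0.
have := hC t^-1; rewrite invr_ge0 (ltW t0) => /(_ isT).
rewrite hornerM hornerXn normrM [X in _ -> X <= _]normrM (ger0_norm (expR_ge0 _)) => h.
rewrite expRN ler_pdivrMr ?expR_gt0//.
rewrite normrX gtr0_norm ?invr_gt0// exprVn mulrC ler_pdivrMr in h; last by rewrite exprn_gt0.
by rewrite mulrAC.
Qed.

Lemma is_derive_flat P t : is_derive t 1 (flat P) (flat ('X^2 * (P - P^`())) t).
Proof.
have [t0|t0|->] := ltgtP t 0.
- rewrite flat_le0 ?(ltW t0)//.
  apply: (@near_eq_is_derive _ _ _ (cst 0)).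
  near=> s; rewrite flat_le0//; apply: ltW.
  by near: s; apply: lt_nbhsl.
- apply: (@near_eq_is_derive _ _ _ ((horner P \o (@GRing.inv R)) * (expR \o (-%R \o @GRing.inv R)))).
    near=> s; rewrite flat_gt0//.
    by near: s; apply: lt_nbhsr.
  have tn0 : t != 0 by rewrite gt_eqF.
  have dV : is_derive t 1 (@GRing.inv R) (- t ^- 2 *: 1).
    exact: is_deriveV.
  apply: is_derive_eq.
  rewrite flat_gt0// !hornerE/=.
  rewrite /GRing.scale/=. by field.
- rewrite flat_le0//.
  have [C C0 hC] := flat_le_sqr P.
  (* At 0 the quadratic bound makes the difference quotient at most C|h|. *)
  have cv : (fun h : R => h^-1 *: ((flat P \o shift 0) (h *: 1) - flat P 0)) h @[h --> 0^'] --> (0:R).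
    apply/cvgrPdist_le => e e0; near=> h.
    have hn0 : h != 0 by near: h; exact: nbhs_dnbhs_neq.
    rewrite sub0r normrN /= [flat P 0]flat_le0// subr0 addr0 [h *: 1]mulr1 /GRing.scale/= normrM normfV.
    rewrite mulrC ler_pdivrMr ?normr_gt0//.
    apply: (le_trans (hC h)); rewrite -real_normK ?num_real// expr2 mulrA ler_wpM2r//.
    have hs : `|h| <= e / (C + 1).
      near: h; apply: dnbhs0_le; rewrite divr_gt0//; lra.
    apply: (le_trans (ler_wpM2l C0 hs)); rewrite mulrA ler_pdivrMr; last lra.
    by rewrite mulrC ler_pM2l//; lra.
  by split; [apply: cvgP cv | apply/cvg_lim].
Unshelve. all: by end_near.
Qed.

End flat_function.

Section smooth_positive_part.
Variable R : realType.
Implicit Types (d t : R).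

(** For t > 0 this is t e^(-d/t). The inequality 1 + x <= e^x gives both useful bounds: at x = -d/t
    the error at most d, at x = d/t the slope at most 1. As a product with [flat 1] it inherits
    smoothness. *)
Definition spos d t : R := t * flat 1 (d^-1 * t).

Definition dspos d t : R := if 0 < t then (1 + d / t) * expR (- (d / t)) else 0.

Lemma flat1_ge0 t : 0 <= flat 1 t.
Proof. by rewrite /flat hornerC mul1r; case: ifP => // _; exact: expR_ge0. Qed.

Lemma flat1_le1 t : flat 1 t <= 1.
Proof.
rewrite /flat hornerC mul1r; case: ifP => // t0.
by rewrite expR_le1 oppr_le0 invr_ge0 ltW.
Qed.

Lemma spos_le0 d t : 0 < d -> t <= 0 -> spos d t = 0.
Proof. by move=> d0 t0; rewrite /spos flat_le0 ?mulr0// pmulr_rle0// invr_gt0. Qed.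

Lemma spos0 d : spos d 0 = 0.
Proof. by rewrite /spos mul0r. Qed.

Lemma spos_ge0 d t : 0 < d -> 0 <= spos d t.
Proof.
move=> d0; have [t0|t0] := leP t 0; first by rewrite spos_le0.
by rewrite mulr_ge0 ?flat1_ge0// ltW.
Qed.

Lemma spos_le d t : 0 < d -> spos d t <= Num.max t 0.
Proof.
move=> d0; have [t0|t0] := leP t 0; first by rewrite spos_le0.
by rewrite ger_pMr// flat1_le1.
Qed.

Lemma spos_ge d t : 0 < d -> t - d <= spos d t.
Proof.
move=> d0; have [t0|t0] := leP t 0; first by rewrite spos_le0//; lra.
rewrite /spos flat_gt0 ?mulr_gt0 ?invr_gt0// hornerC mul1r invfM invrK.
have := expR_ge1Dx (- (d * t^-1)) => h.
apply: (le_trans _ (ler_wpM2l (ltW t0) h)).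
by rewrite mulrDr mulr1 mulrN mulrCA mulfV ?gt_eqF// mulr1.
Qed.

Lemma is_derive_spos d t : 0 < d -> is_derive t 1 (spos d) (dspos d t).
Proof.
move=> d0.
have d1 : is_derive t 1 (fun t : R => d^-1 * t) d^-1.
  apply: (@is_derive_eq _ _ _ (d^-1 *: id)); by rewrite /GRing.scale/= mulr1.
have d2 : is_derive t 1 (flat 1 \o (fun t : R => d^-1 * t)) (flat 'X^2 (d^-1 * t) * d^-1).
  have := is_derive_flat 1 (d^-1 * t); rewrite derivC subr0 mulr1 => d2.
  exact: is_derive1_comp.
apply: (@is_derive_eq _ _ _ (id * (flat 1 \o (fun t : R => d^-1 * t)))).
rewrite /dspos /= /GRing.scale/= mulr1; have [t0|t0] := leP t 0.
  by rewrite !flat_le0 ?pmulr_rle0 ?invr_gt0// !(mulr0,mul0r,addr0).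
rewrite !flat_gt0 ?pmulr_rgt0 ?invr_gt0// hornerC hornerXn invfM invrK.
have tn0 : t != 0 by rewrite gt_eqF.
have dn0 : d != 0 by rewrite gt_eqF.
set E := expR _; have -> : 1 * E = E by rewrite mul1r.
rewrite mulrDl mul1r addrC; congr (_ + _); rewrite expr2.
have -> : t * (d / t * (d / t) * E / d) = (t / t) * (d / d) * (d / t * E) by ring.
by rewrite !divff// !mul1r.
Qed.

Lemma dspos_ge0 d t : 0 < d -> 0 <= dspos d t.
Proof.
move=> d0; rewrite /dspos; case: ifP => // t0.
by rewrite mulr_ge0 ?expR_ge0// addr_ge0// divr_ge0// ltW.
Qed.

Lemma dspos_le1 d t : 0 < d -> dspos d t <= 1.
Proof.
move=> d0; rewrite /dspos; case: ifP => // t0.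
by rewrite expRN ler_pdivrMr ?expR_gt0// mul1r expR_ge1Dx.
Qed.

Lemma spos_ndecr d : 0 < d -> {homo spos d : x y / x <= y}.
Proof.
move=> d0 x y xy.
have [c _ e] : exists2 c, c \in `[x, y]%R & spos d y - spos d x = dspos d c * (y - x).
  apply: MVT_segment => //; first by move=> z _; exact: is_derive_spos.
  apply: continuous_subspaceT => z; apply/differentiable_continuous/derivable1_diffP.
  by have [] := is_derive_spos z d0.
by rewrite -subr_ge0 e mulr_ge0 ?dspos_ge0// subr_ge0.
Qed.

End smooth_positive_part.

Section derive_chain.
Variables (R : realType) (V : normedModType R).

(** Only derivability of [f] along [v] is known, not differentiability, so the chain rule is applied
    in one variable, on the line through [x]. *)
Lemma is_derive_comp (f : V -> R) (g : R -> R) (x v : V) (df dg : R) :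
  is_derive x v f df -> is_derive (f x) 1 g dg -> is_derive x v (g \o f) (dg * df).
Proof.
move=> [fx <-] [gx <-].
pose h := fun t : R => f (t *: v + x).
have h0 : h 0 = f x by rewrite /h scale0r add0r.
have dh : derivable h 0 1 by exact: (iffLR (derivable1P f x v)).
have dE k : derivable k x v -> 'D_v k x = 'D_1 (fun t : R => k (t *: v + x)) 0 :> R.
  move=> _; rewrite /derive; set u := fun _ => _; set w := fun _ => _.
  suff -> : u = w by [].
  by apply/funext => t; rewrite /u /w /= addr0 scale0r add0r [_%:A]mulr1.
have gh : derivable (g \o h) 0 1.
  apply/derivable1_diffP/differentiable_comp; first exact: (iffLR (derivable1_diffP _ _) dh).
  by rewrite h0; exact: (iffLR (derivable1_diffP _ _) gx).
have gfx : derivable (g \o f) x v by exact: (iffRL (derivable1P (g \o f) x v)).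
split => //; rewrite dE// (dE f)//.
transitivity ('D_1 (g \o h) 0); first exact: erefl.
have gh0 : derivable g (h 0) 1 by rewrite h0; exact: gx.
rewrite -[LHS]derive1E (derive1_comp dh gh0) h0 !derive1E; exact: erefl.
Qed.

End derive_chain.

Section smooth_functions.
Variables (R : realType) (n : nat).
Notation V := 'rV[R]_n.
Notation e_ i := (@delta_mx R 1 n ord0 i).
Implicit Types f g : V -> R.

(** Coinduction principle: it replaces iterated partial derivatives by one stability check. *)
Lemma smooth_coind (Q : (V -> R) -> Prop) :
  (forall f, Q f -> [/\ continuous f, forall i x, derivable f x (e_ i) &
     forall i, Q (partial i f)]) -> forall f, Q f -> smooth f.
Proof.
move=> QP f Qf s; have {Qf} : Q (foldr (@partial R n) f s).
  by elim: s => //= i s /QP[].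
by move=> /QP[].
Qed.

Lemma smooth_continuous f : smooth f -> continuous f.
Proof. by move=> /(_ [::])[]. Qed.

Lemma smooth_derivable f i x : smooth f -> derivable f x (e_ i).
Proof. by move=> /(_ [::])[_]; exact. Qed.

Lemma smooth_partial f i : smooth f -> smooth (partial i f).
Proof. by move=> sf s; have := sf (rcons s i); rewrite foldr_rcons. Qed.

(* The class generated from smooth functions by sums, products and composition with
   the functions [flat P] is stable under partial derivatives, hence smooth. *)
Inductive smooth_gen : (V -> R) -> Prop :=
| smooth_gen_base f : smooth f -> smooth_gen f
| smooth_gen_cst c : smooth_gen (cst c)
| smooth_gen_coord i : smooth_gen (fun x => x ord0 i)
| smooth_gen_add f g : smooth_gen f -> smooth_gen g -> smooth_gen (f \+ g)
| smooth_gen_mul f g : smooth_gen f -> smooth_gen g -> smooth_gen (f \* g)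
| smooth_gen_flat P f : smooth_gen f -> smooth_gen (flat P \o f).

Lemma smooth_gen_stable f : smooth_gen f -> [/\ continuous f,
  forall i x, derivable f x (e_ i) & forall i, smooth_gen (partial i f)].
Proof.
elim=> {f}[f sf|c|j|f g _ [cf df sf] _ [cg dg sg]|f g hf [cf df sf] hg [cg dg sg]|P f hf [cf df sf]].
- split; [exact: smooth_continuous|by move=> *; exact: smooth_derivable|].
  by move=> i; exact/smooth_gen_base/smooth_partial.
- split; [exact: cst_continuous|by move=> i x; exact: (derivable_cst c x (e_ i))|].
  move=> i; rewrite (_ : partial _ _ = cst 0); first exact: smooth_gen_cst.
  by apply/funext => x; rewrite /partial derive_cst.
- have dj i x : is_derive x (e_ i) (fun x : V => x ord0 j) (e_ i ord0 j).
    have h : is_diff x (fun x : V => x ord0 j) (fun x : V => x ord0 j).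
      have lin : linear (fun x : V => x ord0 j) by move=> a u w; rewrite !mxE.
      pose L := GRing.isLinear.Build _ _ _ _ _ lin.
      pose F : {linear V -> R} := HB.pack (fun x : V => x ord0 j) L.
      have cF : continuous F by exact: coord_continuous.
      have dF : differentiable F x by exact: linear_differentiable.
      by apply: DiffDef => //; rewrite (diff_lin _ cF).
    split; first exact/diff_derivable.
    by rewrite deriveE// diff_val.
  split; [exact: coord_continuous| by move=> i x; have [] := dj i x|].
  move=> i; rewrite (_ : partial _ _ = cst (e_ i ord0 j)); first exact: smooth_gen_cst.
  by apply/funext => x; rewrite /partial; have [] := dj i x.
- split=> [x|i x|i]; [exact: (cvgD (cf x) (cg x))|exact: (derivableD (df i x) (dg i x))|].
  rewrite (_ : partial _ _ = partial i f \+ partial i g); first exact: smooth_gen_add.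
  by apply/funext => x; exact: (deriveD (df i x) (dg i x)).
- split=> [x|i x|i]; [exact: (cvgM (cf x) (cg x))|exact: (derivableM (df i x) (dg i x))|].
  rewrite (_ : partial _ _ = (f \* partial i g) \+ (g \* partial i f)).
    by apply: smooth_gen_add; exact: smooth_gen_mul.
  by apply/funext => x; exact: (deriveM (df i x) (dg i x)).
- have dP i x := is_derive_comp (derivableP (df i x)) (is_derive_flat P (f x)).
  split=> [x|i x|i].
  + apply: continuous_comp; first exact: cf.
    apply/differentiable_continuous/derivable1_diffP.
    by have [] := is_derive_flat P (f x).
  + by have [] := dP i x.
  + rewrite (_ : partial _ _ = (flat ('X^2 * (P - P^`())) \o f) \* partial i f).
      by apply: smooth_gen_mul => //; exact: smooth_gen_flat.
    by apply/funext => x; rewrite /partial; have [_ ->] := dP i x.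
Qed.

Lemma smooth_genP f : smooth_gen f -> smooth f.
Proof. by apply: smooth_coind; exact: smooth_gen_stable. Qed.

Lemma eq_smooth f g : f =1 g -> smooth f -> smooth g.
Proof. by move=> /funext ->. Qed.

Lemma smooth_cst c : smooth (cst c : V -> R).
Proof. exact/smooth_genP/smooth_gen_cst. Qed.

Lemma smooth_coord i : smooth (fun x : V => x ord0 i).
Proof. exact/smooth_genP/smooth_gen_coord. Qed.

Lemma smoothD f g : smooth f -> smooth g -> smooth (f \+ g).
Proof. by move=> sf sg; apply/smooth_genP/smooth_gen_add; exact/smooth_gen_base. Qed.

Lemma smoothM f g : smooth f -> smooth g -> smooth (f \* g).
Proof. by move=> sf sg; apply/smooth_genP/smooth_gen_mul; exact/smooth_gen_base. Qed.

Lemma smoothZ c f : smooth f -> smooth (c \*o f).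
Proof. by move=> sf; exact: (smoothM (smooth_cst c) sf). Qed.

Lemma smoothB f g : smooth f -> smooth g -> smooth (f \- g).
Proof.
move=> sf sg; rewrite (_ : f \- g = f \+ (-1 \*o g)).
  exact: (smoothD sf (smoothZ (-1) sg)).
by apply/funext => x /=; rewrite mulN1r.
Qed.

Lemma smooth_flat P f : smooth f -> smooth (flat P \o f).
Proof. by move=> sf; apply/smooth_genP/smooth_gen_flat/smooth_gen_base. Qed.

Lemma smooth_prod (I : Type) (r : seq I) (F : I -> V -> R) :
  (forall i, smooth (F i)) -> smooth (fun x => \prod_(i <- r) F i x).
Proof.
move=> sF; elim: r => [|i r ih].
  by apply: eq_smooth (smooth_cst 1) => x; rewrite big_nil.
by apply: eq_smooth (smoothM (sF i) ih) => x; rewrite big_cons.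
Qed.

Lemma smooth_spos d f : smooth f -> smooth (spos d \o f).
Proof.
move=> sf; exact: (smoothM sf (smooth_flat 1 (smoothZ d^-1 sf))).
Qed.

Lemma smooth_shift y f : smooth f -> smooth (fun x => f (x + y)).
Proof.
(* Translates by the fixed [y] of smooth functions form a class stable under partial derivatives. *)
move=> sf; pose Q g := exists2 h, smooth h & g = h \o shift y.
apply: (smooth_coind (Q := Q)); last by exists f.
have dE (h : V -> R) v x : derivable h (x + y) v -> is_derive x v (h \o shift y) ('D_v h (x + y)).
  move=> dh.
  have E : (fun k : R => k^-1 *: (((h \o shift y) \o shift x) (k *: v) - (h \o shift y) x))
     = (fun k : R => k^-1 *: ((h \o shift (x + y)) (k *: v) - h (x + y))).
    by apply/funext => k /=; rewrite addrA.
  by split; [rewrite /derivable E|rewrite /derive E].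
move=> _ [h sh ->]; split=> [x|i x|i].
- apply: continuous_comp; last exact: (smooth_continuous sh).
  exact: (cvgD cvg_id (cvg_cst y)).
- by have [] := dE h (e_ i) x (smooth_derivable sh).
- exists (partial i h); first exact: smooth_partial.
  by apply/funext => x; rewrite /partial; have [_ ->] := dE h (e_ i) x (smooth_derivable sh).
Qed.

End smooth_functions.

(** * Lebesgue measure on row vectors *)

Lemma lebesgue_measure_shift (R : realType) (y : R) (A : set (measurableTypeR R)) :
  measurable A ->
  (lebesgue_measure ((fun x : measurableTypeR R => (x + y)%R) @^-1` A) = lebesgue_measure A)%E.
Proof.
move=> mA; pose s := fun x : measurableTypeR R => (x + y : measurableTypeR R).
have ms : measurable_fun setT s by apply: measurable_funD.
pose mu : {measure set (measurableTypeR R) -> \bar R} :=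
  measure_function_pushforward__canonical__measure_function_Measure (@lebesgue_measure R) ms.
suff -> : lebesgue_measure A = mu A by [].
apply: lebesgue_measure_unique => // _ [[a b] _ <-] /=.
rewrite /mu /= /pushforward (_ : s @^-1` _ = `]a - y, b - y]%classic).
  rewrite !lebesgue_measure_itv/= !lte_fin ltrD2r; case: ifPn => // ab.
  by rewrite -!EFinB; congr EFin; ring.
by apply/seteqP; split => x /=; rewrite !in_itv /s /= ltrBlDr lerBrDr.
Qed.

Section lebesgue_rV.
Variables (R : realType) (n : nat).
Notation V := 'rV[R]_n.
Notation leb := (@leb R n).
Implicit Types (x y : V) (A : set V).

(** A generating pi-system on which [leb_box] gives the measure, as uniqueness of measures
    demands. *)
Definition rboxes : set (set V) :=
  [set A | exists2 B : 'I_n -> set (measurableTypeR R), (forall i, measurable (B i)) &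
    A = [set x : V | forall i, B i (x ord0 i)]].

Lemma measurable_rbox (B : 'I_n -> set (measurableTypeR R)) :
  (forall i, measurable (B i)) -> measurable [set x : V | forall i, B i (x ord0 i)].
Proof.
move=> mB; rewrite (_ : mkset _ = \bigcap_(i in [set: 'I_n])
    (fun x : V => x ord0 i) @^-1` B i).
  apply: fin_bigcap_measurable => [|i _]; first exact: finite_finset.
  by rewrite -[X in measurable X]setTI; apply: measurable_coord; [|exact: mB].
by apply/seteqP; split => x /= h i; [move=> _|]; exact: h.
Qed.

Lemma measurable_rVE : (@measurable _ V) = <<s rboxes >>.
Proof.
apply/seteqP; split; last first.
  apply: smallest_sub; first exact: sigma_algebra_measurable.
  by move=> _ [B mB ->]; exact: measurable_rbox.
apply: smallest_sub; first exact: smallest_sigma_algebra.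
move=> A; rewrite -bigcup_seq/= => -[i _ [B mB <-]].
apply: sub_sigma_algebra; rewrite setTI.
exists (fun j => if j == i then B else setT).
  by move=> j; case: ifP.
apply/seteqP; split => x /=; last by move=> /(_ i); rewrite eqxx.
by move=> Bx j; case: eqP => // ->.
Qed.

Lemma rboxes_setI : setI_closed rboxes.
Proof.
move=> _ _ [A mA ->] [B mB ->]; exists (fun i => A i `&` B i).
  by move=> i; exact: measurableI.
apply/seteqP; split => x /=; first by move=> [h1 h2] i; split; [exact: h1|exact: h2].
by move=> h; split => i; have [] := h i.
Qed.

(** Closed sup-norm balls of integer radius: an exhaustion of finite measure for uniqueness of
    measures, and the reference compact sets for supports. *)
Definition cube (k : nat) : set V :=
  [set x : V | forall i, `[- k%:R, k%:R]%classic (x ord0 i)].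

Lemma cube_rboxes k : rboxes (cube k).
Proof. by exists (fun=> `[- k%:R, k%:R]%classic). Qed.

Lemma measurable_cube k : measurable (cube k).
Proof. by apply: (@measurable_rbox (fun=> `[- k%:R, k%:R]%classic)). Qed.

Lemma coord_le_norm x i : `|x ord0 i| <= `|x|.
Proof.
rewrite [leRHS]/Num.Def.normr /= mx_normrE; apply/bigmax_geP; right => /=.
by exists (ord0, i).
Qed.

Lemma norm_le_coord x (e : R) : 0 <= e -> (forall i, `|x ord0 i| <= e) -> `|x| <= e.
Proof.
move=> e0 h; rewrite /Num.Def.normr /= mx_normrE; apply/bigmax_leP; split => // -[i j] _ /=.
by rewrite ord1.
Qed.

Lemma norm_lt_coord x (e : R) : 0 < e -> (forall i, `|x ord0 i| < e) -> `|x| < e.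
Proof.
move=> e0 h; rewrite /Num.Def.normr /= mx_normrE; apply/bigmax_ltP; split => // -[i j] _ /=.
by rewrite ord1.
Qed.

Lemma cubeE k x : cube k x <-> `|x| <= k%:R.
Proof.
split => [h|h i] /=.
  by apply: norm_le_coord => // i; rewrite ler_norml; have := h i; rewrite /= in_itv.
by rewrite in_itv/= -ler_norml; apply: le_trans h; exact: coord_le_norm.
Qed.

Lemma bigcup_cube : \bigcup_k cube k = setT.
Proof.
apply/seteqP; split => // x _; exists (Num.truncn `|x|).+1 => //.
by apply: (iffRL (cubeE _ _)); apply/ltW; exact: truncnS_gt.
Qed.

Lemma leb_cube k : (leb (cube k) < +oo)%E.
Proof.
rewrite /cube (leb_box (A := fun=> `[- k%:R, k%:R]%classic))//.
rewrite ltey_eq prode_fin_num// => i _.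
by rewrite lebesgue_measure_itv/=; case: ifP.
Qed.

Lemma measurable_shift y : measurable_fun setT (fun x : V => x + y).
Proof.
apply: measurable_fun_rV => i; under eq_fun do rewrite mxE.
by apply: measurable_funD => //; exact: measurable_coord.
Qed.

Lemma measurable_preimage_shift y A : measurable A -> measurable ((fun x => x + y) @^-1` A).
Proof. by move=> mA; rewrite -[X in measurable X]setTI; exact: measurable_shift. Qed.

Definition leb_shift y : {measure set V -> \bar R} :=
  measure_function_pushforward__canonical__measure_function_Measure leb (@measurable_shift y).

(** A translation acts on each side of a box separately, so the two measures agree on [rboxes] by
    the one-dimensional case, and finiteness on cubes gives uniqueness. *)
Lemma pushforward_leb_shift y A : measurable A -> pushforward leb (fun x : V => x + y) A = leb A.
Proof.
move=> mA.
pose mu := leb_shift y; suff -> : leb A = mu A by [].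
apply: (measure_unique rboxes cube) => //.
- exact: measurable_rVE.
- exact: rboxes_setI.
- exact: cube_rboxes.
- exact: bigcup_cube.
- move=> _ [B mB ->]; apply: (etrans (leb_box mB)); rewrite /mu /= /pushforward.
  rewrite (_ : _ @^-1` _ = [set x : V | forall i,
      ((fun t : measurableTypeR R => (t + y ord0 i)%R) @^-1` B i) (x ord0 i)]).
    rewrite (@leb_box R n (fun i => (fun t : measurableTypeR R => (t + y ord0 i)%R) @^-1` B i)).
      by apply: eq_bigr => i _; rewrite lebesgue_measure_shift.
    move=> i; rewrite -[X in measurable X]setTI.
    suff : measurable_fun setT (fun t : measurableTypeR R => (t + y ord0 i : measurableTypeR R)) by apply.
    exact: measurable_funD.
  by apply/seteqP; split => x /= h i; have := h i; rewrite mxE.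
- exact: leb_cube.
Qed.

Lemma leb_preimage_shift y A : measurable A -> leb ((fun x => x + y) @^-1` A) = leb A.
Proof. by move=> mA; rewrite -[RHS](pushforward_leb_shift y). Qed.

Lemma measurable_ball_rV x (e : R) : measurable (ball x e).
Proof.
have [e0|e0] := ltP 0 e; last first.
  rewrite (_ : ball x e = set0); first exact: measurable0.
  apply/seteqP; split => // y; rewrite mx_norm_ball /ball_/= => h.
  by have := le_lt_trans (normr_ge0 _) h; rewrite ltNge e0.
rewrite (_ : ball x e = [set y | forall i, (ball (x ord0 i) e : set (measurableTypeR R)) (y ord0 i)]).
  by apply: (@measurable_rbox (fun i => ball (x ord0 i) e)) => i; exact: measurable_ball.
apply/seteqP; split => y /=; rewrite mx_norm_ball /ball_/=.
  move=> h i; apply: le_lt_trans h.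
  by have := coord_le_norm (x - y) i; rewrite !mxE.
by move=> h; apply: norm_lt_coord => // i; rewrite !mxE; exact: h.
Qed.

(** Bridge from the topology to the product sigma-algebra. Centres are rational so that the index
    type is countable; indices whose ball leaves [A] receive the empty set. *)
Lemma open_countable_ball A : open A ->
  exists F : {ffun 'I_n -> rat} * nat -> set V, A = \bigcup_i F i /\
    forall i, F i = set0 \/ exists x (e : R), 0 < e /\ F i = ball x e.
Proof.
move=> oA.
pose c (q : {ffun 'I_n -> rat}) : V := \row_i ratr (q i).
pose F (qk : {ffun 'I_n -> rat} * nat) : set V :=
  if `[< ball (c qk.1) (qk.2.+1%:R^-1) `<=` A >] then ball (c qk.1) (qk.2.+1%:R^-1) else set0.
exists F; split; last first.
  by move=> i; rewrite /F; case: ifP => _; [right; exists (c i.1), i.2.+1%:R^-1; split=> //; rewrite invr_gt0|left].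
apply/seteqP; split => [x Ax|x [i _]]; last by rewrite /F; case: asboolP => [h|//]; exact: h.
have : nbhs x A by exact: open_nbhs_nbhs.
rewrite -nbhs_ballE => -[e /= e0 eA].
(* A ball of radius below e/2 whose centre is closer to [x] than that radius stays inside the ball
   of radius [e] around [x]. *)
have [k hk] : exists k : nat, k.+1%:R^-1 < e / 2.
  exists (Num.truncn (2 / e)); rewrite invf_plt ?posrE ?divr_gt0// invf_div.
  exact: truncnS_gt.
have [d dE] : exists d, d = (k.+1%:R : R)^-1 by eexists.
have d0 : 0 < d by rewrite dE invr_gt0.
rewrite -dE in hk.
have /choice[q hq] : forall i, exists q : rat, x ord0 i - d < ratr q < x ord0 i + d.
  move=> i; have [|q] := @rat_in_itvoo R (x ord0 i - d) (x ord0 i + d); first by lra.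
  by rewrite in_itv/= => hq; exists q.
have xc : `|c (finfun q) - x| < d.
  apply: norm_lt_coord => // i; rewrite !mxE ffunE ltr_norml.
  by have /andP[h1 h2] := hq i; lra.
exists (finfun q, k) => //; rewrite /F /= -dE; case: asboolP => [_|].
  by rewrite mx_norm_ball.
case=> y; rewrite mx_norm_ball/= => yc; apply: eA; rewrite mx_norm_ball /ball_/=.
rewrite -(subrK (c (finfun q)) x) -addrA (le_lt_trans (ler_normD _ _))//.
by rewrite distrC; lra.
Qed.

Lemma open_measurable_rV A : open A -> measurable A.
Proof.
move=> /open_countable_ball[F [-> hF]].
apply: countable_bigcupT_measurable; first exact: countableP.
by move=> i; have [->|[x [e [_ ->]]]] := hF i; [exact: measurable0|exact: measurable_ball_rV].
Qed.

Lemma closed_measurable_rV A : closed A -> measurable A.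
Proof. by move=> /closed_openC/open_measurable_rV/measurableC; rewrite setCK. Qed.

Lemma compact_measurable_rV A : compact A -> measurable A.
Proof.
by move=> cA; apply: closed_measurable_rV; exact: compact_closed.
Qed.

Lemma continuous_measurable_rV (f : V -> R) : continuous f -> measurable_fun setT f.
Proof.
move=> /continuousP cf; apply: (measurability _ (RGenOpens.measurableE R)).
move=> _ [_ [a [b ->]] <-]; rewrite setTI; apply: open_measurable_rV.
by apply: cf; exact: interval_open.
Qed.

Lemma bounded_sub_cube A (M : R) : (forall x, A x -> `|x| <= M) -> exists k, A `<=` cube k.
Proof.
move=> h; exists (Num.truncn M).+1 => x /h xM; apply: (iffRL (cubeE _ _)).
by apply/ltW/(le_lt_trans xM); exact: truncnS_gt.
Qed.

Lemma compact_sub_cube A : compact A -> exists k, A `<=` cube k.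
Proof.
move=> /compact_bounded[M [Mr hM]]; apply: (@bounded_sub_cube _ (M + 1)) => x Ax.
by apply: hM => //; rewrite ltrDl.
Qed.

Lemma compact_cube k : compact (cube k).
Proof.
apply: (@rV_compact R n (fun=> `[- k%:R, k%:R]%classic)) => i.
exact: segment_compact.
Qed.

End lebesgue_rV.

(** * Test functions and weak gradients *)

Section compactly_supported.
Variables (R : realType) (n : nat).
Notation V := 'rV[R]_n.
Notation leb := (@leb R n).
Notation e_ i := (@delta_mx R 1 n ord0 i).
Implicit Types (f g : V -> R).

(** A cube index replaces the closure of the support; for sums one takes the larger index. *)
Definition supported_in (k : nat) f := forall x, ~ cube k x -> f x = 0.

Lemma closed_cube k : closed (@cube R n k).
Proof. by apply: compact_closed => //; exact: compact_cube. Qed.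

Lemma Cc_smoothP f : @Cc_smooth R n f <-> smooth f /\ exists k, supported_in k f.
Proof.
split=> -[sf].
  move=> /compact_sub_cube[k hk]; split=> //; exists k => x nx.
  apply/eqP; apply/negP => /negP fx; apply: nx; apply: hk.
  exact: subset_closure.
move=> [k hk]; split => //.
apply: (subclosed_compact (@closed_closure _ _) (@compact_cube R n k)).
rewrite closureE; apply: smallest_sub; first exact: closed_cube.
by move=> x /= fx; apply: contrapT => /hk /eqP; apply/negP.
Qed.

Lemma Cc_smooth_smooth f : @Cc_smooth R n f -> smooth f.
Proof. by case. Qed.

Lemma Cc_smooth_supported f : @Cc_smooth R n f -> exists k, supported_in k f.
Proof. by move=> /Cc_smoothP[]. Qed.

Lemma cubeS k l : (k <= l)%N -> @cube R n k `<=` @cube R n l.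
Proof.
move=> kl x /cubeE h; apply: (iffRL (cubeE _ _)); apply: (le_trans h).
by rewrite ler_nat.
Qed.

Lemma supportedS k l f : (k <= l)%N -> supported_in k f -> supported_in l f.
Proof. by move=> kl h x nx; apply: h; apply: contra_not nx; exact: cubeS. Qed.

Lemma Cc_smoothD f g : @Cc_smooth R n f -> @Cc_smooth R n g -> @Cc_smooth R n (f \+ g).
Proof.
move=> /Cc_smoothP[sf [k fk]] /Cc_smoothP[sg [l gl]]; apply/Cc_smoothP; split.
  exact: smoothD.
exists (maxn k l) => x nx.
have fk' := supportedS (leq_maxl k l) fk; have gl' := supportedS (leq_maxr k l) gl.
by rewrite /= fk'// gl'// addr0.
Qed.

Lemma Cc_smoothMr f g : @Cc_smooth R n f -> smooth g -> @Cc_smooth R n (f \* g).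
Proof.
move=> /Cc_smoothP[sf [k fk]] sg; apply/Cc_smoothP; split; first exact: smoothM.
by exists k => x nx; rewrite /= fk// mul0r.
Qed.

Lemma Cc_smoothZ c f : @Cc_smooth R n f -> @Cc_smooth R n (c \*o f).
Proof.
move=> /Cc_smoothP[sf [k fk]]; apply/Cc_smoothP; split; first exact: smoothZ.
by exists k => x nx; rewrite /= fk// mulr0.
Qed.

Lemma Cc_smoothB f g : @Cc_smooth R n f -> @Cc_smooth R n g -> @Cc_smooth R n (f \- g).
Proof.
move=> /Cc_smoothP[sf [k fk]] /Cc_smoothP[sg [l gl]]; apply/Cc_smoothP; split.
  exact: smoothB.
exists (maxn k l) => x nx.
have fk' := supportedS (leq_maxl k l) fk; have gl' := supportedS (leq_maxr k l) gl.
by rewrite /= fk'// gl'// subr0.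
Qed.

Lemma Cc_smooth_spos d f : @Cc_smooth R n f -> @Cc_smooth R n (spos d \o f).
Proof.
move=> /Cc_smoothP[sf [k fk]]; apply/Cc_smoothP; split; first exact: smooth_spos.
by exists k => x nx; rewrite /= fk// spos0.
Qed.

Lemma Cc_smooth_shift y f : @Cc_smooth R n f -> @Cc_smooth R n (fun x => f (x + y)).
Proof.
move=> /Cc_smoothP[sf [k fk]]; apply/Cc_smoothP; split; first exact: smooth_shift.
exists (k + (Num.truncn `|y|).+1)%N => x nx; apply: fk; apply: contra_not nx => /cubeE h.
apply: (iffRL (cubeE _ _)); rewrite -[x](addrK y); apply: (le_trans (ler_normB _ _)).
by rewrite natrD lerD// ltW// truncnS_gt.
Qed.

Lemma supported_partial k f i : supported_in k f -> supported_in k (partial i f).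
Proof.
move=> fk x nx; rewrite /partial.
rewrite (@near_eq_derive _ _ _ f (cst 0)); first exact: derive_cst.
have : nbhs x (~` cube k).
  by apply: open_nbhs_nbhs; split => //; apply: closed_openC; exact: closed_cube.
by apply: filterS => y /fk ->.
Qed.

Lemma Cc_smooth_partial i f : @Cc_smooth R n f -> @Cc_smooth R n (partial i f).
Proof.
move=> /Cc_smoothP[sf [k fk]]; apply/Cc_smoothP; split; first exact: smooth_partial.
by exists k; exact: supported_partial.
Qed.

Lemma supported_bounded k f : continuous f -> supported_in k f ->
  exists2 M, 0 <= M & forall x, `|f x| <= M.
Proof.
move=> cf fk.
have : compact (f @` cube k).
  by apply: continuous_compact; [exact: continuous_subspaceT|exact: compact_cube].
move=> /compact_bounded[M [Mr hM]]; exists (`|M| + 1); first by rewrite addr_ge0.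
move=> x; have [cx|ncx] := pselect (cube k x).
  by apply: hM; [rewrite (le_lt_trans (ler_norm M))// ltrDl|exists x].
by rewrite fk// normr0 addr_ge0.
Qed.

Lemma Cc_smooth_bounded f : @Cc_smooth R n f -> exists2 M, 0 <= M & forall x, `|f x| <= M.
Proof.
move=> /Cc_smoothP[sf [k fk]]; apply: (supported_bounded (k := k)) => //.
exact: smooth_continuous.
Qed.

Lemma continuous_integrable_cube k f : continuous f -> leb.-integrable (cube k) (EFin \o f).
Proof.
move=> cf; apply: measurable_bounded_integrable; [exact: measurable_cube|exact: leb_cube| |].
  by apply: measurable_funTS; exact: continuous_measurable_rV.
have : compact (f @` cube k).
  by apply: continuous_compact; [exact: continuous_subspaceT|exact: compact_cube].
move=> /compact_bounded[M [Mr hM]]; exists M; split => // e Me x cx.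
by apply: hM => //; exists x.
Qed.

Lemma loc_integrable_cube k f : loc_integrable f -> leb.-integrable (cube k) (EFin \o f).
Proof. by move=> [_]; apply; exact: compact_cube. Qed.

Lemma loc_integrable_bounded_set f A : loc_integrable f -> measurable A ->
  (exists k, A `<=` cube k) -> leb.-integrable A (EFin \o f).
Proof.
move=> fl mA [k Ak]; apply: integrableS (loc_integrable_cube k fl) => //.
exact: measurable_cube.
Qed.

Lemma continuous_loc_integrable f : continuous f -> loc_integrable f.
Proof.
move=> cf; split; first exact: continuous_measurable_rV.
move=> K cK; have [k Kk] := compact_sub_cube cK.
apply: integrableS (continuous_integrable_cube k cf) => //; first exact: measurable_cube.
exact: compact_measurable_rV.
Qed.

Lemma supported_integrable k f : supported_in k f ->
  leb.-integrable (cube k) (EFin \o f) -> leb.-integrable setT (EFin \o f).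
Proof.
move=> fk /(integrable_mkcond _ (@measurable_cube R n k)).
rewrite (_ : _ \_ _ = EFin \o f)//; apply/funext => x; rewrite /patch.
by case: ifPn => // /negP; rewrite inE /= => /fk ->.
Qed.

Lemma loc_integrableM k f g : loc_integrable f -> continuous g -> supported_in k g ->
  leb.-integrable setT (EFin \o (f \* g)).
Proof.
move=> fl cg gk; apply: (supported_integrable (k := k)).
  by move=> x nx; rewrite /= gk// mulr0.
rewrite (_ : _ \o _ = (EFin \o f) \* (EFin \o g))%E//.
apply: integrableMl; [exact: measurable_cube|exact: loc_integrable_cube| |].
  by apply: measurable_funTS; exact: continuous_measurable_rV.
have [M M0 hM] := supported_bounded cg gk.
exists M; split; first exact: num_real.
by move=> e Me x cx; exact/(le_trans (hM x))/ltW.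
Qed.

Lemma loc_integrableM_Cc f g : loc_integrable f -> @Cc_smooth R n g ->
  leb.-integrable setT (EFin \o (f \* g)).
Proof.
move=> fl /Cc_smoothP[sg [k gk]]; apply: (loc_integrableM (k := k)) => //.
exact: smooth_continuous.
Qed.

Lemma Cc_integrable f : @Cc_smooth R n f -> leb.-integrable setT (EFin \o f).
Proof.
move=> /Cc_smoothP[sf [k fk]]; apply: supported_integrable fk _.
exact/continuous_integrable_cube/smooth_continuous.
Qed.

Lemma ge0_integral_shift y (f : V -> \bar R) : measurable_fun setT f -> (forall x, (0 <= f x)%E) ->
  (\int[leb]_x f (x + y)%R = \int[leb]_x f x)%E.
Proof.
move=> mf f0.
transitivity (\int[pushforward leb (fun x : V => (x + y)%R)]_x f x)%E; last first.
  apply: (@eq_measure_integral _ _ _ _ leb (leb_shift y)).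
  by move=> A mA _; exact: pushforward_leb_shift.
rewrite ge0_integral_pushforward//; first exact: measurable_shift.
Qed.

Lemma Rintegral_shift y f : leb.-integrable setT (EFin \o f) ->
  \int[leb]_x f (x + y) = \int[leb]_x f x.
Proof.
move=> intf; have mf : measurable_fun setT (EFin \o f) by apply: measurable_int intf.
rewrite /Rintegral; congr fine.
transitivity (\int[pushforward leb (fun x : V => (x + y)%R)]_x (EFin \o f) x)%E; last first.
  apply: (@eq_measure_integral _ _ _ _ leb (leb_shift y)).
  by move=> A mA _; exact: pushforward_leb_shift.
rewrite integral_pushforward//; first exact: measurable_shift.
apply/integrableP; split.
  by apply: measurableT_comp => //; exact: measurable_shift.
have := @ge0_integral_shift y (fun x => `|(f x)%:E|)%E.
rewrite /comp => ->//; last exact: measurableT_comp.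
by case/integrableP : intf.
Qed.

End compactly_supported.

(** * Integration by parts and classical gradients as weak gradients *)

Section integration_by_parts.
Variables (R : realType) (n : nat).
Notation V := 'rV[R]_n.
Notation leb := (@leb R n).
Notation e_ i := (@delta_mx R 1 n ord0 i).
Implicit Types (f g : V -> R).

Lemma is_derive_line f (x v : V) (t : R) : derivable f (t *: v + x) v ->
  is_derive t 1 (fun h : R => f (h *: v + x)) ('D_v f (t *: v + x)).
Proof.
move=> df.
have E : (fun k : R => k^-1 *: (((fun h : R => f (h *: v + x)) \o shift t) (k *: (1:R)) - f (t *: v + x)))
   = (fun k : R => k^-1 *: ((f \o shift (t *: v + x)) (k *: v) - f (t *: v + x))).
  by apply/funext => k /=; rewrite scalerDl addrA [k *: 1]mulr1.
by split; [rewrite /derivable E|rewrite /derive E].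
Qed.

Lemma partial_MVT f i (x : V) (h M : R) : (forall z, derivable f z (e_ i)) ->
  (forall z, `|partial i f z| <= M) -> `|f (h *: e_ i + x) - f x| <= M * `|h|.
Proof.
move=> df dM.
pose g := fun t : R => f (t *: e_ i + x).
have dg (t : R) : is_derive t 1 g (partial i f (t *: e_ i + x)) by exact: is_derive_line.
have cg : continuous g.
  move=> t; apply/differentiable_continuous/derivable1_diffP.
  by have [] := dg t.
have -> : f x = g 0 by rewrite /g scale0r add0r.
rewrite -/(g h).
have key a b : a <= b -> `|g b - g a| <= M * (b - a).
  move=> ab; have [c _ ->] := MVT_segment ab (fun t _ => dg t) (continuous_subspaceT cg).
  by rewrite normrM [X in _ * X]ger0_norm ?subr_ge0// ler_wpM2r// subr_ge0.
have [h0|h0] := leP 0 h.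
  by have := key _ _ h0; rewrite subr0 (ger0_norm h0).
by rewrite distrC; have := key _ _ (ltW h0); rewrite sub0r (ltr0_norm h0).
Qed.

(** Difference quotients of [g] have zero integral by translation invariance, and the mean value
    bound lets dominated convergence pass to the derivative. *)
Lemma Rintegral_partial_eq0 i g : @Cc_smooth R n g -> \int[leb]_x partial i g x = 0.
Proof.
move=> cg; have sg := Cc_smooth_smooth cg.
have [k gk] := Cc_smooth_supported cg.
have [M M0 hM] := Cc_smooth_bounded (Cc_smooth_partial i cg).
pose h (m : nat) : R := m.+1%:R^-1.
have h0 m : 0 < h m by rewrite invr_gt0.
have h1 m : h m <= 1 by rewrite invf_le1// ler1n.
pose q m x := (h m)^-1 * (g (h m *: e_ i + x) - g x).
have ig := Cc_integrable cg.
have shE m : (fun x => g (h m *: e_ i + x)) = (fun x => g (x + h m *: e_ i)).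
  by apply/funext => x; rewrite addrC.
have igs m : leb.-integrable setT (EFin \o (fun x => g (h m *: e_ i + x))).
  by rewrite shE; apply: Cc_integrable; exact: Cc_smooth_shift.
have iq m : leb.-integrable setT (EFin \o q m).
  exact: (integrableZl measurableT (h m)^-1 (integrableB measurableT (igs m) ig)).
have q0 m : (\int[leb]_x (q m x)%:E = 0)%E.
  have : \int[leb]_x q m x = 0.
    rewrite /q RintegralZl//; last exact: (integrableB measurableT (igs m) ig).
    rewrite RintegralB// shE (@Rintegral_shift R n _ g)// subrr mulr0 //.
  rewrite /Rintegral; have := integrable_fin_num measurableT (iq m).
  by move=> /fineK <- /= ->.
(* The increments [h m] are at most 1, so all quotients are supported in the cube one size
   larger. *)
pose G : V -> \bar R := (EFin \o (M \*o \1_(cube k.+1))).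
have iG : leb.-integrable setT G.
  have mc := @measurable_cube R n k.+1.
  have ii : leb.-integrable setT (EFin \o \1_(@cube R n k.+1)).
    apply/integrableP; split; first exact/measurable_EFinP/measurable_indic.
    under eq_integral do rewrite /= ger0_norm//.
    by rewrite integral_indic// setIT; exact: leb_cube.
  exact: (integrableZl measurableT M ii).
have [] := @dominated_convergence _ _ R leb setT measurableT (fun m => EFin \o q m)
  (EFin \o partial i g) G.
- by move=> m; exact: measurable_int (iq m).
- apply/measurable_EFinP; apply: continuous_measurable_rV.
  exact/smooth_continuous/smooth_partial.
- apply: aeW => x _; apply: cvg_EFin; first exact: nearW.
  have dx : derivable g x (e_ i) by exact: smooth_derivable.
  have hc : h @ \oo --> 0^'.
    move=> A; rewrite /dnbhs /within /= nbhs_simpl => hA.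
    have H : nbhs \oo [set m | h m != 0 -> A (h m)] := @cvg_harmonic R _ hA.
    apply: (@filterS _ \oo _ [set m | h m != 0 -> A (h m)] (h @^-1` A)) H => m /=.
    by apply; rewrite gt_eqF.
  have : (fun t : R => t^-1 *: ((g \o shift x) (t *: e_ i) - g x)) \o h @ \oo --> partial i g x.
    exact: (cvg_comp _ _ hc dx).
  exact.
- exact: iG.
- apply: aeW => x m _; rewrite lee_fin /G /=.
  rewrite indicE; have [cx|ncx] := boolP (x \in cube k.+1).
    rewrite mulr1 /q normrM gtr0_norm ?invr_gt0// mulrC ler_pdivrMr//.
    have := @partial_MVT g i x (h m) M; rewrite (gtr0_norm (h0 m)); apply => // z.
    exact: smooth_derivable.
  rewrite mulr0 /q !gk ?subrr ?mulr0 ?normr0//.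
    move=> /(@cubeS R n k k.+1 (leqnSn k)) cx; by rewrite (mem_set cx) in ncx.
  move=> /cubeE h2; move/negP: ncx; apply; rewrite inE; apply: (iffRL (cubeE _ _)).
  rewrite -(addKr (h m *: e_ i) x) (le_trans (ler_normD _ _))// -[in leRHS]natr1 addrC lerD//.
  rewrite normrN normrZ gtr0_norm// (le_trans (ler_wpM2r _ (h1 m)))// mul1r.
  by apply: norm_le_coord => // j; rewrite mxE eqxx /=; case: eqP => _; rewrite ?normr1 ?normr0 ?ler01.
move=> _ _; rewrite (_ : [sequence _]_m = cst 0%E); last by apply/funext => m; exact: q0.
move=> /cvg_lim => /(_ (@ereal_hausdorff R)); rewrite lim_cst// => E0; rewrite /Rintegral -[X in fine X]/(\int[leb]_x (EFin \o partial i g) x)%E -E0.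
by [].
Qed.

Definition grad f : V -> V := fun x => \row_i partial i f x.

Lemma partialM f g i : smooth f -> smooth g ->
  partial i (f \* g) = (f \* partial i g) \+ (g \* partial i f).
Proof.
move=> sf sg; apply/funext => x.
exact: (deriveM (smooth_derivable (i := i) (x := x) sf) (smooth_derivable sg)).
Qed.

Lemma Rintegral_by_parts f phi i : smooth f -> @Cc_smooth R n phi ->
  \int[leb]_x (f x * partial i phi x) = - \int[leb]_x (partial i f x * phi x).
Proof.
move=> sf cphi; have sphi := Cc_smooth_smooth cphi.
have cfp : @Cc_smooth R n (f \* phi).
  rewrite (_ : f \* phi = phi \* f); last by apply/funext => x; exact: mulrC.
  exact: Cc_smoothMr.
have := Rintegral_partial_eq0 i cfp; rewrite partialM//.
have i1 : leb.-integrable setT (EFin \o (f \* partial i phi)).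
  apply: loc_integrableM_Cc; last exact: Cc_smooth_partial.
  exact/continuous_loc_integrable/smooth_continuous.
have i2 : leb.-integrable setT (EFin \o (partial i f \* phi)).
  apply: loc_integrableM_Cc => //.
  exact/continuous_loc_integrable/smooth_continuous/smooth_partial.
rewrite (_ : phi \* partial i f = partial i f \* phi); last first.
  by apply/funext => x; exact: mulrC.
by rewrite RintegralD// => /eqP; rewrite addr_eq0 => /eqP.
Qed.

Lemma smooth_weak_gradient f : smooth f -> is_weak_gradient f (grad f).
Proof.
move=> sf; split.
- exact/continuous_loc_integrable/smooth_continuous.
- move=> i; rewrite (_ : (fun _ => _) = partial i f); last by apply/funext => x; rewrite mxE.
  exact/continuous_loc_integrable/smooth_continuous/smooth_partial.
- move=> phi cphi i; rewrite Rintegral_by_parts//; congr (- _).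
  by apply: eq_Rintegral => x _; rewrite mxE.
Qed.

End integration_by_parts.

(** * The fundamental lemma of the calculus of variations *)

Section fundamental_lemma.
Variables (R : realType) (n : nat).
Notation V := 'rV[R]_n.
Notation leb := (@leb R n).
Implicit Types (f g : V -> R) (a b : V).

(** Open boxes instead of [rboxes]: their indicators are pointwise limits of smooth functions
    supported in them. *)
Definition obox a b : set V := [set x : V | forall i, a ord0 i < x ord0 i < b ord0 i].

Definition oboxes : set (set V) := [set A | exists a b, A = obox a b].

Lemma obox_rbox a b : obox a b = [set x : V | forall i, (`]a ord0 i, b ord0 i[%classic : set (measurableTypeR R)) (x ord0 i)].
Proof. by apply/seteqP; split => x h i; have := h i; rewrite /= in_itv. Qed.

Lemma measurable_obox a b : measurable (obox a b).
Proof.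
rewrite obox_rbox.
by apply: (@measurable_rbox R n (fun i => `]a ord0 i, b ord0 i[%classic)).
Qed.

Lemma obox_sub_cube a b : exists k, obox a b `<=` cube k.
Proof.
apply: (@bounded_sub_cube R n _ (`|a| + `|b|)) => x xab; apply: norm_le_coord.
  by rewrite addr_ge0.
move=> i; have /andP[h1 h2] := xab i.
have := coord_le_norm a i; have := coord_le_norm b i; rewrite !ler_norml.
by move=> /andP[h3 h4] /andP[h5 h6]; have := normr_ge0 a; have := normr_ge0 b; lra.
Qed.

Lemma obox_setI a b c d : obox a b `&` obox c d =
  obox (\row_i Num.max (a ord0 i) (c ord0 i)) (\row_i Num.min (b ord0 i) (d ord0 i)).
Proof.
apply/seteqP; split => x /=.
  by move=> [h1 h2] i; rewrite !mxE gt_max lt_min; have /andP[-> ->] := h1 i; exact: h2.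
move=> h; split => i; have := h i; rewrite !mxE gt_max lt_min => /andP[/andP[h1 h2] /andP[h3 h4]].
  by rewrite h1.
by rewrite h2.
Qed.

Lemma oboxes_setI : setI_closed oboxes.
Proof. by move=> _ _ [a [b ->]] [c [d ->]]; rewrite obox_setI; do 2 eexists. Qed.

Lemma ball_obox x (e : R) : 0 < e -> ball x e = obox (x - const_mx e) (x + const_mx e).
Proof.
move=> e0; apply/seteqP; split => y; rewrite mx_norm_ball /ball_ /=.
  move=> h i; rewrite !mxE; have := le_lt_trans (coord_le_norm (x - y) i) h.
  by rewrite !mxE ltr_norml => /andP[h1 h2]; apply/andP; split; lra.
move=> h; apply: norm_lt_coord => // i; have := h i; rewrite !mxE ltr_norml.
by move=> /andP[h1 h2]; apply/andP; split; lra.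
Qed.

Lemma open_oboxes A : open A -> <<s oboxes >> A.
Proof.
move=> /open_countable_ball[F [-> hF]].
apply: (@countable_bigcupT_measurable _ (g_sigma_algebraType oboxes)).
  exact: countableP.
move=> i; have [->|[x [e [e0 ->]]]] := hF i; first exact: measurable0.
by apply: sub_sigma_algebra; rewrite ball_obox//; do 2 eexists.
Qed.

Lemma measurable_oboxesE : (@measurable _ V) = <<s oboxes >>.
Proof.
apply/seteqP; split; last first.
  apply: smallest_sub; first exact: sigma_algebra_measurable.
  by move=> _ [a [b ->]]; exact: measurable_obox.
apply: smallest_sub; first exact: smallest_sigma_algebra.
move=> A; rewrite -bigcup_seq/= => -[i _ [B mB <-]].
have mi : measurable_fun setT ((fun x : V => x ord0 i) : g_sigma_algebraType oboxes -> R).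
  apply: (measurability _ (RGenOpens.measurableE R)).
  move=> _ [_ [a [b ->]] <-]; rewrite setTI; apply: open_oboxes.
  have /continuousP := @coord_continuous R 1 n ord0 i; apply.
  exact: interval_open.
exact: mi.
Qed.

(** Each factor exp(-1/((k+1)t)) vanishes for t <= 0 and tends to 1 for t > 0, so the products
    converge, between 0 and 1, to the indicator of the box. *)
Definition obox_bump a b (k : nat) (x : V) : R := \prod_(i < n)
  (flat 1 (k.+1%:R * (x ord0 i - a ord0 i)) * flat 1 (k.+1%:R * (b ord0 i - x ord0 i))).

Lemma obox_bump_out a b k x : ~ obox a b x -> obox_bump a b k x = 0.
Proof.
move=> /existsNP[i /negP]; rewrite negb_and -!leNgt => h.
rewrite /obox_bump (bigD1 i)//=.
have k0 : (0:R) < k.+1%:R by [].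
case/orP : h => h.
  by rewrite (@flat_le0 _ _ (_ * (x ord0 i - _)))?mul0r// pmulr_rle0 ?subr_le0.
by rewrite (@flat_le0 _ _ (_ * (_ - x ord0 i))) ?mulr0 ?mul0r// pmulr_rle0 ?subr_le0.
Qed.

Lemma obox_bump_ge0 a b k x : 0 <= obox_bump a b k x.
Proof. by apply: prodr_ge0 => i _; rewrite mulr_ge0// flat1_ge0. Qed.

Lemma obox_bump_le1 a b k x : obox_bump a b k x <= 1.
Proof.
apply: (big_rec (fun y => y <= 1)) => // i y _ y1.
have h0 : 0 <= flat 1 (k.+1%:R * (x ord0 i - a ord0 i)) * flat 1 (k.+1%:R * (b ord0 i - x ord0 i)).
  by rewrite mulr_ge0// flat1_ge0.
apply: (le_trans (ler_wpM2l h0 y1)); rewrite mulr1.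
by rewrite mulr_ile1// ?flat1_ge0// flat1_le1.
Qed.

Lemma Cc_smooth_obox_bump a b k : @Cc_smooth R n (obox_bump a b k).
Proof.
apply/Cc_smoothP; split.
  apply: (@smooth_prod R n _ _ (fun i x => flat 1 (k.+1%:R * (x ord0 i - a ord0 i)) * flat 1 (k.+1%:R * (b ord0 i - x ord0 i)))) => i.
  have sc := @smooth_coord R n i.
  apply: (@smoothM R n (flat 1 \o (k.+1%:R \*o ((fun x => x ord0 i) \- cst (a ord0 i))))
     (flat 1 \o (k.+1%:R \*o (cst (b ord0 i) \- (fun x => x ord0 i))))).
    exact: (smooth_flat 1 (smoothZ _ (smoothB sc (smooth_cst _)))).
  exact: (smooth_flat 1 (smoothZ _ (smoothB (smooth_cst _) sc))).
have [N hN] := obox_sub_cube a b; exists N => x nx; apply: obox_bump_out.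
by apply: contra_not nx; exact: hN.
Qed.

Lemma flat1_cvg (t : R) : 0 < t -> flat 1 (k.+1%:R * t) @[k --> \oo] --> (1:R).
Proof.
move=> t0.
rewrite (_ : (fun k : nat => _) = (fun k : nat => expR (- (harmonic k * t^-1)))); last first.
  apply/funext => k; rewrite flat_gt0 ?mulr_gt0// hornerC mul1r invfM.
  by rewrite mulrC.
rewrite -expR0.
have h : - (@harmonic R k * t^-1) @[k --> \oo] --> (0:R).
  rewrite (_ : (0:R) = - (0 * t^-1)); last by rewrite mul0r oppr0.
  by apply: cvgN; apply: cvgM; [exact: cvg_harmonic|exact: cvg_cst].
by apply: continuous_cvg => //; exact: continuous_expR.
Qed.

Lemma obox_bump_cvg a b x : obox a b x -> obox_bump a b k x @[k --> \oo] --> (1:R).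
Proof.
move=> xab; rewrite /obox_bump.
have : forall r : seq 'I_n, (\prod_(i <- r)
  (flat 1 (k.+1%:R * (x ord0 i - a ord0 i)) * flat 1 (k.+1%:R * (b ord0 i - x ord0 i)))) @[k --> \oo] --> (1:R).
  elim=> [|i r ih].
    by under eq_fun do rewrite big_nil; exact: cvg_cst.
  under eq_fun do rewrite big_cons.
  have /andP[h1 h2] := xab i.
  rewrite -subr_gt0 in h1; rewrite -subr_gt0 in h2.
  have H := cvgM (cvgM (flat1_cvg h1) (flat1_cvg h2)) ih.
  by rewrite !mulr1 in H; exact: (H _ _).
exact.
Qed.

Definition test_null d := loc_integrable d /\
  forall phi, @Cc_smooth R n phi -> \int[leb]_x (d x * phi x) = 0.

Lemma test_null_obox d a b : test_null d -> (\int[leb]_(x in obox a b) (d x)%:E = 0)%E.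
Proof.
move=> [dl dphi].
have mQ := measurable_obox a b.
have iQ : leb.-integrable (obox a b) (EFin \o d).
  by apply: loc_integrable_bounded_set => //; exact: obox_sub_cube.
have iphi k := loc_integrableM_Cc dl (Cc_smooth_obox_bump a b k).
have I0 k : (\int[leb]_(x in obox a b) (d x * obox_bump a b k x)%:E = 0)%E.
  rewrite integral_mkcond (_ : _ \_ _ = EFin \o (d \* obox_bump a b k)); last first.
    apply/funext => x; rewrite /patch; case: ifPn => // /negP; rewrite inE => h.
    by rewrite /= obox_bump_out// mulr0.
  have := dphi _ (Cc_smooth_obox_bump a b k); rewrite /Rintegral.
  by have := integrable_fin_num measurableT (iphi k) => /fineK <- /= ->.
have [] := @dominated_convergence _ _ R leb (obox a b) mQ
  (fun k x => (d x * obox_bump a b k x)%:E) (EFin \o d) (fun x => `|d x|%:E).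
- by move=> k; apply: measurable_funTS; exact: measurable_int (iphi k).
- exact: measurable_int iQ.
- apply: aeW => x Qx; apply: cvg_EFin; first exact: nearW.
  have H := cvgM (cvg_cst (d x)) (obox_bump_cvg Qx).
  by rewrite mulr1 in H; exact: (H _ _).
- exact: integrable_abse iQ.
- apply: aeW => x k _; rewrite lee_fin normrM ler_piMr//.
  by rewrite ger0_norm ?obox_bump_ge0 ?obox_bump_le1.
move=> _ _; rewrite (_ : [sequence _]_k = cst 0%E); last by apply/funext => k; exact: I0.
by move=> /cvg_lim => /(_ (@ereal_hausdorff R)); rewrite lim_cst// => <-.
Qed.

(** A pi-lambda argument starting from open boxes. The fixed box keeps [d] integrable, as
    complements and countable disjoint unions require. *)
Lemma test_null_set d a b A : test_null d -> measurable A ->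
  (\int[leb]_(x in A `&` obox a b) (d x)%:E = 0)%E.
Proof.
move=> dn mA; have [dl _] := dn.
have mQ := measurable_obox a b.
have iQ : leb.-integrable (obox a b) (EFin \o d).
  by apply: loc_integrable_bounded_set => //; exact: obox_sub_cube.
rewrite measurable_oboxesE in mA.
have iS S : measurable S -> leb.-integrable (S `&` obox a b) (EFin \o d).
  by move=> mS; apply: integrableS iQ => //; exact: measurableI.
move: A mA; apply: (@dynkin_induction _ V oboxes (fun A => \int[leb]_(x in A `&` obox a b) (d x)%:E = 0)%E).
- exact: measurable_oboxesE.
- exact: oboxes_setI.
- by rewrite setTI; exact: test_null_obox.
- by move=> _ [c [e ->]]; rewrite /= obox_setI; exact: test_null_obox.
- move=> S mS S0.
  have := test_null_obox a b dn.
  rewrite -{1}(setIT (obox a b)) -(setUv S) setIUr !(setIC (obox a b)).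
  rewrite integral_setU//.
  + by rewrite S0 add0e.
  + exact: measurableI.
  + by apply: measurableI => //; exact: measurableC.
  + rewrite -setIUl setUv setTI; exact: (measurable_int _ iQ).
  + by apply/disj_setPS => x [[Sx _] [nSx _]].
- move=> F mF tF F0; rewrite setI_bigcupl integral_bigcup.
  + by apply: eseries0 => k _ _; exact: F0.
  + by apply: trivIset_setIr.
  + by move=> k; exact: measurableI.
  + by rewrite -setI_bigcupl; apply: iS; exact: bigcupT_measurable.
Qed.

Lemma test_null_ae d : test_null d -> {ae leb, forall x, d x = 0}.
Proof.
move=> dn; have [dl _] := dn.
pose O k : set V := obox (const_mx (- k%:R)) (const_mx k%:R).
have H k : ae_eq leb (O k) (EFin \o d) (cst 0%E).
  apply: integral_ae_eq => //.
  - exact: measurable_obox.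
  - by apply: loc_integrable_bounded_set => //; [exact: measurable_obox|exact: obox_sub_cube].
  - move=> E EO mE; rewrite integral0 -(setIidl EO); exact: test_null_set.
have {}H : {ae leb, forall x, forall k, O k x -> (EFin \o d) x = cst 0%E x}.
  exact/ae_foralln.
apply: filterS H => x /(_ (Num.truncn `|x|).+1) h.
have : O (Num.truncn `|x|).+1 x.
  move=> i; rewrite !mxE -ltr_norml (le_lt_trans (coord_le_norm x i))//.
  exact: truncnS_gt.
by move=> /h [].
Qed.

End fundamental_lemma.

(** * Convexity and elementary inequalities for real powers *)

Section powR_lemmas.
Variable R : realType.
Implicit Types (p a s t : R).

Lemma powR_convex p a s t : 1 <= p -> 0 <= a <= 1 -> 0 <= s -> 0 <= t ->
  (a * s + (1 - a) * t) `^ p <= a * s `^ p + (1 - a) * t `^ p.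
Proof.
move=> p1 /andP[a0 a1] s0 t0.
by apply: (convex_powR p1 (Itv01 a0 a1)); rewrite ?inE /= in_itv/= ?s0 ?t0.
Qed.

Lemma norm_powR_convex p a s t : 1 <= p -> 0 <= a <= 1 ->
  `|a * s + (1 - a) * t| `^ p <= a * `|s| `^ p + (1 - a) * `|t| `^ p.
Proof.
move=> p1 a01; apply: le_trans (powR_convex p1 a01 (normr_ge0 s) (normr_ge0 t)).
have /andP[a0 a1] := a01.
apply: ge0_ler_powR; rewrite ?nnegrE ?addr_ge0 ?mulr_ge0 ?subr_ge0//.
  exact: le_trans p1.
apply: (le_trans (ler_normD _ _)).
by rewrite !normrM (ger0_norm a0) (@ger0_norm _ (1 - a)) ?subr_ge0.
Qed.

(* For [s = a (s / a)], [t = (1 - a) (t / (1 - a))] this is convexity of the power. *)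
Lemma powRD_le p a s t : 1 <= p -> 0 < a < 1 -> 0 <= s -> 0 <= t ->
  (s + t) `^ p <= a `^ (1 - p) * s `^ p + (1 - a) `^ (1 - p) * t `^ p.
Proof.
move=> p1 /andP[a0 a1] s0 t0; have b0 : 0 < 1 - a by rewrite subr_gt0.
have h c u : 0 < c -> 0 <= u -> c * (u / c) `^ p = c `^ (1 - p) * u `^ p.
  move=> c0 u0; rewrite powRM ?invr_ge0 ?(ltW c0)// powRB ?(gt_eqF c0) ?implybT//.
  have -> : c^-1 `^ p = (c `^ p)^-1.
    by rewrite -[c^-1]powR_inv1 ?ltW// -powRrM mulN1r powRN.
  by rewrite powRr1 ?ltW//; ring.
rewrite -!h//.
have -> : s + t = a * (s / a) + (1 - a) * (t / (1 - a)).
  by rewrite mulrCA mulfV ?gt_eqF// mulrCA mulfV ?gt_eqF// !mulr1.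
apply: powR_convex => //; first by rewrite !ltW.
  by rewrite divr_ge0// ltW.
by rewrite divr_ge0// ltW.
Qed.

Lemma norm_powRD_le2 p s t : 1 <= p ->
  `|s + t| `^ p <= 2 `^ p * (`|s| `^ p + `|t| `^ p).
Proof.
move=> p1; have p0 : 0 <= p by exact: le_trans p1.
have h : `|s + t| <= 2 * Num.max `|s| `|t|.
  apply: (le_trans (ler_normD _ _)); rewrite mulr2n mulrDl mul1r lerD//.
    by rewrite le_max lexx.
  by rewrite le_max lexx orbT.
have M0 : 0 <= Num.max `|s| `|t| by rewrite le_max normr_ge0.
apply: (@le_trans _ _ ((2 * Num.max `|s| `|t|) `^ p)).
  by apply: ge0_ler_powR; rewrite ?nnegrE ?mulr_ge0.
rewrite powRM//.
rewrite ler_wpM2l ?powR_ge0//.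
by case: (leP `|s| `|t|) => _; rewrite ?lerDl ?lerDr powR_ge0.
Qed.

(** Takes the place of Hoelder's inequality and covers p = 1 as well: if |t| > d then |t|^(1-p) <=
    d^(1-p). *)
Lemma norm_le_powR p d t : 1 <= p -> 0 < d -> `|t| <= d + d `^ (1 - p) * `|t| `^ p.
Proof.
move=> p1 d0; have [td|dt] := leP `|t| d.
  by rewrite (le_trans td)// lerDl mulr_ge0 ?powR_ge0.
have t0 : 0 < `|t| by exact: lt_trans dt.
rewrite -[leLHS]add0r lerD ?(ltW d0)//.
apply: (@le_trans _ _ (`|t| `^ (1 - p) * `|t| `^ p)).
  by rewrite -powRD ?subrK ?powRr1// (gt_eqF t0) implybT.
rewrite ler_wpM2r ?powR_ge0// -opprB !powRN lef_pV2 ?posrE ?powR_gt0//.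
by apply: ge0_ler_powR; rewrite ?subr_ge0 ?nnegrE// ltW.
Qed.

End powR_lemmas.

(** * Linearity and almost everywhere uniqueness of weak gradients *)

Section weak_gradients.
Variables (R : realType) (n : nat).
Notation V := 'rV[R]_n.
Notation leb := (@leb R n).
Implicit Types (f g : V -> R) (G H : V -> V).

Lemma loc_integrableB f g : loc_integrable f -> loc_integrable g -> loc_integrable (f \- g).
Proof.
move=> [mf fi] [mg gi]; split; first exact: measurable_funB.
move=> K cK; exact: (integrableB (compact_measurable_rV cK) (fi _ cK) (gi _ cK)).
Qed.

Lemma is_weak_gradientB f g G H : is_weak_gradient f G -> is_weak_gradient g H ->
  is_weak_gradient (f \- g) (fun x => G x - H x).
Proof.
move=> [fl Gl fG] [gl Hl gH]; split.
- exact: loc_integrableB.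
- move=> i; rewrite (_ : (fun _ => _) = (fun x => G x ord0 i) \- (fun x => H x ord0 i)).
    exact: loc_integrableB.
  by apply/funext => x; rewrite !mxE.
- move=> phi cphi i.
  have cp := Cc_smooth_partial i cphi.
  transitivity (\int[leb]_x (f x * partial i phi x - g x * partial i phi x)).
    by apply: eq_Rintegral => x _; rewrite /= mulrBl.
  rewrite RintegralB//; [|exact: loc_integrableM_Cc fl cp|exact: loc_integrableM_Cc gl cp].
  rewrite fG// gH//.
  transitivity (- \int[leb]_x (G x ord0 i * phi x - H x ord0 i * phi x)).
    rewrite RintegralB//; [|exact: loc_integrableM_Cc (Gl i) cphi|exact: loc_integrableM_Cc (Hl i) cphi].
    by rewrite opprB opprK addrC.
  by congr (- _); apply: eq_Rintegral => x _; rewrite !mxE mulrBl.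
Qed.

Lemma is_weak_gradient_unique f G H : is_weak_gradient f G -> is_weak_gradient f H ->
  {ae leb, forall x, G x = H x}.
Proof.
move=> fG fH.
have K i : {ae leb, forall x, G x ord0 i - H x ord0 i = 0}.
  have [_ Gl fG'] := fG; have [_ Hl fH'] := fH.
  apply: (@test_null_ae R n (fun x => G x ord0 i - H x ord0 i)); split.
    exact: (loc_integrableB (Gl i) (Hl i)).
  move=> phi cphi.
  transitivity (\int[leb]_x (G x ord0 i * phi x - H x ord0 i * phi x)).
    by apply: eq_Rintegral => x _; rewrite mulrBl.
  rewrite RintegralB//; [|exact: loc_integrableM_Cc (Gl i) cphi|exact: loc_integrableM_Cc (Hl i) cphi].
  by apply/eqP; rewrite subr_eq0 -eqr_opp -fG'// -fH'.
have KK : {ae leb, forall x i, G x ord0 i - H x ord0 i = 0} by exact: filter_forall.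
apply: filterS KK => x h; apply/rowP => i; apply/eqP; rewrite -subr_eq0; exact/eqP.
Qed.

Lemma weak_gradientP f : (exists G, is_weak_gradient f G) -> is_weak_gradient f (weak_gradient f).
Proof. by move=> h; rewrite /weak_gradient; exact: (getPex h). Qed.

Lemma weak_gradient_ae f G : is_weak_gradient f G -> {ae leb, forall x, weak_gradient f x = G x}.
Proof.
by move=> fG; exact: (is_weak_gradient_unique (weak_gradientP (ex_intro _ G fG)) fG).
Qed.

Lemma weak_gradient_smooth f : smooth f -> {ae leb, forall x, weak_gradient f x = grad f x}.
Proof. by move=> sf; apply: weak_gradient_ae; exact: smooth_weak_gradient. Qed.

Lemma weak_gradient_measurable f : is_weak_gradient f (weak_gradient f) ->
  measurable_fun setT (weak_gradient f).
Proof. by move=> [_ h _]; apply: measurable_fun_rV => i; have [] := h i. Qed.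

End weak_gradients.

(** * Energies *)

Section euclidean_norm.
Variables (R : realType) (n : nat).
Notation V := 'rV[R]_n.
Implicit Types (x y v w : V).

Lemma dot_ge0 v : 0 <= dot v v.
Proof. by apply: sumr_ge0 => i _; rewrite -expr2 sqr_ge0. Qed.

Lemma enorm_ge0 v : 0 <= enorm v.
Proof. exact: sqrtr_ge0. Qed.

Lemma coord_le_enorm v i : `|v ord0 i| <= enorm v.
Proof.
rewrite -sqrtr_sqr ler_sqrt ?dot_ge0// /dot (bigD1 i)//= -expr2 lerDl.
by apply: sumr_ge0 => j _; rewrite -expr2 sqr_ge0.
Qed.

Lemma enorm_le_sum v : enorm v <= \sum_(i < n) `|v ord0 i|.
Proof.
have S0 (r : seq 'I_n) : 0 <= \sum_(i <- r) `|v ord0 i| by apply: sumr_ge0.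
rewrite -[leRHS]ger0_norm// -sqrtr_sqr ler_sqrt ?sqr_ge0// /dot.
elim: (index_enum _) => [|i r ih]; first by rewrite !big_nil expr0n.
rewrite !big_cons sqrrD -addrA lerD//; first by rewrite -expr2 real_normK ?num_real.
by apply: (le_trans ih); rewrite lerDr mulrn_wge0// mulr_ge0.
Qed.

Lemma norm_le_enorm v : `|v| <= enorm v.
Proof. by apply: norm_le_coord; [exact: enorm_ge0|exact: coord_le_enorm]. Qed.

Lemma enorm_le_norm v : enorm v <= n%:R * `|v|.
Proof.
apply: (le_trans (enorm_le_sum v)).
apply: (@le_trans _ _ (\sum_(i < n) `|v|)).
  by apply: ler_sum => i _; exact: coord_le_norm.
by rewrite sumr_const card_ord mulr_natl.
Qed.

Lemma enorm0 : enorm (0 : V) = 0.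
Proof.
apply/eqP; rewrite eq_le enorm_ge0 andbT (le_trans (enorm_le_norm _))//.
by rewrite normr0 mulr0.
Qed.

(** Comparable to the p-th power of the Euclidean norm up to constants depending on n and p; being a
    sum over coordinates, its convexity is one-dimensional. *)
Definition psum (p : R) v : R := \sum_(i < n) `|v ord0 i| `^ p.

Lemma psum_ge0 p v : 0 <= psum p v.
Proof. by apply: sumr_ge0 => i _; exact: powR_ge0. Qed.

Lemma psum_le_enorm p v : 0 <= p -> psum p v <= n%:R * enorm v `^ p.
Proof.
move=> p0; apply: (@le_trans _ _ (\sum_(i < n) enorm v `^ p)).
  apply: ler_sum => i _; apply: ge0_ler_powR => //; rewrite ?nnegrE ?enorm_ge0//.
  exact: coord_le_enorm.
by rewrite sumr_const card_ord mulr_natl.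
Qed.

Lemma psum_convex p a v w : 1 <= p -> 0 <= a <= 1 ->
  psum p (a *: v + (1 - a) *: w) <= a * psum p v + (1 - a) * psum p w.
Proof.
move=> p1 a01; rewrite /psum !mulr_sumr -big_split/=.
by apply: ler_sum => i _; rewrite !mxE; exact: norm_powR_convex.
Qed.

Lemma psumZ p a v : psum p (a *: v) = `|a| `^ p * psum p v.
Proof.
by rewrite /psum mulr_sumr; apply: eq_bigr => i _; rewrite mxE normrM powRM.
Qed.

Lemma psumD_le p v w : 1 <= p -> psum p (v + w) <= 2 `^ p * (psum p v + psum p w).
Proof.
move=> p1; rewrite /psum -big_split/= mulr_sumr.
by apply: ler_sum => i _; rewrite !mxE; exact: norm_powRD_le2.
Qed.

Lemma psumN p v : psum p (- v) = psum p v.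
Proof. by apply: eq_bigr => i _; rewrite mxE normrN. Qed.

Lemma measurable_psum p : measurable_fun setT (psum p).
Proof.
apply: measurable_sum => i.
apply: (measurableT_comp (measurable_powR _)).
by apply: measurableT_comp => //; exact: measurable_coord.
Qed.

End euclidean_norm.

Section gradients.
Variables (R : realType) (n : nat).
Notation V := 'rV[R]_n.
Notation e_ i := (@delta_mx R 1 n ord0 i).
Implicit Types (u v : V -> R).

Lemma gradD u v x : smooth u -> smooth v -> grad (u \+ v) x = grad u x + grad v x.
Proof.
move=> su sv; apply/rowP => i; rewrite !mxE.
exact: (deriveD (smooth_derivable (i := i) (x := x) su) (smooth_derivable sv)).
Qed.

Lemma gradZ c u x : smooth u -> grad (c \*o u) x = c *: grad u x.
Proof.
move=> su; apply/rowP => i; rewrite !mxE.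
exact: (deriveZ c (smooth_derivable (i := i) (x := x) su)).
Qed.

Lemma gradB u v x : smooth u -> smooth v -> grad (u \- v) x = grad u x - grad v x.
Proof.
move=> su sv; apply/rowP => i; rewrite !mxE.
exact: (deriveB (smooth_derivable (i := i) (x := x) su) (smooth_derivable sv)).
Qed.

Lemma grad_comp (F : R -> R) (dF : R) u x : smooth u -> is_derive (u x) 1 F dF ->
  grad (F \o u) x = dF *: grad u x.
Proof.
move=> su dFu; apply/rowP => i; rewrite !mxE.
have du := derivableP (smooth_derivable (i := i) (x := x) su).
by have [_ E] := is_derive_comp du dFu; exact: E.
Qed.

Lemma grad_spos d u x : 0 < d -> smooth u -> grad (spos d \o u) x = dspos d (u x) *: grad u x.
Proof. by move=> d0 su; apply: grad_comp => //; exact: is_derive_spos. Qed.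

Lemma grad_shift y u x : grad (fun z => u (z + y)) x = grad u (x + y).
Proof.
apply/rowP => i; rewrite !mxE /partial /derive.
set a := (fun h : R => _); set b := (fun h : R => _).
suff -> : a = b by [].
by apply/funext => h; rewrite /a /b /= addrA.
Qed.

Lemma measurable_grad u : smooth u -> measurable_fun setT (grad u).
Proof.
move=> su; apply: measurable_fun_rV => i.
rewrite (_ : (fun t => grad u t ord0 i) = partial i u); last by apply/funext => x; rewrite mxE.
by apply: continuous_measurable_rV; apply: smooth_continuous; exact: smooth_partial.
Qed.

End gradients.

Section energy.
Variables (R : realType) (n : nat) (p : R).
Hypothesis p1 : 1 <= p.
Notation V := 'rV[R]_n.
Notation leb := (@leb R n).
Notation Cc := (@Cc_smooth R n).
Implicit Types (u v : V -> R).

Let p0 : 0 < p. Proof. exact: lt_le_trans p1. Qed.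

Definition energy u : R := \int[leb]_x psum p (grad u x).

Lemma bounded_supported_integrable k (f : V -> R) M : measurable_fun setT f ->
  supported_in k f -> (forall x, `|f x| <= M) -> leb.-integrable setT (EFin \o f).
Proof.
move=> mf fk fM; apply: (supported_integrable fk).
apply: measurable_bounded_integrable; [exact: measurable_cube|exact: leb_cube| |].
  exact: measurable_funTS.
exists M; split; first exact: num_real.
by move=> e Me x _; exact/(le_trans (fM x))/ltW.
Qed.

Lemma energy_integrable u : Cc u -> leb.-integrable setT (EFin \o (fun x => psum p (grad u x))).
Proof.
move=> cu; have [k uk] := Cc_smooth_supported cu.
have /choice[M hM] : forall i, exists M, 0 <= M /\ forall x, `|partial i u x| <= M.
  by move=> i; have [M M0 hM] := Cc_smooth_bounded (Cc_smooth_partial i cu); exists M.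
apply: (@bounded_supported_integrable k _ (\sum_(i < n) M i `^ p)).
- exact: (measurableT_comp (@measurable_psum R n p) (measurable_grad (Cc_smooth_smooth cu))).
- move=> x nx; rewrite /psum big1// => i _.
  by rewrite mxE (supported_partial i uk)// normr0 powR0// gt_eqF.
- move=> x; rewrite ger0_norm ?psum_ge0//; apply: ler_sum => i _; rewrite mxE.
  have [Mi hi] := hM i.
  by apply: ge0_ler_powR; rewrite ?nnegrE// ltW.
Qed.

Lemma energy_ge0 u : 0 <= energy u.
Proof. by apply: Rintegral_ge0 => x _; exact: psum_ge0. Qed.

Lemma energyE u : Cc u -> (\int[leb]_x (psum p (grad u x))%:E = (energy u)%:E)%E.
Proof.
move=> cu; rewrite /energy /Rintegral fineK//.
exact: integrable_fin_num (energy_integrable cu).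
Qed.

Lemma energy_shift y u : Cc u -> energy (fun x => u (x + y)) = energy u.
Proof.
move=> cu; rewrite /energy -[RHS](@Rintegral_shift R n y); last exact: energy_integrable.
by apply: eq_Rintegral => x _; rewrite grad_shift.
Qed.

Lemma energyZ c u : Cc u -> energy (c \*o u) = `|c| `^ p * energy u.
Proof.
move=> cu; rewrite /energy -(RintegralZl _ measurableT (energy_integrable cu)).
by apply: eq_Rintegral => x _; rewrite (gradZ c x (Cc_smooth_smooth cu)) psumZ.
Qed.

Lemma energy_convex a u v : Cc u -> Cc v -> 0 <= a <= 1 ->
  energy ((a \*o u) \+ ((1 - a) \*o v)) <= a * energy u + (1 - a) * energy v.
Proof.
move=> cu cv a01.
have iu := energy_integrable cu; have iv := energy_integrable cv.
have su := Cc_smooth_smooth cu; have sv := Cc_smooth_smooth cv.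
have iau := integrableZl measurableT a iu; have ibv := integrableZl measurableT (1 - a) iv.
rewrite /energy -(RintegralZl a measurableT iu) -(RintegralZl (1 - a) measurableT iv).
rewrite -(RintegralD measurableT iau ibv).
apply: (le_Rintegral measurableT).
- by apply: energy_integrable; apply: Cc_smoothD; exact: Cc_smoothZ.
- exact: (integrableD measurableT iau ibv).
- move=> x _; rewrite (gradD x (smoothZ a su) (smoothZ (1 - a) sv)) (gradZ a x su) (gradZ (1 - a) x sv).
  exact: psum_convex.
Qed.

(* [v + spos d (u - v)] and [u - spos d (u - v)] are smooth versions of the maximum and the
   minimum of [u] and [v]; at each point their gradients are complementary convex
   combinations of those of [u] and [v]. *)
Lemma energy_max_min d u v : 0 < d -> Cc u -> Cc v ->
  energy (v \+ (spos d \o (u \- v))) + energy (u \- (spos d \o (u \- v)))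
    <= energy u + energy v.
Proof.
move=> d0 cu cv.
have iu := energy_integrable cu; have iv := energy_integrable cv.
have su := Cc_smooth_smooth cu; have sv := Cc_smooth_smooth cv.
have cs : Cc (spos d \o (u \- v)) by apply: Cc_smooth_spos; exact: Cc_smoothB.
have ss := Cc_smooth_smooth cs.
have iM := energy_integrable (Cc_smoothD cv cs).
have im := energy_integrable (Cc_smoothB cu cs).
have E1 := RintegralD measurableT iM im; have E2 := RintegralD measurableT iu iv.
rewrite -[leLHS]E1 -[leRHS]E2; apply: (le_Rintegral measurableT).
- exact: (integrableD measurableT iM im).
- exact: (integrableD measurableT iu iv).
- move=> x _; rewrite (gradD x sv ss) (gradB x su ss) (grad_spos x d0 (smoothB su sv)) (gradB x su sv).
  set a := dspos d _.
  have a01 : 0 <= a <= 1 by rewrite dspos_ge0// dspos_le1.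
  have b01 : 0 <= 1 - a <= 1 by have /andP[? ?] := a01; rewrite subr_ge0 gerBl; apply/andP.
  clearbody a; move: (grad u x) (grad v x) => U W.
  have -> : W + a *: (U - W) = a *: U + (1 - a) *: W.
    by rewrite scalerBr scalerBl scale1r [RHS]addrCA.
  have -> : U - a *: (U - W) = (1 - a) *: U + (1 - (1 - a)) *: W.
    by rewrite subKr scalerBr opprB scalerBl scale1r [a *: W - _]addrC addrA.
  apply: (le_trans (lerD (psum_convex _ _ p1 a01) (psum_convex _ _ p1 b01))).
  move: (psum p U) (psum p W) => r s; rewrite le_eqVlt; apply/orP; left; apply/eqP.
  clear; ring.
Qed.

End energy.

(** * From the Sobolev norm to integrals of p-th powers *)

Section sobolev_approximation.
Variables (R : realType) (n : nat) (p : R).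
Hypothesis p1 : 1 <= p.
Notation V := 'rV[R]_n.
Notation leb := (@leb R n).
Notation Cc := (@Cc_smooth R n).
Implicit Types (f g u v phi psi : V -> R).

Let p0 : 0 < p. Proof. exact: lt_le_trans p1. Qed.

Lemma Lnorm_lt_integral (f : V -> R) e : 0 < e -> ('N[leb]_(p%:E) [EFin \o f] < e%:E)%E ->
  (\int[leb]_x (`|f x| `^ p)%:E <= (e `^ p)%:E)%E.
Proof.
move=> e0 h; rewrite (_ : (fun _ => _) = (fun x => `|(EFin \o f) x| `^ p)%E)//.
rewrite -powR_Lnorm ?gt_eqF// -poweR_EFin.
apply: gt0_ler_poweR; rewrite ?ltW// !in_itv/= !leey ?Lnorm_ge0//.
by rewrite lee_fin ltW.
Qed.

Lemma measurable_normr_powR (f : V -> R) : measurable_fun setT f ->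
  measurable_fun setT (fun x => (`|f x| `^ p)%:E).
Proof.
move=> mf; apply/measurable_EFinP; apply: (measurableT_comp (measurable_powR _)).
exact: measurableT_comp.
Qed.

(** The norm involves a chosen weak gradient of the difference, which equals the difference of
    gradients only almost everywhere. The factor n is that of [psum_le_enorm]. *)
Lemma sobolev_near g phi e : 0 < e -> is_weak_gradient g (weak_gradient g) -> Cc phi ->
  (sobolev_norm p (g \- phi)%R < e%:E)%E ->
  (\int[leb]_x (`|g x - phi x| `^ p)%R%:E <= (e `^ p)%:E)%E /\
  (\int[leb]_x (psum p (weak_gradient g x - grad phi x)%R)%:E <= (n%:R * e `^ p)%R%:E)%E.
Proof.
move=> e0 wg cphi; rewrite /sobolev_norm => h.
have sphi := Cc_smooth_smooth cphi.
have wgd := is_weak_gradientB wg (smooth_weak_gradient sphi).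
have h1 : ('N[leb]_(p%:E) [EFin \o (g \- phi)%R] < e%:E)%E.
  by apply: le_lt_trans h; rewrite leeDl// Lnorm_ge0.
have h2 : ('N[leb]_(p%:E) [EFin \o (@enorm R n \o weak_gradient (g \- phi)%R)] < e%:E)%E.
  by apply: le_lt_trans h; rewrite leeDr// Lnorm_ge0.
split; first exact: Lnorm_lt_integral h1.
have := Lnorm_lt_integral e0 h2.
set w := weak_gradient (g \- phi) => h3.
have mw : measurable_fun setT w.
  by apply: weak_gradient_measurable; apply: weak_gradientP; eexists; exact: wgd.
have mps (G : V -> V) : measurable_fun setT G -> measurable_fun setT (fun x => (psum p (G x))%:E).
  by move=> mG; apply/measurable_EFinP; exact: (measurableT_comp (@measurable_psum R n p) mG).
have md : measurable_fun setT (fun x => weak_gradient g x - grad phi x).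
  apply: measurable_fun_rV => i; under eq_fun do rewrite 2!mxE.
  apply: measurable_funB.
    by have [_ + _] := wg => /(_ i)[].
  exact: (measurableT_comp (@measurable_coord R n i) (measurable_grad sphi)).
rewrite (_ : (\int[leb]_x _ = \int[leb]_x (psum p (w x))%:E)%E); last first.
  apply: ge0_ae_eq_integral => //; [exact: mps|exact: mps| | |].
  - by move=> x _; rewrite lee_fin psum_ge0.
  - by move=> x _; rewrite lee_fin psum_ge0.
  - by have := weak_gradient_ae wgd; apply: filterS => x E _; rewrite /w E.
apply: (@le_trans _ _ (\int[leb]_x (n%:R%:E * (`|enorm (w x)| `^ p)%:E))%E).
  have men : measurable_fun setT (fun x => enorm (w x)).
    exact: (measurableT_comp (@measurable_enorm R n) mw).
  apply: ge0_le_integral => //.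
  - by move=> x _; rewrite lee_fin psum_ge0.
  - exact: mps.

  - by apply: emeasurable_funM => //; exact: measurable_normr_powR.
  - move=> x _; rewrite -EFinM lee_fin (ger0_norm (enorm_ge0 _)).
    by apply: psum_le_enorm; exact: ltW.
rewrite ge0_integralZl//.
- by rewrite EFinM; apply: lee_wpmul2l; rewrite ?lee_fin//.
- apply: measurable_normr_powR; exact: (measurableT_comp (@measurable_enorm R n) mw).
Qed.

(** Both approximations are compared with the weak gradient of [g]; the conclusion concerns smooth
    functions only, where the capacity argument takes place. *)
Lemma energy_near g phi psi e : 0 < e -> is_weak_gradient g (weak_gradient g) ->
  Cc phi -> Cc psi -> (sobolev_norm p (g \- phi)%R < e%:E)%E ->
  (sobolev_norm p (g \- psi)%R < e%:E)%E ->
  energy p (psi \- phi) <= 2 `^ p * (n%:R * e `^ p + n%:R * e `^ p).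
Proof.
move=> e0 wg cphi cpsi /(sobolev_near e0 wg cphi)[_ h1] /(sobolev_near e0 wg cpsi)[_ h2].
have sphi := Cc_smooth_smooth cphi; have spsi := Cc_smooth_smooth cpsi.
rewrite -lee_fin -(energyE p1 (Cc_smoothB cpsi cphi)).
have md f : smooth f -> measurable_fun setT (fun x => (psum p (weak_gradient g x - grad f x)%R)%:E).
  move=> sf; apply/measurable_EFinP; apply: (measurableT_comp (@measurable_psum R n p)).
  apply: measurable_fun_rV => i; under eq_fun do rewrite 2!mxE.
  apply: measurable_funB.
    by have [_ + _] := wg => /(_ i)[].
  exact: (measurableT_comp (@measurable_coord R n i) (measurable_grad sf)).
apply: (@le_trans _ _ (\int[leb]_x ((2 `^ p)%:E * ((psum p (weak_gradient g x - grad phi x)%R)%:E + (psum p (weak_gradient g x - grad psi x)%R)%:E)))%E).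
  apply: ge0_le_integral => //.
  - by move=> x _; rewrite lee_fin psum_ge0.
  - apply/measurable_EFinP; apply: (measurableT_comp (@measurable_psum R n p)).
    by apply: measurable_grad; exact: smoothB.

  - by apply: emeasurable_funM => //; apply: emeasurable_funD; exact: md.
  - move=> x _; rewrite -EFinD -EFinM lee_fin (gradB x spsi sphi).
    rewrite -(psumN p (weak_gradient g x - grad psi x)).
    rewrite (_ : grad psi x - grad phi x = (weak_gradient g x - grad phi x) - (weak_gradient g x - grad psi x)).
      exact: psumD_le.
    by rewrite opprB [RHS]addrC subrKA.
rewrite ge0_integralZl//; last 2 first.
- by apply: emeasurable_funD; exact: md.
- by move=> x _; rewrite -EFinD lee_fin addr_ge0// psum_ge0.
rewrite EFinM lee_wpmul2l ?lee_fin ?powR_ge0//.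
rewrite ge0_integralD//; [|by move=> x _; rewrite lee_fin psum_ge0|exact: md
  |by move=> x _; rewrite lee_fin psum_ge0|exact: md].
exact: (leeD h1 h2).
Qed.

Lemma Cc_smooth_Lnorm f : Cc f -> ('N[leb]_(p%:E) [EFin \o f] < +oo)%E.
Proof.
move=> cf; rewrite unlock; apply: poweR_lty.
have [k fk] := Cc_smooth_supported cf; have [M M0 hM] := Cc_smooth_bounded cf.
have mf := continuous_measurable_rV (smooth_continuous (Cc_smooth_smooth cf)).
suff H : leb.-integrable setT (EFin \o (fun x => `|f x| `^ p)) by exact: (integrable_lty measurableT H).
apply: (@bounded_supported_integrable R n k _ (M `^ p)).
- by apply/measurable_EFinP; exact: (measurable_normr_powR mf).
- by move=> x nx; rewrite fk// normr0 powR0// gt_eqF.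
- move=> x; rewrite ger0_norm ?powR_ge0//.
  by apply: ge0_ler_powR; rewrite ?nnegrE// ltW.
Qed.

Lemma Lnorm_ae (f g : V -> R) : measurable_fun setT f -> measurable_fun setT g ->
  {ae leb, forall x, f x = g x} -> ('N[leb]_(p%:E) [EFin \o f] = 'N[leb]_(p%:E) [EFin \o g])%E.
Proof.
move=> mf mg fg; rewrite unlock; apply: (congr1 (fun z => z `^ p^-1)%E).
apply: ge0_ae_eq_integral => //.
- exact: measurable_normr_powR.
- exact: measurable_normr_powR.
- by move=> x _; exact: poweR_ge0.
- by move=> x _; exact: poweR_ge0.
- by apply: filterS fg => x E _ /=; rewrite E.
Qed.

Lemma Lnorm_weak_gradient_smooth f : smooth f ->
  ('N[leb]_(p%:E) [EFin \o (@enorm R n \o weak_gradient f)] =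
  'N[leb]_(p%:E) [EFin \o (@enorm R n \o grad f)])%E.
Proof.
move=> sf; apply: Lnorm_ae.
- apply: (measurableT_comp (@measurable_enorm R n)); apply: weak_gradient_measurable.
  by apply: weak_gradientP; eexists; exact: smooth_weak_gradient.
- exact: (measurableT_comp (@measurable_enorm R n) (measurable_grad sf)).
- by have := weak_gradient_smooth sf; apply: filterS => x /= ->.
Qed.

(** [f] approximates itself; finiteness of its norm follows once the chosen weak gradient is
    replaced, almost everywhere, by the bounded classical one. *)
Lemma Cc_smooth_W01p f : Cc f -> W01p p f.
Proof.
move=> cf; have sf := Cc_smooth_smooth cf; split; last first.
  move=> e e0; exists f => //; rewrite /sobolev_norm.
  have -> : f \- f = cst 0 by apply/funext => x /=; rewrite subrr.
  have s0 : smooth (cst 0 : V -> R) by exact: smooth_cst.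
  rewrite Lnorm_weak_gradient_smooth//.
  rewrite (_ : @enorm R n \o grad (cst 0) = cst 0); last first.
    apply/funext => x /=; rewrite (_ : grad _ _ = 0) ?enorm0//.
    by apply/rowP => i; rewrite !mxE /partial derive_cst.
  by rewrite (_ : EFin \o cst 0 = cst 0%E)// Lnorm0 ?adde0// eqe gt_eqF.
split; first by exists (grad f); exact: smooth_weak_gradient.
rewrite /sobolev_norm Lnorm_weak_gradient_smooth//; apply: lte_add_pinfty.
  exact: Cc_smooth_Lnorm.
rewrite unlock; apply: poweR_lty.
have [k fk] := Cc_smooth_supported cf.
have /choice[M hM] : forall i, exists M, 0 <= M /\ forall x, `|partial i f x| <= M.
  by move=> i; have [M M0 hM] := Cc_smooth_bounded (Cc_smooth_partial i cf); exists M.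
suff H : leb.-integrable setT (EFin \o (fun x => `|enorm (grad f x)| `^ p)) by exact: (integrable_lty measurableT H).
apply: (@bounded_supported_integrable R n k _ ((\sum_(i < n) M i) `^ p)).
- apply/measurable_EFinP; apply: measurable_normr_powR.
  exact: (measurableT_comp (@measurable_enorm R n) (measurable_grad sf)).
- move=> x nx; rewrite (_ : grad f x = 0) ?enorm0 ?normr0 ?powR0 ?gt_eqF//.
  by apply/rowP => i; rewrite !mxE (supported_partial i fk).
- move=> x; rewrite ger0_norm ?powR_ge0// ger0_norm ?enorm_ge0//.
  apply: ge0_ler_powR; rewrite ?nnegrE ?enorm_ge0//; first exact: ltW.
    by apply: sumr_ge0 => i _; have [] := hM i.
  apply: (le_trans (enorm_le_sum _)); apply: ler_sum => i _; rewrite mxE.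
  by have [_] := hM i.
Qed.

End sobolev_approximation.

(** * Means over balls *)

Section ball_means.
Variables (R : realType) (n : nat).
Notation V := 'rV[R]_n.
Notation leb := (@leb R n).
Notation Cc := (@Cc_smooth R n).
Implicit Types (f g u psi : V -> R) (x y : V) (r : R).

Definition vol (A : set V) : R := fine (leb A).

Lemma eballE x r : eball x r = (fun y : V => y + - x) @^-1` eball 0 r.
Proof. by apply/seteqP; split => y; rewrite /eball /= subr0. Qed.

Lemma measurable_eball0 r : measurable (eball (0 : V) r).
Proof.
rewrite (_ : eball 0 r = @enorm R n @^-1` `]-oo, r[).
  by rewrite -[X in measurable X]setTI; apply: measurable_enorm.
by apply/seteqP; split => x; rewrite /eball /= subr0 in_itv.
Qed.

Lemma measurable_eball x r : measurable (eball x r).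
Proof. by rewrite eballE; apply: measurable_preimage_shift; exact: measurable_eball0. Qed.

Lemma leb_eball x r : leb (eball x r) = leb (eball 0 r).
Proof. by rewrite eballE leb_preimage_shift//; exact: measurable_eball0. Qed.

Lemma eball_norm x r y : eball x r y -> `|y - x| < r.
Proof. exact: le_lt_trans (norm_le_enorm _). Qed.

Lemma eball_sub_cube x r : exists k, eball x r `<=` cube k.
Proof.
apply: (@bounded_sub_cube R n _ (r + `|x|)) => y /eball_norm yr.
by rewrite -(subrK x y) (le_trans (ler_normD _ _))// lerD2r ltW.
Qed.

Lemma leb_sub_cube (A : set V) : measurable A -> (exists k, A `<=` cube k) -> leb A \is a fin_num.
Proof.
move=> mA [k Ak]; rewrite ge0_fin_numE//.
by apply: le_lt_trans (@leb_cube R n k); apply: le_measure => //; rewrite inE//; exact: measurable_cube.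
Qed.

Lemma leb_obox_gt0 (a b : V) : (forall i, a ord0 i < b ord0 i) -> (0 < leb (obox a b))%E.
Proof.
move=> ab; rewrite obox_rbox (leb_box (A := fun i => `]a ord0 i, b ord0 i[%classic))//.
apply: (big_ind (fun z => 0 < z)%E) => //; first by move=> z w; exact: mule_gt0.
by move=> i _; rewrite lebesgue_measure_itv/= lte_fin ab -EFinB lte_fin subr_gt0.
Qed.

Lemma vol_eball_gt0 x r : 0 < r -> 0 < vol (eball x r).
Proof.
move=> r0; rewrite /vol leb_eball.
have fin := leb_sub_cube (@measurable_eball0 r) (eball_sub_cube 0 r).
rewrite -lte_fin fineK//.
(* The Euclidean norm is at most n times the sup norm, so the sup-ball of this radius fits; n + 1
   gives a strict inequality and also covers n = 0. *)
pose e := r / n.+1%:R.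
have e0 : 0 < e by rewrite divr_gt0.
apply: (@lt_le_trans _ _ (leb (ball (0 : V) e))).
  by rewrite ball_obox//; apply: leb_obox_gt0 => i; rewrite !mxE ltrD2l gtrN.
apply: le_measure; rewrite ?inE; [exact: measurable_ball_rV|exact: measurable_eball0|].
move=> y; rewrite mx_norm_ball /ball_ /= sub0r normrN => ye.
rewrite /eball /= subr0 (le_lt_trans (enorm_le_norm y))//.
apply: (@le_lt_trans _ _ (n%:R * e)); first by rewrite ler_wpM2l// ltW.
by rewrite /e mulrCA gtr_pMr// ltr_pdivrMr// mul1r ltr_nat.
Qed.

Lemma loc_integrable_eball f x r : loc_integrable f -> leb.-integrable (eball x r) (EFin \o f).
Proof.
move=> fl; apply: loc_integrable_bounded_set => //; first exact: measurable_eball.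
exact: eball_sub_cube.
Qed.

Lemma loc_integrable_cst (c : R) : loc_integrable (cst c : V -> R).
Proof. by apply: continuous_loc_integrable; exact: cst_continuous. Qed.

Lemma ball_meanB f g x r : loc_integrable f -> loc_integrable g ->
  ball_mean f x r - ball_mean g x r = ball_mean (f \- g) x r.
Proof.
move=> fl gl; rewrite /ball_mean -mulrBr; congr (_ * _).
rewrite -(RintegralB (measurable_eball x r) (loc_integrable_eball x r fl) (loc_integrable_eball x r gl)).
by [].
Qed.

Lemma ball_mean_cst (c : R) x r : 0 < r -> ball_mean (cst c) x r = c.
Proof.
move=> r0; rewrite /ball_mean Rintegral_cst; last exact: measurable_eball.
by rewrite mulrC mulfK// gt_eqF// vol_eball_gt0.
Qed.

Lemma norm_ball_mean_le f h x r : 0 < r -> loc_integrable f ->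
  leb.-integrable (eball x r) (EFin \o h) -> (forall y, eball x r y -> `|f y| <= h y) ->
  `|ball_mean f x r| <= ball_mean h x r.
Proof.
move=> r0 fl hi fh; rewrite /ball_mean normrM gtr0_norm ?invr_gt0 ?vol_eball_gt0//.
rewrite ler_wpM2l ?invr_ge0 ?(ltW (vol_eball_gt0 x r0))//.
have mB := measurable_eball x r; have fi := loc_integrable_eball x r fl.
apply: (le_trans (le_normr_Rintegral mB fi)).
by apply: (le_Rintegral mB) => //; exact: integrable_norm.
Qed.

Lemma ball_mean_cvg f x : continuous f -> ball_mean f x r @[r --> 0^'+] --> f x.
Proof.
move=> cf; apply/cvgrPdist_le => e e0.
have : nbhs x [set y | `|f x - f y| <= e].
  by have /cvgrPdist_le := cf x; exact.
rewrite -nbhs_ballE => -[d /= d0 dh].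
near=> r.
have r0 : 0 < r by near: r; exact: nbhs_right_gt.
have rd : r < d by near: r; exact: nbhs_right_lt.
have fl := continuous_loc_integrable cf.
rewrite -(ball_mean_cst (f x) x r0) ball_meanB//; last exact: loc_integrable_cst.
rewrite -[leRHS](ball_mean_cst e x r0).
apply: norm_ball_mean_le => //.
- exact: (loc_integrableB (@loc_integrable_cst (f x)) fl).
- exact: loc_integrable_eball (@loc_integrable_cst e).
- move=> y yr; apply: dh; rewrite mx_norm_ball /ball_/= distrC.
  by rewrite (lt_trans (eball_norm yr)).
Unshelve. all: by end_near. Qed.

Lemma precise_continuous f : continuous f -> precise f = f.
Proof.
move=> cf; apply/funext => x; rewrite /precise.
have H := @ball_mean_cvg f x cf.
case: pselect => [h|nc] /=; first exact/cvg_lim.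
by exfalso; apply: nc; exact: cvgP H.
Qed.

(** The bound does not depend on [x], since the volume of a ball depends only on its radius. For
    fixed [r], a small [d] and then a small [E] make it arbitrarily small. *)
Lemma ball_mean_near p g psi (E d : R) x r : 1 <= p -> 0 < r -> 0 < d ->
  loc_integrable g -> continuous psi ->
  (\int[leb]_y (`|g y - psi y| `^ p)%R%:E <= E%:E)%E ->
  `|ball_mean g x r - ball_mean psi x r| <= d + d `^ (1 - p) * (vol (eball 0 r))^-1 * E.
Proof.
move=> p1 r0 d0 gl cpsi hE.
have pl := continuous_loc_integrable cpsi.
have gpl := loc_integrableB gl pl.
rewrite ball_meanB//.
have mB := measurable_eball x r.
pose q y := `|g y - psi y| `^ p.
have mq : measurable_fun setT (EFin \o q).
  apply: measurable_normr_powR; by have [] := gpl.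
have q0 y : (0 <= (EFin \o q) y)%E by rewrite lee_fin powR_ge0.
have iqB : (\int[leb]_(y in eball x r) (q y)%:E <= E%:E)%E.
  have H := @ge0_subset_integral _ _ _ leb _ _ mB measurableT _ mq (fun y _ => q0 y) (@subsetT _ _).
  exact: (le_trans H hE).
have iq : leb.-integrable (eball x r) (EFin \o q).
  apply/integrableP; split; first exact: measurable_funTS.
  under eq_integral do rewrite gee0_abs//.
  exact: le_lt_trans iqB (ltry _).
have iqd : leb.-integrable (eball x r) (EFin \o (fun y => d `^ (1 - p) * q y)).
  exact: (integrableZl mB (d `^ (1 - p)) iq).
have id := loc_integrable_eball x r (@loc_integrable_cst d).
apply: (@le_trans _ _ (ball_mean (fun y => d + d `^ (1 - p) * q y) x r)).
  apply: norm_ball_mean_le => //; first exact: (integrableD mB id iqd).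
  by move=> y _; exact: norm_le_powR.
rewrite /ball_mean (RintegralD mB id iqd) (RintegralZl _ mB iq) mulrDr.
have -> : (fine (leb (eball x r)))^-1 * \int[leb]_(y in eball x r) d = d.
  exact: ball_mean_cst.
rewrite lerD2l -[fine (leb _)]/(vol _) /vol leb_eball -/(vol _) mulrCA -mulrA.
have v0 := vol_eball_gt0 0 r0; have iv0 : 0 <= (vol (eball (0:V) r))^-1 by rewrite invr_ge0 ltW.
apply: ler_wpM2l; first exact: powR_ge0.
apply: ler_wpM2l => //.
by rewrite -lee_fin /Rintegral fineK//; exact: integrable_fin_num iq.
Qed.

Lemma Rintegral_eball_shift psi x r : continuous psi ->
  \int[leb]_(y in eball x r) psi y = \int[leb]_(y in eball 0 r) psi (y + x).
Proof.
move=> cpsi; rewrite (Rintegral_mkcond _ (eball x r)) (Rintegral_mkcond _ (eball 0 r)).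
have fl := continuous_loc_integrable cpsi.
rewrite -(@Rintegral_shift R n x); last first.
  have := (integrable_mkcond _ (measurable_eball x r)).1 (loc_integrable_eball x r fl).
  rewrite (_ : _ \_ _ = EFin \o (psi \_ (eball x r)))//.
  by apply/funext => y; rewrite /patch /=; case: ifP.
apply: eq_Rintegral => y _; rewrite /patch.
suff -> : (y + x \in eball x r) = (y \in eball 0 r) by [].
by apply/idP/idP; rewrite !inE /eball /= addrK subr0.
Qed.

(** Changing one coordinate at a time, the mean value bound gives a Lipschitz constant: the sum of
    the bounds on the partial derivatives. *)
Lemma Cc_smooth_unif psi e : Cc psi -> 0 < e -> exists2 d, 0 < d &
  forall x y, `|x - y| < d -> `|psi x - psi y| <= e.
Proof.
move=> cpsi e0; have spsi := Cc_smooth_smooth cpsi.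
have /choice[M hM] : forall i, exists M, 0 <= M /\ forall x, `|partial i psi x| <= M.
  by move=> i; have [M M0 hM] := Cc_smooth_bounded (Cc_smooth_partial i cpsi); exists M.
pose S := \sum_(i < n) M i.
have S0 : 0 <= S by apply: sumr_ge0 => i _; have [] := hM i.
have step (v x : V) (s : seq 'I_n) :
  `|psi (\sum_(i <- s) v ord0 i *: delta_mx ord0 i + x) - psi x| <= \sum_(i <- s) M i * `|v|.
  elim: s => [|i s ih]; first by rewrite !big_nil add0r subrr normr0.
  rewrite !big_cons -addrA; set z := _ + x in ih *.
  rewrite -(subrKA (psi z)) (le_trans (ler_normD _ _))// lerD//.
  have [Mi hi] := hM i.
  apply: (le_trans (partial_MVT _ _ (fun w => smooth_derivable spsi) hi)).
  by rewrite ler_wpM2l// coord_le_norm.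
have lip v x : `|psi (v + x) - psi x| <= S * `|v|.
  have := step v x (index_enum _); rewrite -mulr_suml.
  by rewrite -row_sum_delta.
exists (e / (S + 1)); first by rewrite divr_gt0// ltr_wpDl.
move=> x y xy; have := lip (x - y) y; rewrite subrK => /le_trans; apply.
rewrite ltr_pdivlMr ?ltr_wpDl// in xy; apply: le_trans (ltW xy).
by rewrite mulrC ler_wpM2l// lerDl.
Qed.

End ball_means.

(** * Capacity along increasing sequences *)

Lemma lt_subr_max (R : realType) (a b c t : R) : c < a -> c < b -> t <= Num.max (a - b) 0 -> c < a - t.
Proof. by move=> a1 b1; rewrite maxEle; case: ifP => _ ?; lra. Qed.

(** Bookkeeping of one step of [capacity_increasing]: with q = 2q', an allowance e - q plus a new
    loss q' makes e - q'. *)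
Lemma telescope_lt (R : realType) (a b c c' e q q' : R) : q = q' + q' ->
  b < c + (e - q) -> a < c' + q' -> a + b - c < c' + (e - q').
Proof. by move=> -> h1 h2; lra. Qed.

Section capacity_argument.
Variables (R : realType) (n : nat) (p : R).
Hypothesis p1 : 1 <= p.
Notation V := 'rV[R]_n.
Notation leb := (@leb R n).
Notation Cc := (@Cc_smooth R n).
Implicit Types (f g u v psi : V -> R) (x y : V) (r : R).

Lemma finite_subcover (I : choiceType) (A : set V) (D : set I) (f : I -> set V) : compact A ->
  (forall i, D i -> open (f i)) -> A `<=` \bigcup_(i in D) f i ->
  exists2 s : seq I, (forall i, i \in s -> D i) & forall x, A x -> exists2 i, i \in s & f i x.
Proof.
move=> cA fo Af; have : cover_compact A by rewrite -compact_cover.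
move=> /(_ I D f fo Af)[D' sD' cov]; exists (finmap.enum_fset D').
  by move=> i /sD'; rewrite inE.
by move=> x /cov [i iD' fix_]; exists i.
Qed.

(* The mean over [A] is a limit of Riemann sums: a finite cover of [A] by small balls gives
   a convex combination of translates of [psi]. *)
Lemma mean_convex_approx psi (d e : R) : Cc psi -> 0 <= e ->
  (forall x y, `|x - y| < d -> `|psi x - psi y| <= e) ->
  forall (L : seq V) (A : set V), measurable A -> (exists k, A `<=` cube k) ->
  (forall y, A y -> exists2 c, c \in L & ball c d y) ->
  exists u, [/\ Cc u, energy p u <= energy p psi &
    forall x, `|vol A * u x - \int[leb]_(y in A) psi (y + x)| <= e * vol A].
Proof.
move=> cpsi e0 psid; have spsi := Cc_smooth_smooth cpsi.
elim=> [|c L ih] A mA Ak AL.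
  have -> : A = set0 by apply/seteqP; split => // y /AL[].
  exists psi; split => // x.
  by rewrite Rintegral_set0 subr0 /vol measure0 mul0r normr0 mulr0.
(* On the part of [A] within the first ball, [psi (y + x)] is replaced by [psi (x + c)]; the
   remaining part is covered by the rest of the list. *)
pose A1 := A `&` ball c d; pose A2 := A `\` ball c d.
have mb : measurable (ball c d) by exact: measurable_ball_rV.
have mA1 : measurable A1 by exact: measurableI.
have mA2 : measurable A2 by exact: measurableD.
have A1k : exists k, A1 `<=` cube k by have [k hk] := Ak; exists k => y [/hk].
have A2k : exists k, A2 `<=` cube k by have [k hk] := Ak; exists k => y [/hk].
have A2L y : A2 y -> exists2 c, c \in L & ball c d y.
  move=> [Ay nb]; have [c'] := AL y Ay; rewrite inE => /orP[/eqP-> //|c'L h].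
  by exists c'.
have [u2 [cu2 eu2 hu2]] := ih A2 mA2 A2k A2L.
have cc := Cc_smooth_shift c cpsi.
have psix x : loc_integrable (fun y => psi (y + x)).
  by apply: continuous_loc_integrable; exact: (smooth_continuous (smooth_shift x spsi)).
have iA x B : measurable B -> (exists k, B `<=` cube k) ->
    leb.-integrable B (EFin \o (fun y => psi (y + x))).
  by move=> mB Bk; exact: loc_integrable_bounded_set (psix x) mB Bk.
have AU : A = A1 `|` A2 by rewrite /A1 /A2 setUIDK.
have dis : [disjoint A1 & A2] by apply/disj_setPS => y [[_ ?] [_ ?]].
have volU : vol A = vol A1 + vol A2.
  rewrite /vol {1}AU measureU//; last by apply/eqP; exact: dis.
  by rewrite fineD//; exact: leb_sub_cube.
have intU x : \int[leb]_(y in A) psi (y + x) =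
    \int[leb]_(y in A1) psi (y + x) + \int[leb]_(y in A2) psi (y + x).
  by rewrite {1}AU Rintegral_setU//; rewrite -AU; exact: iA.
have v1 : 0 <= vol A1 by rewrite fine_ge0.
have v2 : 0 <= vol A2 by rewrite fine_ge0.
have h1 x : `|vol A1 * psi (x + c) - \int[leb]_(y in A1) psi (y + x)| <= e * vol A1.
  have ic : leb.-integrable A1 (EFin \o cst (psi (x + c))).
    exact: loc_integrable_bounded_set (@loc_integrable_cst R n (psi (x + c))) mA1 A1k.
  have ie : leb.-integrable A1 (EFin \o cst e).
    exact: loc_integrable_bounded_set (@loc_integrable_cst R n e) mA1 A1k.
  have ii := iA x A1 mA1 A1k.
  have -> : vol A1 * psi (x + c) = \int[leb]_(y in A1) psi (x + c).
    by rewrite Rintegral_cst// mulrC.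
  rewrite -(RintegralB mA1 ic ii).
  apply: (le_trans (le_normr_Rintegral mA1 (integrableB mA1 ic ii))).
  rewrite -[leRHS](Rintegral_cst leb mA1 e).
  apply: (le_Rintegral mA1 (integrable_norm (integrableB mA1 ic ii)) ie).
  move=> y [_]; rewrite mx_norm_ball /ball_/= => cy; apply: psid.
  by rewrite (addrC y x) opprD addrACA subrr add0r.
(* If [A] is null then l = 0, the inverse of 0 being 0. For this case the claim is multiplied by
   [vol A] rather than divided by it. *)
pose l := vol A1 / (vol A1 + vol A2).
have l01 : 0 <= l <= 1.
  rewrite /l divr_ge0 ?addr_ge0//=.
  have [->|v0] := eqVneq (vol A1 + vol A2) 0; first by rewrite invr0 mulr0.
  by rewrite ler_pdivrMr ?mul1r ?lerDl// lt_neqAle eq_sym v0 addr_ge0.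
exists ((l \*o (fun x => psi (x + c))) \+ ((1 - l) \*o u2)); split.
- by apply: Cc_smoothD; exact: Cc_smoothZ.
- apply: (le_trans (energy_convex p1 cc cu2 l01)); rewrite energy_shift//.
  have /andP[l0 l1] := l01.
  apply: (@le_trans _ _ (l * energy p psi + (1 - l) * energy p psi)).
    by rewrite lerD2l; apply: ler_wpM2l; rewrite ?subr_ge0.
  by move: (energy p psi) => E; rewrite -mulrDl subrKC mul1r.
move=> x; have -> : vol A * ((l \*o (fun x => psi (x + c))) \+ ((1 - l) \*o u2)) x =
    vol A1 * psi (x + c) + vol A2 * u2 x.
  rewrite volU /l /=; have [v0|v0] := eqVneq (vol A1 + vol A2) 0; last first.
    by move: (psi _) (u2 _) => a b; clear -v0; field.
  have /eqP := v0; rewrite paddr_eq0// => /andP[/eqP -> /eqP ->].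
  by rewrite !addr0 !mul0r addr0.
rewrite intU opprD addrACA volU mulrDr.
by apply: (le_trans (ler_normD _ _)); exact: lerD.
Qed.

(** A uniformly close competitor of no larger energy stands in for the ball mean, whose own gradient
    is therefore never computed. *)
Lemma ball_mean_approx psi r e : Cc psi -> 0 < r -> 0 < e ->
  exists u, [/\ Cc u, energy p u <= energy p psi & forall x, `|u x - ball_mean psi x r| <= e].
Proof.
move=> cpsi r0 e0; have [d d0 hd] := Cc_smooth_unif cpsi e0.
have [k hk] := eball_sub_cube (0 : V) r.
have [L _ cov] : exists2 s : seq V, (forall c, c \in s -> [set: V] c) &
    forall y, cube k y -> exists2 c, c \in s & ball c d y.
  apply: finite_subcover; first exact: compact_cube.
    by move=> c _; exact: ball_open.
  by move=> y _; exists y => //; exact: ballxx.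
have [u [cu eu hu]] := mean_convex_approx cpsi (ltW e0) hd (measurable_eball0 (n := n) r)
  (ex_intro _ k hk) (fun y Ay => cov y (hk y Ay)).
exists u; split => // x.
have v0 := vol_eball_gt0 (0 : V) r0.
rewrite /ball_mean leb_eball (Rintegral_eball_shift x r (smooth_continuous (Cc_smooth_smooth cpsi))).
rewrite -(ler_pM2l v0) -{1}(gtr0_norm v0) -normrM mulrBr -/(vol _) mulVKf ?gt_eqF// [leRHS]mulrC.
exact: hu.
Qed.

Lemma powR_slack (X T : R) : 0 <= X -> X < T -> exists2 b, 1 < b & b `^ p * X < T.
Proof.
have p0 : 0 < p by exact: lt_le_trans p1.
move=> X0 XT; pose X' := (X + T) / 2.
have [X1 X2] : X < X' /\ X' < T by rewrite /X'; split; lra.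
have X'0 : 0 < X' by exact: le_lt_trans X1.
have TX : 1 < T / X' by rewrite ltr_pdivlMr// mul1r.
exists ((T / X') `^ p^-1).
  have -> : (1 : R) = 1 `^ p^-1 by rewrite powR1.
  by apply: gt0_ltr_powR; rewrite ?invr_gt0// nnegrE ltW// (lt_trans _ TX).
rewrite -powRrM mulVf ?gt_eqF// powRr1; last by rewrite ltW// (lt_trans _ TX).
rewrite -mulrA gtr_pMr; last by exact: le_lt_trans XT.
by rewrite mulrC ltr_pdivrMr// mul1r.
Qed.

(** The left side bounds the energy of a convex combination, with weight [a] on a function enlarged
    by 1/a and weight 1 - a on a fixed function of energy [B]; both costs disappear as a tends to
    1. *)
Lemma convex_slack (X T B : R) : 0 <= X -> X < T -> 0 <= B ->
  exists2 a, 0 < a < 1 & a^-1 `^ p * X + (1 - a) * B < T.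
Proof.
move=> X0 XT B0; pose X' := (X + T) / 2.
have [X1 X2] : X < X' /\ X' < T by rewrite /X'; split; lra.
have [b b1 bX] := powR_slack X0 X1.
have p0 : 0 <= p by exact: le_trans p1.
(* The first term ensures 1/(1 - d) <= b, the second d B <= T - X'. *)
pose d := Num.min (1 - b^-1) ((T - X') / (B + 1)).
have b0 : 0 < b by exact: lt_trans b1.
have B1 : 0 < B + 1 by rewrite ltr_wpDl.
have d0 : 0 < d by rewrite lt_min subr_gt0 invf_lt1// b1 divr_gt0// subr_gt0.
have db : d <= 1 - b^-1 by rewrite ge_min lexx.
have dT : d * (B + 1) <= T - X' by rewrite -ler_pdivlMr// ge_min lexx orbT.
have bV : 0 < b^-1 by rewrite invr_gt0.
have ad : b^-1 <= 1 - d by rewrite lerBrDl -lerBrDr.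
have a0 : 0 < 1 - d by exact: lt_le_trans ad.
exists (1 - d); first by rewrite a0/= gtrBl.
rewrite subKr -(subrK X' T) addrC; apply: ler_ltD.
  by apply: le_trans dT; rewrite mulrDr mulr1 lerDl ltW.
apply: le_lt_trans bX; apply: ler_wpM2r => //.
apply: ge0_ler_powR; rewrite ?nnegrE ?invr_ge0 ?(ltW a0) ?(ltW b0)//.
by rewrite -[leRHS]invrK lef_pV2.
Qed.

(* Strong subadditivity of the energy capacity with obstacle [om], used along an increasing
   sequence of sets: the total loss stays bounded because the intersection term absorbs the
   previous step. *)
Lemma capacity_increasing (C : nat -> set V) (K : set V) (om chi : V -> R) (M e : R) :
  (forall j, C j `<=` C j.+1) -> compact K -> K = \bigcup_j C j -> 0 < e ->
  continuous om -> Cc chi -> (forall x, K x -> 1 <= chi x) ->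
  (forall j, exists u, [/\ Cc u, (forall x, C j x -> om x < u x) & energy p u <= M]) ->
  exists w, [/\ Cc w, (forall x, K x -> om x < w x) & energy p w <= M + e].
Proof.
move=> CS cK KC e0 com cchi chi1 hC.
have CK j x : C j x -> K x by rewrite KC => Cx; exists j.
pose S j : set R := [set t | exists u, [/\ Cc u, (forall x, C j x -> om x < u x) & t = energy p u]].
have Slb j : has_lbound (S j) by exists 0 => _ [u [_ _ ->]]; exact: energy_ge0.
have Sinf j : has_inf (S j).
  by split => //; have [u [cu uC _]] := hC j; exists (energy p u), u.
have infM j : inf (S j) <= M.
  by have [u [cu uC uM]] := hC j; apply: le_trans uM; apply: ge_inf => //; exists u.
(* Step j may lose [q j], half of the previous loss; the losses up to step j add up to [e - q j]. *)
pose q (j : nat) : R := e / 2 ^+ j.+1.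
have q0 j : 0 < q j by rewrite divr_gt0// exprn_gt0.
have qS j : q j = q j.+1 + q j.+1.
  have -> : q j.+1 = q j / 2 by rewrite /q exprS invfM mulrA mulrAC.
  exact: splitr.
have /choice[u hu] : forall j, exists u, [/\ Cc u, (forall x, C j x -> om x < u x) &
    energy p u < inf (S j) + q j].
  move=> j; have [_ [u [cu uC ->]] h] := inf_adherent (q0 j) (Sinf j).
  by exists u.
(* The function [v] must beat the obstacle wherever on [K] some earlier [u i] does, not merely on
   [C j]: these are open conditions, to which compactness applies. *)
have key j : exists v, [/\ Cc v,
    (forall i x, (i <= j)%N -> K x -> om x < u i x -> om x < v x) &
    energy p v < inf (S j) + (e - q j)].
  elim: j => [|j [v [cv vC ve]]].
    have [cu uC ue] := hu 0%N; exists (u 0%N); split => //.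
      by move=> i x; rewrite leqn0 => /eqP ->.
    have -> : e - q 0%N = q 0%N by rewrite /q expr1 {1}(splitr e) addrK.
    exact: ue.
  have [cu uC ue] := hu j.+1; have [cuj uCj _] := hu j.
  (* On [C j] both functions exceed [om], hence so does their smooth minimum, whose energy is thus
     at least [inf (S j)]. Strong subadditivity then bounds the smooth maximum by [X], independently
     of the smoothing [d]. *)
  pose X := energy p (u j.+1) + energy p v - inf (S j).
  have mx d : 0 < d -> energy p (v \+ (spos d \o (u j.+1 \- v))) <= X.
    move=> d0; have := energy_max_min p1 d0 cu cv; rewrite /X => h.
    rewrite lerBrDr; apply: le_trans h; rewrite lerD2l; apply: ge_inf => //.
    exists (u j.+1 \- (spos d \o (u j.+1 \- v))); split => //.
      by apply: Cc_smoothB => //; apply: Cc_smooth_spos; exact: Cc_smoothB.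
    move=> x Cx /=; have h1 := uC _ (CS _ _ Cx).
    have h2 := vC j x (leqnn _) (CK _ _ Cx) (uCj x Cx).
    exact: lt_subr_max h1 h2 (spos_le _ d0).
  have X0 : 0 <= X by apply: le_trans (mx 1 ltr01); exact: energy_ge0.
  have XT : X < inf (S j.+1) + (e - q j.+1) by exact: telescope_lt (qS j) ve ue.
  have [a /andP[a0 a1] aX] := convex_slack X0 XT (energy_ge0 p chi).
  (* The smooth maximum may fall below the true one by [d]; the term (1 - a) [chi], at least [d] on
     [K], repays this. Since [X] does not involve [d], it can be fixed after [a]. *)
  pose d := 1 - a; have d0 : 0 < d by rewrite subr_gt0.
  have cM : Cc (v \+ (spos d \o (u j.+1 \- v))).
    by apply: Cc_smoothD => //; apply: Cc_smooth_spos; exact: Cc_smoothB.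
  pose Ma := a^-1 \*o (v \+ (spos d \o (u j.+1 \- v))).
  have cMa : Cc Ma by exact: Cc_smoothZ.
  exists ((a \*o Ma) \+ ((1 - a) \*o chi)); split.
  - by apply: Cc_smoothD; exact: Cc_smoothZ.
  - move=> i x ij Kx ui; rewrite /Ma /= mulVKf ?gt_eqF// -/d.
    have h1 := spos_ge0 (u j.+1 x - v x) d0.
    have h2 := spos_ge (u j.+1 x - v x) d0.
    have h3 : d <= d * chi x by rewrite ler_peMr ?(ltW d0)//; exact: chi1.
    move: ij; rewrite leq_eqVlt => /orP[/eqP ij|ij].
      rewrite ij in ui; apply: (lt_le_trans ui); apply: le_trans (lerD (lexx _) h3).
      by rewrite -lerBlDr -lerBlDl addrAC.
    apply: (lt_le_trans (vC i x ij Kx ui)); rewrite -addrA lerDl.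
    by apply: addr_ge0 => //; apply: le_trans h3; exact: ltW.
  - have a01 : 0 <= a <= 1 by rewrite !ltW.
    apply: le_lt_trans aX; apply: (le_trans (energy_convex p1 cMa cchi a01)).
    apply: lerD => //; rewrite /Ma energyZ// gtr0_norm ?invr_gt0//.
    have P0 : 0 <= a^-1 `^ p by exact: powR_ge0.
    have E0 := energy_ge0 p (v \+ (spos d \o (u j.+1 \- v))).
    apply: (@le_trans _ _ (a^-1 `^ p * energy p (v \+ (spos d \o (u j.+1 \- v))))).
      by rewrite ler_piMl ?mulr_ge0 ?(ltW a1)//.
    by apply: ler_wpM2l => //; exact: mx.
(* Finitely many [u j] suffice on [K], so the function [v] built for the largest of their indices
   beats the obstacle everywhere on [K]. *)
have [s _ cov] : exists2 s : seq nat, (forall j, j \in s -> [set: nat] j) &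
    forall x, K x -> exists2 j, j \in s & [set x | om x < u j x] x.
  apply: finite_subcover => //.
    move=> j _; have [cu _ _] := hu j.
    have cuj := smooth_continuous (Cc_smooth_smooth cu).
    rewrite (_ : [set x | om x < u j x] = (u j \- om) @^-1` [set t | 0 < t]).
      have /continuousP : continuous (u j \- om).
        by move=> x; exact: (continuousB (cuj x) (com x)).
      by move=> /(_ [set t | 0 < t]); apply; exact: open_gt.
    by apply/seteqP; split => x /=; rewrite subr_gt0.
  by move=> x; rewrite {1}KC => -[j _ Cx]; exists j => //; have [_ h _] := hu j; exact: h.
have [w [cw wC we]] := key (\max_(j <- s) j)%N; exists w; split => //.
  move=> x Kx; have [j js ujx] := cov x Kx; apply: (wC j x _ Kx ujx).
  exact: (@leq_bigmax_seq _ s xpredT id j js isT).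
apply: ltW; apply: (lt_le_trans we); apply: lerD; first exact: infM.
by rewrite lerBlDr lerDl ltW.
Qed.

End capacity_argument.

(** * Smooth approximation that keeps the lower bound on the compact set *)

Section smooth_approximation.
Variables (R : realType) (n : nat) (p : R).
Hypothesis p1 : 1 <= p.
Notation V := 'rV[R]_n.
Notation leb := (@leb R n).
Notation Cc := (@Cc_smooth R n).
Implicit Types (f g u w phi psi : V -> R) (x : V) (K : set V).

Let p0 : 0 < p. Proof. exact: lt_le_trans p1. Qed.

Lemma Cc_smooth_ge1 K : compact K -> exists2 chi, Cc chi & forall x, K x -> 1 <= chi x.
Proof.
move=> cK; have [N KN] := compact_sub_cube cK.
pose b : V := const_mx N.+1%:R.
(* Points of the cube of size N are at distance at least 1 from the faces of the box of size N + 1,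
   so each of the 2n factors is at least e^(-1). *)
pose c : R := (expR (-1) * expR (-1)) ^+ n.
have c0 : 0 < c by rewrite exprn_gt0// mulr_gt0 ?expR_gt0.
exists (c^-1 \*o obox_bump (- b) b 0).
  by apply: Cc_smoothZ; exact: Cc_smooth_obox_bump.
have fl (t : R) : 1 <= t -> expR (-1) <= flat 1 t.
  move=> t1; have t0 : 0 < t by exact: lt_le_trans t1.
  by rewrite flat_gt0// hornerC mul1r ler_expR lerN2 invf_le1.
move=> x /KN Nx; rewrite /= mulrC ler_pdivlMr// mul1r /c /obox_bump.
rewrite -[X in _ ^+ X]card_ord -prodr_const; apply: ler_prod => i _.
rewrite mulr_ge0 ?expR_ge0//=.
have := Nx i; rewrite /= in_itv/= => /andP[h1 h2].
by apply: ler_pM; rewrite ?expR_ge0//; apply: fl; rewrite mul1r !mxE -natr1; move: h1 h2; clear -n p1; lra.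
Qed.

(** The default value of [precise] is 0, so a value at least 1 certifies that the limit exists. *)
Lemma precise_ge1_cvg g x : 1 <= precise g x ->
  ball_mean g x r @[r --> 0^'+] --> precise g x.
Proof.
rewrite /precise; case: pselect => [h|nh] /=; first by move=> _; exact: h.
by rewrite ler10.
Qed.

(** The auxiliary approximation [psi] depends on the radius and on [a], but the energy bound depends
    on [eta] alone; so one bound serves all C_j. *)
Lemma ball_mean_capacity g phi r a eta : 0 < r -> 0 < a -> 0 < eta ->
  W01p p g -> Cc phi -> (sobolev_norm p (g \- phi)%R < eta%:E)%E ->
  exists u, [/\ Cc u, energy p u <= 2 `^ p * (n%:R * eta `^ p + n%:R * eta `^ p) &
    forall x, `|(ball_mean g x r - ball_mean phi x r) - u x| <= a].
Proof.
move=> r0 a0 eta0 [[exG _] gapp] cphi hphi.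
have wg := weak_gradientP exG; have [gl _ _] := wg.
have v0 := vol_eball_gt0 (0 : V) r0.
pose d := a / 4; have d0 : 0 < d by rewrite divr_gt0.
pose k := d `^ (1 - p) * (vol (eball (0 : V) r))^-1.
have k0 : 0 < k by rewrite mulr_gt0 ?powR_gt0// invr_gt0.
(* The bound [eta] keeps [psi] within reach of [energy_near]; the other makes the means of [g] and
   [psi] at radius [r] differ by at most d + d = a/2. *)
pose e := Num.min eta ((d / k) `^ p^-1).
have e0 : 0 < e by rewrite lt_min eta0 powR_gt0// divr_gt0.
have ek : k * e `^ p <= d.
  apply: (@le_trans _ _ (k * ((d / k) `^ p^-1) `^ p)).
    apply: ler_wpM2l; first exact: ltW.
    apply: ge0_ler_powR; rewrite ?nnegrE ?powR_ge0 ?(ltW p0) ?(ltW e0)//.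
    by rewrite ge_min lexx orbT.
  rewrite -powRrM mulVf ?gt_eqF// powRr1; last by rewrite ltW// divr_gt0.
  by rewrite mulrCA mulfV ?gt_eqF// mulr1.
have [psi cpsi hpsi] := gapp e e0.
have hpsi' : (sobolev_norm p (g \- psi)%R < eta%:E)%E.
  by apply: lt_le_trans hpsi _; rewrite lee_fin ge_min lexx.
have [h1 _] := sobolev_near p1 e0 wg cpsi hpsi.
have spsi := Cc_smooth_smooth cpsi; have sphi := Cc_smooth_smooth cphi.
have cpp : Cc (psi \- phi) by exact: Cc_smoothB.
have d20 : 0 < a / 2 by rewrite divr_gt0.
have [u [cu eu hu]] := ball_mean_approx p1 cpp r0 d20.
exists u; split => //.
  by apply: (le_trans eu); exact: (energy_near p1 eta0 wg cphi cpsi hphi hpsi').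
move=> x; have h2 := ball_mean_near x p1 r0 d0 gl (smooth_continuous spsi) h1.
have h3 : `|ball_mean g x r - ball_mean psi x r| <= a / 2.
  apply: (le_trans h2); rewrite -/k; apply: (le_trans (lerD (lexx d) ek)).
  by rewrite /d; move: a0; clear -n p1; lra.
have h4 := hu x; rewrite -ball_meanB in h4; last 2 first.
- exact/continuous_loc_integrable/smooth_continuous.
- exact/continuous_loc_integrable/smooth_continuous.
rewrite [leRHS](splitr a).
move: h3 h4; move: (ball_mean g x r) (ball_mean psi x r) (ball_mean phi x r) (u x) => b1 b2 b3 b4 h3 h4.
have -> : b1 - b3 - b4 = (b1 - b2) - (b4 - (b2 - b3)) by ring.
by apply: (le_trans (ler_normB _ _)); exact: lerD.
Qed.

Lemma smooth_approx g K eps kappa : compact K -> W01p p g ->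
  (forall x, K x -> 1 <= precise g x) -> 0 < eps -> 0 < kappa ->
  exists f, [/\ Cc f, forall x, K x -> 1 - eps < f x &
    (\int[leb]_x (psum p (weak_gradient g x - grad f x)%R)%:E <= kappa%:E)%E].
Proof.
move=> cK Wg g1 eps0 kappa0; have [[exG _] gapp] := Wg.
have wg := weak_gradientP exG.
pose m (eta : R) := 2 `^ p * (n%:R * eta `^ p + n%:R * eta `^ p).
(* Costs in units of eta^p: n for g - phi, the constant of [m eta] for the admissible functions, 1
   for the loss in [capacity_increasing]; the outer factor comes from [psumD_le]. *)
pose B := 2 `^ p * (n%:R + (2 `^ p * (n%:R + n%:R) + 1)).
have B0 : 0 < B.
  by rewrite mulr_gt0 ?powR_gt0// ltr_wpDl// ltr_wpDl// mulr_ge0 ?powR_ge0// addr_ge0.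
pose eta := (kappa / B) `^ p^-1.
have eta0 : 0 < eta by rewrite powR_gt0// divr_gt0.
have etaB : B * eta `^ p = kappa.
  rewrite -powRrM mulVf ?gt_eqF// powRr1; last by rewrite ltW// divr_gt0.
  by rewrite mulrCA mulfV ?gt_eqF// mulr1.
have [phi cphi hphi] := gapp eta eta0.
have sphi := Cc_smooth_smooth cphi; have ctphi := smooth_continuous sphi.
have [chi cchi chi1] := Cc_smooth_ge1 cK.
pose om x := 1 - eps - phi x.
have com : continuous om.
  by move=> x; exact: (continuousB (@cst_continuous V R (1 - eps) x) (ctphi x)).
pose C (j : nat) := [set x | K x /\ forall r, 0 < r -> r <= j.+1%:R^-1 ->
  1 - phi x - eps / 2 < ball_mean g x r - ball_mean phi x r].
have CS j : C j `<=` C j.+1.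
  move=> x [Kx h]; split => // r r0 rj; apply: h => //; apply: (le_trans rj).
  by rewrite lef_pV2 ?posrE// ler_nat.
have KC : K = \bigcup_j C j.
  apply/seteqP; split => [x Kx|x [j _ []//]].
  have h1 := precise_ge1_cvg (g1 x Kx); have h2 := @ball_mean_cvg R n phi x ctphi.
  (* The means of g - phi at [x] converge to [precise g x - phi x], at least [1 - phi x]; the margin
     eps/2 makes the inequality strict for all small radii. *)
  have : \forall r \near 0^'+, 1 - phi x - eps / 2 < ball_mean g x r - ball_mean phi x r.
    apply: (cvgr_gt (precise g x - phi x)); first by apply: cvgB.
    by have := g1 x Kx; move: (precise g x) => z; move: eps0; clear -n p1; lra.
  case => d /= d0 hd; exists (Num.truncn d^-1) => //; split => // r r0 rj.
  apply: hd => //=; rewrite sub0r normrN gtr0_norm//; apply: (le_lt_trans rj).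
  by rewrite invf_plt ?posrE//; exact: truncnS_gt.
(* Of the margin eps, the definition of [C] uses eps/2 and replacing the mean by [u] uses eps/4; the
   remaining quarter keeps the inequality strict. *)
have e4 : 0 < eps / 4 by rewrite divr_gt0.
have admissible j : exists u, [/\ Cc u, (forall x, C j x -> om x < u x) & energy p u <= m eta].
  have r0 : (0:R) < j.+1%:R^-1 by rewrite invr_gt0.
  have [u [cu eu hu]] := ball_mean_capacity r0 e4 eta0 Wg cphi hphi.
  exists u; split => // x [Kx /(_ _ r0 (lexx _))]; have := hu x; rewrite ler_norml /om.
  move: (ball_mean g x _ - _) (phi x) (u x) => b1 b2 b3 /andP[h1 h2] h3.
  by move: eps0 h1 h2 h3; clear -n p1; lra.
have ee0 : 0 < eta `^ p by rewrite powR_gt0.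
have [w [cw wK we]] := capacity_increasing p1 CS cK KC ee0 com cchi chi1 admissible.
have sw := Cc_smooth_smooth cw.
exists (phi \+ w); split; first exact: Cc_smoothD.
  by move=> x Kx; have := wK x Kx; rewrite /om ltrBlDl.
have [_ h1] := sobolev_near p1 eta0 wg cphi hphi.
have md : measurable_fun setT (fun x => (psum p (weak_gradient g x - grad phi x)%R)%:E).
  apply/measurable_EFinP; apply: (measurableT_comp (@measurable_psum R n p)).
  apply: measurable_fun_rV => i; under eq_fun do rewrite 2!mxE.
  apply: measurable_funB.
    by have [_ + _] := wg => /(_ i)[].
  exact: (measurableT_comp (@measurable_coord R n i) (measurable_grad sphi)).
have mf : measurable_fun setT (fun x => (psum p (weak_gradient g x - grad (phi \+ w) x)%R)%:E).
  apply/measurable_EFinP; apply: (measurableT_comp (@measurable_psum R n p)).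
  apply: measurable_fun_rV => i; under eq_fun do rewrite 2!mxE.
  apply: measurable_funB.
    by have [_ + _] := wg => /(_ i)[].
  exact: (measurableT_comp (@measurable_coord R n i) (measurable_grad (smoothD sphi sw))).
have mw : measurable_fun setT (fun x => (psum p (grad w x)%R)%:E).
  apply/measurable_EFinP; apply: (measurableT_comp (@measurable_psum R n p)).
  exact: measurable_grad.
apply: (@le_trans _ _ (\int[leb]_x ((2 `^ p)%:E * ((psum p (weak_gradient g x - grad phi x)%R)%:E + (psum p (grad w x)%R)%:E)))%E).
  apply: ge0_le_integral => //.
  - by move=> x _; rewrite lee_fin psum_ge0.
  - exact: (emeasurable_funM (measurable_cst _) (emeasurable_funD md mw)).
  - move=> x _; rewrite -EFinD -EFinM lee_fin (gradD x sphi sw) -(psumN p (grad w x)) opprD addrA.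
    exact: (psumD_le _ _ p1).
rewrite ge0_integralZl//; last 2 first.
- exact: (emeasurable_funD md mw).
- by move=> x _; rewrite -EFinD lee_fin addr_ge0// psum_ge0.
have ps0 (G : V -> V) x : setT x -> (0 <= (psum p (G x))%:E)%E by rewrite lee_fin psum_ge0.
rewrite (ge0_integralD leb measurableT (ps0 _) md (ps0 _) mw).
rewrite (energyE p1 cw).
apply: (@le_trans _ _ ((2 `^ p)%:E * ((n%:R * eta `^ p)%R%:E + (m eta + eta `^ p)%R%:E))%E).
  by apply: lee_wpmul2l; [rewrite lee_fin powR_ge0|apply: leeD => //; rewrite lee_fin].
rewrite -EFinD -EFinM lee_fin -etaB /B /m le_eqVlt; apply/orP; left; apply/eqP.
by move: (2 `^ p) (eta `^ p) (n%:R : R) => P E N; clear -n p1; ring.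
Qed.

End smooth_approximation.

(** * The affine energy *)

Lemma perturb_le (R : realType) (x z t : R) : 0 <= x -> 0 < z -> z <= 1 ->
  z * (x + 2) <= t -> (1 + z) * (x + z) <= x + t.
Proof. by move=> x0 z0 z1 h; nra. Qed.

Section harmonic_functional.
Context d (T : measurableType d) (R : realType) (mu : {measure set T -> \bar R}).
Variables (D : set T) (r : R).
Hypotheses (mD : measurable D) (r0 : 0 < r).
Implicit Types (e : T -> \bar R).
Local Open Scope ereal_scope.

(** An unnormalised power mean of exponent -r. For r = n/p on the sphere it turns directional
    energies into the affine energy. *)
Definition harmonic_power e : \bar R := ((\int[mu]_(u in D) (e u `^ r)^-1) `^ r^-1)^-1.

Lemma le_poweR (s : R) (x y : \bar R) : (0 <= s)%R -> 0 <= x -> x <= y -> x `^ s <= y `^ s.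
Proof.
move=> s0 x0 xy; apply: gt0_ler_poweR => //; rewrite in_itv/= leey ?andbT//.
exact: le_trans xy.
Qed.

Lemma poweRK (s : R) (x : \bar R) : (0 < s)%R -> 0 <= x -> (x `^ s) `^ s^-1 = x.
Proof. by move=> s0 x0; rewrite -poweRrM mulfV ?gt_eqF// poweRe1. Qed.

Lemma poweRVK (s : R) (x : \bar R) : (0 < s)%R -> 0 <= x -> (x `^ s^-1) `^ s = x.
Proof. by move=> s0 x0; rewrite -poweRrM mulVf ?gt_eqF// poweRe1. Qed.

Lemma le_inve (x y : \bar R) : 0 <= x -> x <= y -> y^-1 <= x^-1.
Proof. by move=> x0 xy; rewrite lee_pV2 ?inE//; exact: le_trans xy. Qed.

Lemma le_inve_poweR (s : R) (x y : \bar R) : (0 <= s)%R -> 0 <= x -> x <= y ->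
  (y `^ s)^-1 <= (x `^ s)^-1.
Proof. by move=> s0 x0 xy; apply: le_inve; [exact: poweR_ge0|exact: le_poweR]. Qed.

Lemma measurable_inve_poweR e : measurable_fun D e -> measurable_fun D (fun u => (e u `^ r)^-1).
Proof.
move=> me; pose f u := e u `^ r.
have mf : measurable_fun D f by exact: (measurableT_comp (measurable_poweR _) me).
(* Only the value 0 needs a separate branch: at +oo, [fine] gives 0 and the real power of 0 is 0,
   which is the inverse of +oo. *)
rewrite (_ : (fun u => _) = (fun u => if f u == 0 then +oo else ((fine (f u)) `^ (-1))%R%:E)).
  apply: measurable_fun_if => //; first exact: measurable_fun_eqe.
  apply/measurable_EFinP; apply: (measurableT_comp (measurable_powR _)).
  apply: (measurable_funS mD); first by move=> u [].
  by apply: measurableT_comp mf.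
apply/funext => u; have := poweR_ge0 (e u) r; rewrite -/(f u).
case: (f u) => [x| |]//=; last by rewrite invey powR0.
rewrite lee_fin eqe inver => x0; case: eqP => // _; by rewrite powR_inv1.
Qed.

Lemma harmonic_power_le e e' : measurable_fun D e -> measurable_fun D e' ->
  (forall u, D u -> 0 <= e u) -> (forall u, D u -> e u <= e' u) ->
  harmonic_power e <= harmonic_power e'.
Proof.
move=> me me' e0 ee'; apply: le_inve; first exact: poweR_ge0.
apply: le_poweR; first by rewrite invr_ge0 ltW.
  by apply: integral_ge0 => u _; rewrite inve_ge0 poweR_ge0.
apply: ge0_le_integral => //.
- by move=> u _; rewrite inve_ge0 poweR_ge0.
- exact: measurable_inve_poweR.
- exact: measurable_inve_poweR.
- by move=> u Du; apply: le_inve_poweR; [exact: ltW|exact: e0|exact: ee'].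
Qed.

(* Monotone convergence along perturbations decreasing to [e]; no continuity of the powers is
   needed since each bound can be transported through the order isomorphisms. *)
Lemma harmonic_power_limit e (L : \bar R) : measurable_fun D e -> (forall u, D u -> 0 <= e u) ->
  0 <= L ->
  (forall k : nat, L <= harmonic_power (fun u => (1 + k.+1%:R^-1)%R%:E * (e u + (k.+1%:R^-1)%R%:E))) ->
  L <= harmonic_power e.
Proof.
move=> me e0 L0 hL.
pose h (k : nat) : R := (k.+1%:R^-1)%R.
have h0 k : (0 < h k)%R by rewrite invr_gt0.
pose b k u := (1 + h k)%R%:E * (e u + (h k)%:E).
have b0 k u : D u -> 0 <= b k u.
  move=> Du; apply: mule_ge0; first by rewrite lee_fin addr_ge0// ltW.
  by apply: adde_ge0; [exact: e0|rewrite lee_fin ltW].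
have mb k : measurable_fun D (b k).
  by apply: emeasurable_funM => //; exact: emeasurable_funD.
have bS k l u : D u -> (k <= l)%N -> b l u <= b k u.
  move=> Du kl; have hkl : (h l <= h k)%R by rewrite lef_pV2 ?posrE// ler_nat.
  apply: lee_pmul => //.
  - by rewrite lee_fin addr_ge0// ltW.
  - by apply: adde_ge0; [exact: e0|rewrite lee_fin ltW].
  - by rewrite lee_fin lerD2l.
  - by rewrite leeD2l.
pose G k u := (b k u `^ r)^-1.
have G0 k u : D u -> 0 <= G k u by move=> _; rewrite inve_ge0 poweR_ge0.
have mG k : measurable_fun D (G k) by exact: measurable_inve_poweR.
have ndG u : D u -> nondecreasing_seq (G^~ u).
  by move=> Du k l kl; apply: le_inve_poweR; [exact: ltW|exact: b0|exact: bS].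
have binf u s : D u -> (forall k, s <= b k u) -> s <= e u.
  move=> Du hs; have := e0 _ Du; case Eu : (e u) => [x| |]//; last by move=> _; exact: leey.
  rewrite lee_fin => x0; apply/lee_addgt0Pr => t t0.
  (* Expanding (1 + z)(x + z) with z = [h k] leaves an excess z(x + 1 + z) <= z(x + 2), which this k
     makes at most t. *)
  pose k := Num.truncn ((x + 2) / t)%R.
  have hk : (h k * (x + 2) <= t)%R.
    rewrite /h mulrC ler_pdivrMr// mulrC -ler_pdivrMr//.
    by apply: ltW; exact: truncnS_gt.
  apply: (le_trans (hs k)); rewrite /b Eu -EFinD -EFinM -EFinD lee_fin.
  have h1 : (h k <= 1)%R by rewrite invf_le1// ler1n.
  exact: perturb_le.
have I0 k : 0 <= \int[mu]_(u in D) G k u by apply: integral_ge0 => u Du; exact: (G0 k u Du).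
(* Inverting the outer operations turns the lower bound on the functional into an upper bound on
   increasing integrals, the form that monotone convergence accepts. *)
have IL k : \int[mu]_(u in D) G k u <= (L^-1) `^ r.
  rewrite -(poweRVK r0 (I0 k)); apply: le_poweR; [exact: ltW|exact: poweR_ge0|].
  by rewrite -[leLHS]inveK; apply: le_inve => //; exact: hL.
have limG : \int[mu]_(u in D) (limn (G^~ u)) <= (L^-1) `^ r.
  rewrite monotone_convergence//; apply: lime_le; last exact: nearW.
  apply: ereal_nondecreasing_is_cvgn => k l kl.
  exact: (@ge0_le_integral _ _ _ mu _ mD _ _ (G0 k) (mG k) (mG l) (fun u Du => ndG u Du k l kl)).
have eG u : D u -> (e u `^ r)^-1 <= limn (G^~ u).
  move=> Du.
  have cG : cvgn (G^~ u) by exact: (ereal_nondecreasing_is_cvgn (ndG u Du)).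
  have GS k : G k u <= limn (G^~ u).
    rewrite (cvg_lim _ (ereal_nondecreasing_cvgn (ndG u Du)))//.
    by apply: ereal_sup_ubound; exists k.
  set S := limn _ in GS *.
  have S0 : 0 <= S by apply: le_trans (GS 0%N); exact: G0.
  have SV0 : 0 <= S^-1 by rewrite inve_ge0.
  rewrite -[leRHS]inveK; apply: le_inve => //.
  rewrite -(poweRVK r0 SV0); apply: le_poweR; [exact: ltW|exact: poweR_ge0|].
  (* Each [G k u] lies below the limit, so undoing the inverse and the power bounds every [b k u]
     from below; [binf] carries this over to [e u]. *)
  apply: binf => // k; rewrite -(poweRK r0 (b0 k u Du)).
  apply: le_poweR => //; first by rewrite invr_ge0 ltW.
  by rewrite -[leRHS]inveK; apply: le_inve => //; [exact: G0|exact: GS].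
rewrite -[leLHS]inveK; apply: le_inve; first exact: poweR_ge0.
rewrite -(poweRK r0 (_ : 0 <= L^-1)) ?inve_ge0//.
apply: le_poweR; first by rewrite invr_ge0 ltW.
  by apply: integral_ge0 => u _; rewrite inve_ge0 poweR_ge0.
apply: le_trans limG; apply: ge0_le_integral => //.
- by move=> u _; rewrite inve_ge0 poweR_ge0.
- exact: measurable_inve_poweR.
- apply: (emeasurable_fun_cvg G) => // u Du.
  by apply: ereal_nondecreasing_is_cvgn; exact: ndG.
Qed.

End harmonic_functional.

(** * Directional energies: sublinearity, measurability and perturbation *)

Section directional_energies.
Variables (R : realType) (n : nat) (p tau : R).
Hypotheses (p1 : 1 <= p) (tau1 : -1 <= tau <= 1).
Notation V := 'rV[R]_n.
Notation leb := (@leb R n).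
Notation Cc := (@Cc_smooth R n).
Notation phi := (phi_tau p tau).
Implicit Types (f g : V -> R) (u v w x : V) (s t a : R).

Let p0 : 0 < p. Proof. exact: lt_le_trans p1. Qed.

Lemma phi_tau_coef_le1 : ((1 + tau) / 2) `^ p^-1 <= 1 /\ ((1 - tau) / 2) `^ p^-1 <= 1.
Proof.
have H a : 0 <= a <= 1 -> a `^ p^-1 <= 1.
  move=> /andP[a0 a1]; rewrite (_ : 1 = 1 `^ p^-1); last by rewrite powR1.
  by apply: ge0_ler_powR; rewrite ?nnegrE ?invr_ge0// ltW.
have /andP[h1 h2] := tau1.
by split; apply: H; apply/andP; split; lra.
Qed.

Lemma phi_tau_ge0 t : 0 <= phi t.
Proof. by rewrite /phi_tau addr_ge0// mulr_ge0 ?powR_ge0// le_max lexx orbT. Qed.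

Lemma max0_sum s t : Num.max (s + t) 0 <= Num.max s 0 + Num.max t 0.
Proof. by rewrite !maxEle; do 3 (case: ifP => ?); lra. Qed.

Lemma phi_tauD s t : phi (s + t) <= phi s + phi t.
Proof.
rewrite /phi_tau addrACA -!mulrDr lerD// ler_wpM2l ?powR_ge0//; first exact: max0_sum.
by rewrite opprD max0_sum.
Qed.

(** Positive homogeneity only: the two signs have different weights. Hence the slopes of truncations
    must be nonnegative for the energy to be controlled. *)
Lemma phi_tauZ s t : 0 <= s -> phi (s * t) = s * phi t.
Proof.
move=> s0; rewrite /phi_tau mulrDr -mulrN.
have M z : Num.max (s * z) 0 = s * Num.max z 0 by rewrite maxr_pMr// mulr0.
by rewrite !M; congr (_ + _); rewrite mulrCA.
Qed.

Lemma phi_tau_le t : phi t <= `|t|.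
Proof.
have [c1 c2] := phi_tau_coef_le1; rewrite /phi_tau.
case: (boolP (0 <= t)) => [t0|]; last rewrite -ltNge => /ltW t0.
  have t0' : - t <= 0 by rewrite oppr_le0.
  by rewrite (max_l t0) (max_r t0') mulr0 addr0 (ger0_norm t0) ler_piMl.
have t0' : 0 <= - t by rewrite oppr_ge0.
by rewrite (max_r t0) (max_l t0') mulr0 add0r (ler0_norm t0) ler_piMl.
Qed.

Lemma measurable_phi_tau : measurable_fun setT phi.
Proof.
by apply: measurable_funD; apply: measurable_funM => //; apply: measurable_maxr.
Qed.

Lemma dotD u v w : dot u (v + w) = dot u v + dot u w.
Proof. by rewrite /dot -big_split/=; apply: eq_bigr => i _; rewrite mxE mulrDr. Qed.

Lemma dotZ u a v : dot u (a *: v) = a * dot u v.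
Proof. by rewrite /dot mulr_sumr; apply: eq_bigr => i _; rewrite mxE mulrCA. Qed.

Lemma norm_dot_le u v : esphere u -> `|dot u v| <= \sum_(i < n) `|v ord0 i|.
Proof.
move=> u1; apply: (le_trans (ler_norm_sum _ _ _)); apply: ler_sum => i _.
by rewrite normrM ler_piMl// (le_trans (coord_le_enorm u i)) ?u1.
Qed.

Lemma sum_powR_le v : (\sum_(i < n) `|v ord0 i|) `^ p <= n%:R `^ p * psum p v.
Proof.
have ps0 := psum_ge0 p v; have p00 : 0 <= p by exact: ltW.
have pn0 : p != 0 by rewrite gt_eqF.
have h i : `|v ord0 i| <= psum p v `^ p^-1.
  rewrite -[leLHS]powRr1// -(mulfV pn0) powRrM.
  apply: ge0_ler_powR; rewrite ?nnegrE ?invr_ge0 ?powR_ge0//.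
  rewrite /psum (bigD1 i)//= lerDl; apply: sumr_ge0 => j _; exact: powR_ge0.
have hs : \sum_(i < n) `|v ord0 i| <= n%:R * psum p v `^ p^-1.
  apply: (@le_trans _ _ (\sum_(i < n) psum p v `^ p^-1)); first exact: ler_sum.
  by rewrite sumr_const card_ord mulr_natl.
apply: (@le_trans _ _ ((n%:R * psum p v `^ p^-1) `^ p)).
  apply: ge0_ler_powR => //; rewrite nnegrE ?mulr_ge0 ?powR_ge0//.
  exact: sumr_ge0.
by rewrite powRM ?powR_ge0// -powRrM mulVf// powRr1.
Qed.

Lemma phi_dot_powR_le u v : esphere u -> phi (dot u v) `^ p <= n%:R `^ p * psum p v.
Proof.
move=> u1; apply: le_trans (sum_powR_le v).
apply: ge0_ler_powR; rewrite ?nnegrE ?phi_tau_ge0 ?sumr_ge0//; first exact: ltW.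
exact: le_trans (phi_tau_le _) (norm_dot_le v u1).
Qed.

Lemma measurable_phi_dot u (G : V -> V) : measurable_fun setT G ->
  measurable_fun setT (fun x => (phi (dot u (G x)) `^ p)%:E).
Proof.
move=> mG; apply/measurable_EFinP; apply: (measurableT_comp (measurable_powR _)).
apply: (measurableT_comp measurable_phi_tau); apply: measurable_sum => i.
by apply: measurable_funM => //; exact: (measurableT_comp (@measurable_coord R n i) mG).
Qed.

Lemma directional_energy_ge0 f u : (0 <= directional_energy p tau f u)%E.
Proof. by apply: integral_ge0 => x _; rewrite lee_fin powR_ge0. Qed.

(** By Tonelli, as a partial integral of a jointly measurable function of direction and point. *)
Lemma measurable_directional_energy f : measurable_fun setT (weak_gradient f) ->
  measurable_fun setT (directional_energy p tau f).
Proof.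
move=> mG.
pose F (z : V * V) := (phi (dot z.1 (weak_gradient f z.2)) `^ p)%:E.
have mF : measurable_fun setT F.
  apply/measurable_EFinP; apply: (measurableT_comp (measurable_powR _)).
  apply: (measurableT_comp measurable_phi_tau); apply: measurable_sum => i.
  apply: measurable_funM.
    exact: (measurableT_comp (@measurable_coord R n i) measurable_fst).
  apply: (measurableT_comp (@measurable_coord R n i)).
  exact: (measurableT_comp mG measurable_snd).
apply: (@measurable_fun_fubini_tonelli_F _ _ V V R leb F mF).
by move=> z; rewrite lee_fin powR_ge0.
Qed.

Lemma directional_energyE f G u : is_weak_gradient f G ->
  directional_energy p tau f u = (\int[leb]_x (phi (dot u (G x)) `^ p)%:E)%E.
Proof.
move=> fG; apply: ge0_ae_eq_integral => //.
- apply: measurable_phi_dot; apply: weak_gradient_measurable.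
  by apply: weak_gradientP; exists G.
- apply: measurable_phi_dot; apply: measurable_fun_rV => i.
  by have [_ + _] := fG => /(_ i)[].
- by move=> x _; rewrite lee_fin powR_ge0.
- by move=> x _; rewrite lee_fin powR_ge0.
- by have := weak_gradient_ae fG; apply: filterS => x /= ->.
Qed.

(** Serves constant multiples, with [s] constant, and smooth truncations, with [s] the slope at each
    point. *)
Lemma directional_energy_scale f f' (s : V -> R) (c : R) u : smooth f -> smooth f' ->
  (forall x, 0 <= s x <= c) -> (forall x, grad f' x = s x *: grad f x) ->
  (directional_energy p tau f' u <= (c `^ p)%:E * directional_energy p tau f u)%E.
Proof.
move=> sf sf' sc gf.
rewrite (directional_energyE u (smooth_weak_gradient sf)).
rewrite (directional_energyE u (smooth_weak_gradient sf')).
have m1 := measurable_phi_dot u (measurable_grad sf).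
have m2 := measurable_phi_dot u (measurable_grad sf').
have q0 (G : V -> V) x : setT x -> (0 <= (phi (dot u (G x)) `^ p)%:E)%E by rewrite lee_fin powR_ge0.
have cp : (0 <= (c `^ p)%:E)%E by rewrite lee_fin powR_ge0.
rewrite -(ge0_integralZl leb measurableT m1 (q0 _) cp).
apply: (@ge0_le_integral _ _ _ leb _ measurableT _ _ (q0 _) m2).
  exact: (emeasurable_funM (measurable_cst _) m1).
move=> x _; have /andP[s0 s1] := sc x; have c0 := le_trans s0 s1.
rewrite gf dotZ phi_tauZ// -EFinM lee_fin -powRM ?phi_tau_ge0//.
apply: ge0_ler_powR; rewrite ?nnegrE ?mulr_ge0 ?phi_tau_ge0//; first exact: ltW.
by apply: ler_wpM2r => //; exact: phi_tau_ge0.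
Qed.

(** Subadditivity of [phi] splits off the difference of gradients, and [powRD_le] keeps the factor
    of the main term close to 1 when [a] is. The error is uniform over the unit sphere, whose points
    have coordinates at most 1. *)
Lemma directional_energy_near f g a kappa u : is_weak_gradient g (weak_gradient g) ->
  smooth f -> 0 < a < 1 -> esphere u ->
  (\int[leb]_x (psum p (weak_gradient g x - grad f x)%R)%:E <= kappa%:E)%E ->
  (directional_energy p tau f u <= (a `^ (1 - p))%:E * directional_energy p tau g u
     + ((1 - a) `^ (1 - p) * n%:R `^ p * kappa)%R%:E)%E.
Proof.
move=> wg sf a01 u1 hk.
rewrite (directional_energyE u (smooth_weak_gradient sf)) (directional_energyE u wg).
have mwg := weak_gradient_measurable wg.
have m1 := measurable_phi_dot u (measurable_grad sf).
have m2 := measurable_phi_dot u mwg.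
have q0 (G : V -> V) x : setT x -> (0 <= (phi (dot u (G x)) `^ p)%:E)%E by rewrite lee_fin powR_ge0.
have ps0 (G : V -> V) x : setT x -> (0 <= (psum p (G x))%:E)%E by rewrite lee_fin psum_ge0.
have m3 : measurable_fun setT (fun x => (psum p (weak_gradient g x - grad f x)%R)%:E).
  apply/measurable_EFinP; apply: (measurableT_comp (@measurable_psum R n p)).
  apply: measurable_fun_rV => i; under eq_fun do rewrite 2!mxE.
  apply: measurable_funB; first exact: (measurableT_comp (@measurable_coord R n i) mwg).
  exact: (measurableT_comp (@measurable_coord R n i) (measurable_grad sf)).
pose A := a `^ (1 - p); pose B := (1 - a) `^ (1 - p) * n%:R `^ p.
have A0 : 0 <= A by exact: powR_ge0.
have B0 : 0 <= B by rewrite mulr_ge0 ?powR_ge0.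
have A0E : (0 <= A%:E)%E by rewrite lee_fin.
have B0E : (0 <= B%:E)%E by rewrite lee_fin.
have Am2 := emeasurable_funM (measurable_cst A%:E) m2.
have Bm3 := emeasurable_funM (measurable_cst B%:E) m3.
apply: (@le_trans _ _ (\int[leb]_x (A%:E * (phi (dot u (weak_gradient g x)) `^ p)%R%:E +
    B%:E * (psum p (weak_gradient g x - grad f x)%R)%:E))%E).
  apply: (@ge0_le_integral _ _ _ leb _ measurableT _ _ (q0 _) m1).
    exact: (emeasurable_funD Am2 Bm3).
  move=> x _; rewrite -!EFinM -EFinD lee_fin.
  set v := weak_gradient g x; set w := grad f x.
  have h1 : phi (dot u w) <= phi (dot u v) + phi (dot u (- (v - w))).
    have -> : dot u w = dot u v + dot u (- (v - w)) by rewrite -dotD opprB subrKC.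
    exact: phi_tauD.
  apply: (@le_trans _ _ ((phi (dot u v) + phi (dot u (- (v - w)))) `^ p)).
    have P0 : 0 <= p by exact: ltW.
    apply: (ge0_ler_powR P0 _ _ h1); rewrite nnegrE; first exact: phi_tau_ge0.
    by apply: addr_ge0; exact: phi_tau_ge0.
  apply: (le_trans (powRD_le p1 a01 (phi_tau_ge0 _) (phi_tau_ge0 _))).
  apply: lerD => //; rewrite /B -mulrA; apply: ler_wpM2l; first exact: powR_ge0.
  by rewrite -(psumN p (v - w)); exact: phi_dot_powR_le.
rewrite (ge0_integralD leb measurableT _ Am2 _ Bm3); last 2 first.
- by move=> x _; apply: mule_ge0 => //; exact: q0.
- by move=> x _; apply: mule_ge0 => //; exact: ps0.
rewrite (ge0_integralZl leb measurableT m2 (q0 _) A0E) (ge0_integralZl leb measurableT m3 (ps0 _) B0E).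
apply: leeD => //; rewrite -/B -[leRHS]/(B%:E * kappa%:E)%E.
exact: (lee_wpmul2l B0E hk).
Qed.

Lemma measurable_esphere : measurable (@esphere R n).
Proof.
rewrite (_ : esphere = @enorm R n @^-1` [set 1]).
  by rewrite -[X in measurable X]setTI; apply: measurable_enorm => //; exact: measurable_set1.
by [].
Qed.

Lemma affine_energyE f : affine_energy p tau f =
  harmonic_power sphere_measure (@esphere R n) (n%:R / p) (directional_energy p tau f).
Proof. by rewrite /affine_energy /harmonic_power invf_div. Qed.

End directional_energies.

(** * Comparison of the infima *)

Section affine_capacity.
Variables (R : realType) (n : nat) (p tau : R) (K : set 'rV[R]_n).
Hypotheses (p1 : 1 <= p) (pn : p < n%:R) (tau1 : -1 <= tau <= 1) (cK : compact K).
Notation V := 'rV[R]_n.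
Notation Cc := (@Cc_smooth R n).
Notation D_ := (class_D p K).
Notation E_ := (class_E p K).
Notation F_ := (class_F p K).
Notation inf_ S := (ereal_inf (affine_energy p tau @` S)).
Implicit Types (f g : V -> R).

Let p0 : 0 < p. Proof. exact: lt_le_trans p1. Qed.

Let r0 : 0 < n%:R / p. Proof. by rewrite divr_gt0// (lt_trans p0). Qed.

Lemma affine_energy_ge0 f : (0 <= affine_energy p tau f)%E.
Proof. by rewrite inve_ge0 poweR_ge0. Qed.

Lemma inf_affine_energy_ge0 (S : set (V -> R)) : (0 <= inf_ S)%E.
Proof. by apply: le_ereal_inf_tmp => _ [f _ <-]; exact: affine_energy_ge0. Qed.

Lemma precise_Cc f : Cc f -> precise f = f.
Proof. by move=> cf; apply: precise_continuous; exact/smooth_continuous/Cc_smooth_smooth. Qed.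

Lemma is_weak_gradient_Cc f : Cc f -> is_weak_gradient f (weak_gradient f).
Proof.
move=> cf; apply: weak_gradientP; exists (grad f).
exact/smooth_weak_gradient/Cc_smooth_smooth.
Qed.

(** Monotonicity of the harmonic functional places the infimum below its value at every
    perturbation, and [harmonic_power_limit] lets h tend to 0. *)
Lemma inf_le_affine_energy (S : set (V -> R)) g : is_weak_gradient g (weak_gradient g) ->
  (forall h, 0 < h -> h <= 1 -> exists f, [/\ S f, is_weak_gradient f (weak_gradient f) &
     forall u, esphere u -> (directional_energy p tau f u <=
       (1 + h)%R%:E * (directional_energy p tau g u + h%:E))%E]) ->
  (inf_ S <= affine_energy p tau g)%E.
Proof.
move=> wg hS; rewrite affine_energyE.
have mE f : is_weak_gradient f (weak_gradient f) ->
    measurable_fun (@esphere R n) (directional_energy p tau f).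
  move=> wf; apply: measurable_funTS; apply: measurable_directional_energy.
  exact: weak_gradient_measurable.
apply: (harmonic_power_limit (@measurable_esphere R n) r0 (mE _ wg)).
- by move=> u _; exact: directional_energy_ge0.
- exact: inf_affine_energy_ge0.
move=> k; have h0 : (0:R) < k.+1%:R^-1 by rewrite invr_gt0.
have h1 : (k.+1%:R^-1 : R) <= 1 by rewrite invf_le1// ler1n.
have [f [Sf wf ef]] := hS _ h0 h1.
apply: (@le_trans _ _ (affine_energy p tau f)); first by apply: ereal_inf_lbound; exists f.
rewrite affine_energyE; apply: (harmonic_power_le sphere_measure (@measurable_esphere R n) r0 (mE _ wf)).
- by apply: emeasurable_funM => //; apply: emeasurable_funD => //; exact: mE.
- by move=> u _; exact: directional_energy_ge0.
- exact: ef.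
Qed.

Lemma inf_D_le_E g : E_ g -> (inf_ (Cc `&` D_) <= affine_energy p tau g)%E.
Proof.
move=> [Wg gK]; have [[exG _] _] := Wg; have wg := weak_gradientP exG.
apply: inf_le_affine_energy => // h h0 h1.
have b1 : 1 < 1 + h by rewrite ltrDl.
(* On [K] the approximation exceeds a = 1 - eps, so it is divided by [a]. The total factor a^(-p)
   a^(1-p) is (1 + h)^((2p-1)/(2p)), at most 1 + h. *)
pose a := (1 + h) `^ (- (2 * p)^-1).
have aV : a^-1 = (1 + h) `^ (2 * p)^-1 by rewrite /a powRN invrK.
have pp0 : 0 < (2 * p)^-1 by rewrite invr_gt0 mulr_gt0.
have a0 : 0 < a by rewrite powR_gt0// (lt_trans _ b1).
have aV1 : 1 < a^-1.
  have E : (1 : R) `^ (2 * p)^-1 = 1 by rewrite powR1.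
  rewrite aV -[ltLHS]E.
  by apply: gt0_ltr_powR => //; rewrite nnegrE// ltW// (lt_trans _ b1).
have a1 : a < 1 by rewrite -invf_gt1.
have aVp : a^-1 `^ p * a `^ (1 - p) <= 1 + h.
  have -> : a `^ (1 - p) = a^-1 `^ (p - 1).
    by rewrite -opprB powRN -[a^-1]powR_inv1 ?ltW// -powRrM mulN1r powRN.
  rewrite -powRD; last by rewrite (gt_eqF (lt_trans ltr01 aV1)) implybT.
  rewrite aV -powRrM -[leRHS]powRr1; last by rewrite ltW// (lt_trans _ b1).
  apply: ler_powR; first exact: ltW.
  rewrite mulrC ler_pdivrMr ?mulr_gt0// mul1r; lra.
pose B := a^-1 `^ p * ((1 - a) `^ (1 - p) * n%:R `^ p).
have B0 : 0 <= B by rewrite !mulr_ge0 ?powR_ge0.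
(* Chosen so that the error [B * kappa] fits into the additive part (1 + h) h; with B + 1 the
   quotient needs no positivity of [B]. *)
pose kappa := (1 + h) * h / (B + 1).
have B1 : 0 < B + 1 by rewrite ltr_wpDl.
have hh0 : 0 < (1 + h) * h by rewrite mulr_gt0// (lt_trans _ b1).
have k0 : 0 < kappa by rewrite divr_gt0.
have Bk : B * kappa <= (1 + h) * h.
  by rewrite /kappa mulrCA ler_piMr ?ltW// ltr_pdivrMr// mul1r ltrDl.
have eps0 : 0 < 1 - a by rewrite subr_gt0.
have g1 x : K x -> 1 <= precise g x.
  by move=> Kx; have := gK x; rewrite indicE mem_set.
have [f [cf fK fg]] := smooth_approx p1 cK Wg g1 eps0 k0.
have sf := Cc_smooth_smooth cf.
have cf' : Cc (a^-1 \*o f) by exact: Cc_smoothZ.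
exists (a^-1 \*o f); split.
- split; first exact: cf'.
  split; first exact: Cc_smooth_W01p.
  move=> x Kx; rewrite precise_Cc//= mulrC ler_pdivlMr// mul1r.
  by have := fK x Kx; rewrite subKr => /ltW.
- exact: is_weak_gradient_Cc.
move=> u u1.
have aV0 : 0 <= a^-1 by rewrite invr_ge0 ltW.
have h2 : (directional_energy p tau (a^-1 \*o f) u <= (a^-1 `^ p)%:E * directional_energy p tau f u)%E.
  have sb (x : V) : 0 <= cst a^-1 x <= a^-1 by rewrite /= aV0 lexx.
  exact: (directional_energy_scale tau p1 u sf (Cc_smooth_smooth cf') sb (fun x => gradZ a^-1 x sf)).
have a01 : 0 < a < 1 by rewrite a0.
have h3 := directional_energy_near p1 tau1 wg sf a01 u1 fg.
apply: (le_trans h2).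
have P0 : (0 <= (a^-1 `^ p)%:E)%E by rewrite lee_fin powR_ge0.
have Eg0 := directional_energy_ge0 p tau g u.
apply: (le_trans (lee_wpmul2l P0 h3)).
have A0 : (0 <= (a `^ (1 - p))%:E)%E by rewrite lee_fin powR_ge0.
rewrite ge0_muleDr; last 2 first.
- exact: mule_ge0.
- by rewrite lee_fin; apply: mulr_ge0; [apply: mulr_ge0; exact: powR_ge0|exact: ltW].
have hE : (0 <= h%:E)%E by rewrite lee_fin ltW.
rewrite [leRHS](ge0_muleDr _ Eg0 hE).
apply: leeD; last first.
  by rewrite -!EFinM lee_fin; apply: le_trans Bk; rewrite /B -!mulrA.
by rewrite muleA -EFinM; apply: lee_wpmul2r.
Qed.

Lemma inf_F_le_D f : Cc f -> D_ f -> (inf_ (Cc `&` F_) <= affine_energy p tau f)%E.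
Proof.
move=> cf [_ fK]; have sf := Cc_smooth_smooth cf.
rewrite precise_Cc// in fK.
apply: inf_le_affine_energy; first exact: is_weak_gradient_Cc.
move=> h h0 h1.
have b1 : 1 < 1 + h by rewrite ltrDl.
pose b := (1 + h) `^ p^-1.
have b0 : 0 < b by rewrite powR_gt0// (lt_trans _ b1).
have bp : b `^ p = 1 + h.
  by rewrite /b -powRrM mulVf ?gt_eqF// powRr1// ltW// (lt_trans _ b1).
have b1' : 1 < b.
  have E : (1 : R) `^ p^-1 = 1 by rewrite powR1.
  rewrite /b -[ltLHS]E.
  by apply: gt0_ltr_powR; rewrite ?invr_gt0// nnegrE// ltW// (lt_trans _ b1).
(* One third is the error of g on [K], one separates 1 - d from the threshold c = 1 - 2d, and one is
   the error of A = [spos d c], whence A >= c - d = 1/b. *)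
pose d := (1 - b^-1) / 3.
have bV0 : 0 < b^-1 by rewrite invr_gt0.
have bV1 : b^-1 < 1 by rewrite invf_lt1.
have d0 : 0 < d by rewrite /d divr_gt0// subr_gt0.
pose c := 1 - 2 * d.
have cd : c - d = b^-1 by rewrite /c /d; move: (b^-1) => z; lra.
have c0 : 0 < c by rewrite -(subrK d c) cd addr_gt0.
have c1 : c < 1 - d by rewrite /c; lra.
pose A := spos d c.
have Ab : b^-1 <= A by rewrite -cd; exact: spos_ge.
have A0 : 0 < A by exact: lt_le_trans Ab.
have AV : A^-1 <= b by rewrite -[b]invrK lef_pV2// posrE invr_gt0.
pose g := spos d \o f.
have cg : Cc g by exact: Cc_smooth_spos.
have sg := Cc_smooth_smooth cg.
pose w := spos d \o (cst c \- g).
have scg : smooth (cst c \- g) := smoothB (smooth_cst c) sg.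
have sw : smooth w by exact: smooth_spos.
(* Where f <= 0 one has g = 0, w = A and F = 0; where g > c one has w = 0 and F = 1. As g >= f - d,
   the open set g > c contains [K], and the slope of F in f is at most 1/A <= b. *)
pose F := A^-1 \*o (cst A \- w).
have sAw : smooth (cst A \- w) := smoothB (smooth_cst A) sw.
have cF : Cc F.
  apply/Cc_smoothP; split; first exact: smoothZ.
  have [k gk] := Cc_smooth_supported cg; exists k => x nx.
  by rewrite /F /w /= [g x]gk// subr0 subrr mulr0.
have g0 x : 0 <= g x by exact: spos_ge0.
have w0 x : 0 <= w x by exact: spos_ge0.
have wA x : w x <= A by apply: spos_ndecr => //=; rewrite gerBl.
have F01 x : 0 <= F x <= 1.
  rewrite /F /= mulr_ge0 ?invr_ge0 ?(ltW A0) ?subr_ge0//=.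
  by rewrite mulrC ler_pdivrMr// mul1r gerBl.
exists F; split.
- split => //; split.
  + exact: Cc_smooth_W01p.
  + by move=> x; rewrite precise_Cc.
  exists [set x | c < g x]; split.
  + have /continuousP := smooth_continuous sg.
    by move=> /(_ [set t | c < t]); apply; exact: open_gt.
  + move=> x Kx /=; apply: (lt_le_trans c1); rewrite /g /=.
    apply: le_trans (spos_ge (f x) d0); rewrite lerD2r; exact: fK.
  + move=> x /= cgx; rewrite precise_Cc// /F /w /= spos_le0 ?subr_le0 ?ltW//.
    by rewrite subr0 mulVf// gt_eqF.
- exact: is_weak_gradient_Cc.
move=> u u1.
pose s x := A^-1 * (dspos d (c - g x) * dspos d (f x)).
have gradF x : grad F x = s x *: grad f x.
  rewrite /F (gradZ _ x sAw) (gradB x (smooth_cst A) sw) (grad_spos x d0 scg).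
  rewrite (gradB x (smooth_cst c) sg) (grad_spos x d0 sf).
  have cst0 z : grad (cst z : V -> R) x = 0.
    by apply/rowP => i; rewrite !mxE /partial derive_cst.
  by rewrite !cst0 !sub0r !scalerN opprK !scalerA /s mulrA.
have sb x : 0 <= s x <= b.
  have e0 := dspos_ge0 (c - g x) d0; have e1 := dspos_le1 (c - g x) d0.
  have e2 := dspos_ge0 (f x) d0; have e3 := dspos_le1 (f x) d0.
  have A1 : 0 <= A^-1 by rewrite invr_ge0 ltW.
  rewrite /s !mulr_ge0//=; apply: le_trans AV.
  by rewrite ler_piMr//; exact: mulr_ile1.
have h2 := directional_energy_scale tau p1 u sf (Cc_smooth_smooth cF) sb gradF.
apply: (le_trans h2); rewrite bp; apply: lee_wpmul2l.
  by rewrite lee_fin ltW// (lt_trans _ b1).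
by rewrite leeDl// lee_fin ltW.
Qed.

Lemma class_F_sub_E : F_ `<=` E_.
Proof.
move=> f [Wf f01 [U [_ KU fU]]]; split => // x; rewrite indicE.
by case: (boolP (x \in K)) => [/set_mem/KU/fU -> //|_]; have /andP[] := f01 x.
Qed.

End affine_capacity.

Theorem theorem3p3 (R : realType) (n : nat) (p tau : R) (K : set 'rV[R]_n)
    (p_ge1 : 1 <= p) (p_ltn : p < n%:R) (K_compact : compact K)
    (tau_range : -1 <= tau <= 1) :
  [/\ capacity p tau K
        = ereal_inf (affine_energy p tau @` (@Cc_smooth R n `&` class_D p K)),
      ereal_inf (affine_energy p tau @` (@Cc_smooth R n `&` class_D p K))
        = ereal_inf (affine_energy p tau @` (@Cc_smooth R n `&` class_E p K)) &
      ereal_inf (affine_energy p tau @` (@Cc_smooth R n `&` class_E p K))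
        = ereal_inf (affine_energy p tau @` (@Cc_smooth R n `&` class_F p K))].
Proof.
set iD := ereal_inf (affine_energy p tau @` (@Cc_smooth R n `&` class_D p K)).
set iE := ereal_inf (affine_energy p tau @` (@Cc_smooth R n `&` class_E p K)).
set iF := ereal_inf (affine_energy p tau @` (@Cc_smooth R n `&` class_F p K)).
(* The four infima are joined in a cycle iD <= capacity <= iE <= iF <= iD, in which the two middle
   inequalities are inclusions of classes. *)
have DC : (iD <= capacity p tau K)%E.
  by apply: le_ereal_inf_tmp => _ [g Eg <-]; exact: inf_D_le_E.
have CE : (capacity p tau K <= iE)%E.
  by apply: ereal_inf_le_tmp; apply: image_subset => f [].
have EF : (iE <= iF)%E.
  apply: ereal_inf_le_tmp; apply: image_subset => f [cf Ff]; split => //.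
  exact: class_F_sub_E.
have FD : (iF <= iD)%E.
  by apply: le_ereal_inf_tmp => _ [f [cf Df] <-]; exact: inf_F_le_D.
split; apply/eqP; rewrite eq_le.
- by rewrite DC andbT (le_trans CE)// (le_trans EF).
- by rewrite (le_trans DC)//= (le_trans EF).
- by rewrite EF/= (le_trans FD)// (le_trans DC).
Qed.
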